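(* Let $(A,G,\rho,\sigma)$ be a twisted dynamical system with $A$ a unital $C^*$-algebra and $G$ a discrete group, let $(\mathcal{A},H,D,\pi,U)$ be a $G$-equivariant odd spectral triple over $A$ with $\pi$ faithful, the twisted action being smooth, and let $\ell:G\to\mathbb{B}_h(V)$ be a proper translation bounded function, $V$ a finite dimensional Hilbert space. Put $\Delta=1+D^2$ on $H$. (1) If the spectral triples $(\mathcal{B},H,D)$ and $(C_c(G),\ell^2(G)\otimes V,M_\ell)$ are regular, then the spectral triple $(C_c(G,\mathcal{A}),\widetilde H,\widetilde D,\hat\pi\times\hat L)$ on $A\rtimes_r^{\rho,\sigma}G$ of the equivariant construction is regular. (2) Let $(\mathcal{A},H,D)$ be regular and suppose $U_g\in\mathrm{Op}^0(\Delta)$ for every $g\in G$. Assume further that $[D,U_g]\in\mathrm{Op}^0(\Delta)$ for every $g\in G$ and that for every positive integer $k$ and every $g\in G$ $$\underbrace{[\Delta,[\Delta,\dots[\Delta}_{k\text{ times}},U_g]\dots]]\in\mathrm{Op}^k(\Delta)\quad\text{and}\quad\underbrace{[\Delta,[\Delta,\dots[\Delta}_{k\text{ times}},[D,U_g]]\dots]]\in\mathrm{Op}^k(\Delta).\qquad(\ast)$$ Then the spectral triple $(\mathcal{B},H,D)$ is regular. (3) Conversely, if $(\mathcal{B},H,D)$ is regular, then $(\mathcal{A},H,D)$ is regular, and $U_g\in\mathrm{Op}^0(\Delta)$, $[D,U_g]\in\mathrm{Op}^0(\Delta)$ and $(\ast)$ hold for every $g\in G$ and every positive integer $k$.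
   Context: All Hilbert spaces and $C^*$-algebras are separable; all algebras are complex and unital. Twisted dynamical system: $\rho:G\to\mathrm{Aut}(A)$, $\sigma:G\times G\to U(A)$ with $\rho_x(\sigma_{y,z})=\sigma_{x,y}\sigma_{xy,z}\sigma_{x,yz}^*$, $\rho_x\rho_y=\mathrm{Ad}(\sigma_{x,y})\rho_{xy}$, $\sigma_{x,e}=\sigma_{e,x}=1$, $\rho_e=\mathrm{id}_A$. Smooth means $\rho_x\in\mathrm{Aut}(\mathcal{A})$ and $\sigma_{x,y}\in U(\mathcal{A})$. A twisted covariant representation $(\pi,U)$ on $H$: a non-degenerate representation $\pi$ of $A$ and $U:G\to U(H)$ with $U_xU_y=\pi(\sigma_{x,y})U_{xy}$, $\pi\circ\rho_x=\mathrm{Ad}(U_x)\circ\pi$. $C_c(G,A)$ is a $*$-algebra via $(a\delta_x)\star(b\delta_y)=a\rho_x(b)\sigma_{x,y}\delta_{xy}$, $(a\delta_x)^*=\sigma_{x^{-1},x}^*\rho_{x^{-1}}(a^* )\delta_{x^{-1}}$; $A\rtimes^{\rho,\sigma}G$ is its universal (enveloping) $C^*$-algebra, with integrated form $(\pi\times U)(a\delta_g)=\pi(a)U_g$. $A\rtimes_r^{\rho,\sigma}G$ is the image of $A\rtimes^{\rho,\sigma}G$ under the left regular representation $a\delta_x:\xi\otimes\delta_y\mapsto\pi(\rho_{y^{-1}x^{-1}}(a)\sigma_{y^{-1}x^{-1},x})\xi\otimes\delta_{xy}$ on $H\otimes\ell^2(G)$ for a faithful $\pi$. Odd spectral triple $(\mathcal{A},H,D)$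 with representation $\pi$: dense $*$-subalgebra $\mathcal{A}\subseteq A$, self-adjoint $D$ on $H$ with $(1+D^2)^{-1/2}$ compact, $\pi(a)\mathrm{Dom}(D)\subseteq\mathrm{Dom}(D)$ and $[D,\pi(a)]$ bounded for $a\in\mathcal{A}$. It is $G$-equivariant if there is $U:G\to U(H)$ with $(\pi,U)$ twisted covariant, each $U_g$ leaving $\mathrm{Dom}(D)$ invariant and $[D,U_g]$ extending to a bounded operator. $\ell:G\to\mathbb{B}_h(V)$ (self-adjoint operators on $V$) is translation bounded if $x\mapsto\ell(x)-\ell(y^{-1}x)$ is bounded for each $y$; proper if $\ell(g)=0$ iff $g=e$, $\bigcup_x\mathrm{Sp}\,\ell(x)$ is a discrete subset of $\mathbb{R}$ (finite intersection with every bounded interval), and each $t$ in this union belongs to $\mathrm{Sp}\,\ell(x)$ for only finitely many $x$. $M_\ell(\delta_x\otimes v)=\delta_x\otimes\ell(x)v$ on $\ell^2(G)\otimes V$, on which $C_c(G)=\mathbb{C}G$ acts by $\lambda(\delta_g)(\delta_x\otimes v)=\delta_{gx}\otimes v$; this gives a spectral triple on $C_r^*(G)$. $B\subset\mathbb{B}(H)$ is the image of $A\rtimes^{\rho,\sigma}G$ under $\pi\times U$, and $\mathcal{B}\subset B$ is the $*$-algebra of finite sums $\sum_g\pi(a_g)U_g$, $a_g\in\mathcal{A}$; $(\mathcal{B},H,D)$ is a spectral triple on $B$. Equivariant construction: $\widetilde H=(H\otimes\ell^2(G)\otimes V)\oplus(H\otimes\ell^2(G)\otimes V)$, the representation $\hat\pi\times\hat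 L$ is two copies of $a\delta_h:\xi\otimes\delta_x\otimes v\mapsto\pi(a)U_h\xi\otimes\delta_{hx}\otimes v$, and $\widetilde D$ is the closure of $$\begin{pmatrix}0&D\otimes1\otimes1_V-i1_H\otimes M_\ell\\ D\otimes1\otimes1_V+i1_H\otimes M_\ell&0\end{pmatrix}.$$ Regularity: for a spectral triple $(\mathcal{A},H,D)$ let $\delta(T)=[|D|,T]$ with domain $\mathrm{Dom}(\delta)$ the set of $T\in\mathbb{B}(H)$ preserving $\mathrm{Dom}(|D|)$ such that $[|D|,T]$ extends to a bounded operator; $\mathrm{Dom}(\delta^k)=\{T\in\mathrm{Dom}(\delta):\delta(T)\in\mathrm{Dom}(\delta^{k-1})\}$; $\mathrm{Dom}^\infty(\delta)=\bigcap_k\mathrm{Dom}(\delta^k)$. The triple is regular if $\pi(\mathcal{A})$ and $[D,\pi(\mathcal{A})]$ are contained in $\mathrm{Dom}^\infty(\delta)$. Sobolev spaces: for $s\in\mathbb{R}$, $W^s$ is the completion of $\mathrm{Dom}(\Delta^{s/2})$ for the inner product $\langle\Delta^{s/2}\xi,\Delta^{s/2}\eta\rangle_H$; $W^\infty=\bigcap_sW^s=\bigcap_n\mathrm{Dom}(\Delta^n)$. $\mathrm{Op}^t(\Delta)$ is the space of linear maps $P:W^\infty\to W^\infty$ which extend by continuity to bounded operators $W^{s+t}\to W^s$ for every $s\in\mathbb{R}$. A bounded operator on $H$ (such as $U_g$ or the closure of $[D,U_g]$) belongs to $\mathrm{Op}^0(\Delta)$ if it maps $W^\infty$ to itself and its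 restriction to $W^\infty$ is in $\mathrm{Op}^0(\Delta)$. *)

(* Defs.v *)
From HB Require Import structures.
From mathcomp Require Import all_boot all_order all_algebra.
From mathcomp Require Import all_classical all_reals all_analysis.
From mathcomp Require Import complex.

Set Implicit Arguments.
Unset Strict Implicit.
Unset Printing Implicit Defensive.

Import Order.TTheory GRing.Theory Num.Theory.
Import numFieldNormedType.Exports.

Local Open Scope classical_set_scope.
Local Open Scope ring_scope.

(* Inner products are linear in the first variable. *)
HB.mixin Record isHilbert (R : realType) H of CompleteNormedModule R[i] H := {
  dot : H -> H -> R[i];
  dotDZl : forall (a : R[i]) (x y z : H),
    dot (a *: x + y) z = a * dot x z + dot y z;
  dotC : forall x y : H, dot x y = (dot y x)^*;
  dot_norm : forall x : H, dot x x = `|x| ^+ 2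
}.

#[short(type="hilbertType")]
HB.structure Definition Hilbert (R : realType) :=
  { H of CompleteNormedModule R[i] H & isHilbert R H }.

(* HB cannot join the ring structures, of which numDomainType is an instance,
   with normed modules, hence a separate product amul and unit aone. *)
HB.mixin Record isCstarAlgebra (R : realType) A
    of CompleteNormedModule R[i] A := {
  amul : A -> A -> A;
  aone : A;
  star : A -> A;
  amulA : associative amul;
  amul1l : left_id aone amul;
  amul1r : right_id aone amul;
  amulDZl : forall (c : R[i]) (a b d : A),
    amul (c *: a + b) d = c *: amul a d + amul b d;
  amulDZr : forall (c : R[i]) (a b d : A),
    amul d (c *: a + b) = c *: amul d a + amul d b;
  starDZ : forall (c : R[i]) (a b : A),
    star (c *: a + b) = c^* *: star a + star b;
  starM : forall a b : A, star (amul a b) = amul (star b) (star a);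
  starK : involutive star;
  norm_amul_le : forall a b : A, `|amul a b| <= `|a| * `|b|;
  norm_starM : forall a : A, `|amul (star a) a| = `|a| ^+ 2
}.

#[short(type="cstarType")]
HB.structure Definition CstarAlgebra (R : realType) :=
  { A of CompleteNormedModule R[i] A & isCstarAlgebra R A }.

Notation "a ** b" := (amul a b) (at level 40, left associativity) : ring_scope.

Definition separable_space (T : topologicalType) : Prop :=
  exists S : set T, countable S /\ dense S.

Definition lin_span (K : pzRingType) (E : lmodType K) (S : set E) : set E :=
  [set x | exists n (c : 'I_n -> K) (v : 'I_n -> E),
     (forall j, S (v j)) /\ x = \sum_j c j *: v j].

Section Operators.
Context {R : realType}.
Implicit Types H K : hilbertType R.

Definition bounded_by H K (T : H -> K) (M : R[i]) : Prop :=
  forall x, `|T x| <= M * `|x|.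

Definition bounded_op H K (T : H -> K) : Prop :=
  linear T /\ exists M, bounded_by T M.

Definition unitary_op H (T : H -> H) : Prop :=
  [/\ linear T, forall x y, dot (T x) (T y) = dot x y
    & forall y, exists x, T x = y].

Definition compact_op H (T : H -> H) : Prop :=
  bounded_op T /\ compact (closure (T @` [set x | `|x| <= 1])).

(* Unbounded operators are represented by their graphs. *)
Definition graph H := set (H * H)%type.

Definition dom H (D : graph H) : set H := [set x | exists y, D (x, y)].

Definition app H (D : graph H) (x : H) : H := xget 0 [set y | D (x, y)].

(* The closure of the linear extension of an assignment x |-> y, given by its
   set of pairs (x, y). *)
Definition clspan H (S : graph H) : graph H := closure (lin_span S).

Definition self_adjoint H (D : graph H) : Prop :=
  dense (dom D) /\
  forall x y, D (x, y) <-> (forall u v, D (u, v) -> dot v x = dot u y).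

Definition Delta H (D : graph H) : graph H :=
  [set p | exists y z, [/\ D (p.1, y), D (y, z) & p.2 = p.1 + z]].

(* The witness T is (1 + D^2)^(-1/2), the positive square root of the inverse
   of 1 + D^2. *)
Definition compact_resolvent H (D : graph H) : Prop :=
  exists T : H -> H,
    [/\ compact_op T, forall x, 0 <= dot (T x) x
      & forall x y, Delta D (x, y) <-> x = T (T y)].

(* Functional calculus f(E) of a self-adjoint operator E having an orthonormal
   basis of eigenvectors, in particular of E with compact resolvent: the
   closure of the operator acting as f(t) on the t-eigenspace. *)
Definition fcalc H (E : graph H) (f : R -> R) : graph H :=
  clspan [set p | exists t : R,
    E (p.1, (t%:C)%C *: p.1) /\ p.2 = (f t)%:C%C *: p.1].

Definition absop H (D : graph H) : graph H := fcalc D (fun t => `|t|).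

(* Delta^(s/2) *)
Definition Delta_pow H (D : graph H) (s : R) : graph H :=
  fcalc (Delta D) (fun t => t `^ (s / 2)).

(* T preserves Dom(N) and [N, T] extends to a bounded operator. *)
Definition bounded_comm H (N : graph H) (T : H -> H) : Prop :=
  (forall x, dom N x -> dom N (T x)) /\
  exists M : R[i], forall x, dom N x ->
    `|app N (T x) - T (app N x)| <= M * `|x|.

(* The closure of [N, T], as a total function; it is the bounded extension of
   [N, T] when N is densely defined and bounded_comm N T holds. *)
Definition comm_closure H (N : graph H) (T : H -> H) : H -> H :=
  app (closure [set (x, app N (T x) - T (app N x)) | x in dom N]).

(* An algebra of operators on H is given by its set of elements. *)
Definition star_algebra H (B : set (H -> H)) : Prop :=
  [/\ forall T, B T -> bounded_op T,
      B id,
      forall (c : R[i]) S T, B S -> B T -> B (fun x => c *: S x + T x),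
      forall S T, B S -> B T -> B (S \o T)
    & forall S, B S -> exists2 T, B T & forall x y, dot (S x) y = dot x (T y)].

(* (B, H, D) is an odd spectral triple on the norm closure of B. *)
Definition spectral_triple H (B : set (H -> H)) (D : graph H) : Prop :=
  [/\ star_algebra B, self_adjoint D, compact_resolvent D
    & forall T, B T -> bounded_comm D T].

(* T belongs to Dom(delta^k), delta = [N, .] *)
Fixpoint dom_delta H (N : graph H) (k : nat) (T : H -> H) : Prop :=
  bounded_op T /\
  if k is k'.+1 then bounded_comm N T /\ dom_delta N k' (comm_closure N T)
  else True.

Definition dom_delta_infty H (N : graph H) (T : H -> H) : Prop :=
  forall k, dom_delta N k T.

Definition regular_spectral_triple H (B : set (H -> H)) (D : graph H) : Prop :=
  spectral_triple B D /\
  forall T, B T ->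
    dom_delta_infty (absop D) T /\ dom_delta_infty (absop D) (comm_closure D T).

Definition W_infty H (D : graph H) : set H :=
  [set x | forall s : R, dom (Delta_pow D s) x].

(* Only the restriction of P to W_infty matters. Since W_infty is dense in
   every W^s, P extends by continuity to a bounded operator W^(s+t) -> W^s iff
   it is bounded on W_infty for the two norms. *)
Definition Op H (D : graph H) (t : R) (P : H -> H) : Prop :=
  [/\ forall x, W_infty D x -> W_infty D (P x),
      forall (a : R[i]) x y, W_infty D x -> W_infty D y ->
        P (a *: x + y) = a *: P x + P y
    & forall s : R, exists M : R[i], forall x, W_infty D x ->
        `|app (Delta_pow D s) (P x)| <= M * `|app (Delta_pow D (s + t)) x|].

(* [Delta, P], meaningful on W_infty when P preserves W_infty *)
Definition ad_Delta H (D : graph H) (P : H -> H) : H -> H :=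
  fun x => app (Delta D) (P x) - P (app (Delta D) x).

(* Models of l^2(G), of Hilbert tensor products and of orthogonal direct sums;
   they are unique up to a unique unitary compatible with the structure maps. *)
Record ell2 (G : eqType) := Ell2 {
  ell2_space :> hilbertType R;
  delta : G -> ell2_space;
  dot_delta : forall x y, dot (delta x) (delta y) = (x == y)%:R;
  delta_total : dense (lin_span (range delta))
}.

Record hilbert_tensor H K := HilbertTensor {
  tensor_space :> hilbertType R;
  tens : H -> K -> tensor_space;
  tens_linear_l : forall y, linear (tens^~ y);
  tens_linear_r : forall x, linear (tens x);
  dot_tens : forall x y x' y',
    dot (tens x y) (tens x' y') = dot x x' * dot y y';
  tens_total : dense (lin_span [set z | exists x y, z = tens x y])
}.

Record hilbert_sum H K := HilbertSum {
  sum_space :> hilbertType R;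
  inj1 : H -> sum_space;
  inj2 : K -> sum_space;
  inj1_linear : linear inj1;
  inj2_linear : linear inj2;
  dot_inj1 : forall x x', dot (inj1 x) (inj1 x') = dot x x';
  dot_inj2 : forall y y', dot (inj2 y) (inj2 y') = dot y y';
  dot_inj12 : forall x y, dot (inj1 x) (inj2 y) = 0;
  sum_total : forall z, exists x y, z = inj1 x + inj2 y
}.

End Operators.

Section Twisted.
Context {R : realType} {A : cstarType R} {G : groupType}.

Definition dense_star_subalgebra (calA : set A) : Prop :=
  [/\ dense calA, calA aone,
      forall (c : R[i]) a b, calA a -> calA b -> calA (c *: a + b),
      forall a b, calA a -> calA b -> calA (a ** b)
    & forall a, calA a -> calA (star a)].

Definition unitary_elt (u : A) : Prop :=
  star u ** u = aone /\ u ** star u = aone.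

Definition star_automorphism (f : A -> A) : Prop :=
  [/\ linear f, forall a b, f (a ** b) = f a ** f b,
      forall a, f (star a) = star (f a) & bijective f].

Definition twisted_dynamical_system
    (rho : G -> A -> A) (sigma : G -> G -> A) : Prop :=
  [/\ (forall x, star_automorphism (rho x)) /\
        (forall x y, unitary_elt (sigma x y)),
      forall x y z, rho x (sigma y z) =
        sigma x y ** sigma (x * y)%g z ** star (sigma x (y * z)%g),
      forall x y a, rho x (rho y a) =
        sigma x y ** rho (x * y)%g a ** star (sigma x y),
      forall x, sigma x 1%g = aone /\ sigma 1%g x = aone
    & forall a, rho 1%g a = a].

Definition smooth (calA : set A)
    (rho : G -> A -> A) (sigma : G -> G -> A) : Prop :=
  (forall x, rho x @` calA = calA) /\ (forall x y, calA (sigma x y)).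

Definition representation (H : hilbertType R) (pi : A -> H -> H) : Prop :=
  [/\ forall a, bounded_op (pi a),
      forall (c : R[i]) a b x, pi (c *: a + b) x = c *: pi a x + pi b x,
      forall a b x, pi (a ** b) x = pi a (pi b x),
      forall a x y, dot (pi (star a) x) y = dot x (pi a y)
    & dense (lin_span [set z | exists a x, z = pi a x])].

Definition covariant_representation (rho : G -> A -> A) (sigma : G -> G -> A)
    (H : hilbertType R) (pi : A -> H -> H) (U : G -> H -> H) : Prop :=
  [/\ representation pi,
      forall x, unitary_op (U x),
      forall x y v, U x (U y v) = pi (sigma x y) (U (x * y)%g v)
    & forall x a v, pi (rho x a) (U x v) = U x (pi a v)].

Definition equivariant_spectral_triple
    (rho : G -> A -> A) (sigma : G -> G -> A) (calA : set A)
    (H : hilbertType R) (D : graph H) (pi : A -> H -> H) (U : G -> H -> H) :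
    Prop :=
  [/\ dense_star_subalgebra calA,
      spectral_triple (pi @` calA) D,
      covariant_representation rho sigma pi U
    & forall g, bounded_comm D (U g)].

End Twisted.

Definition Cc (G : choiceType) (E : zmodType) (S : set E) : set (G -> E) :=
  [set f | finite_set [set g | f g != 0] /\ forall g, S (f g)].

Section Construction.
Context {R : realType} {A : cstarType R} {G : groupType}.
Variables (rho : G -> A -> A) (sigma : G -> G -> A).
Variables (H : hilbertType R) (pi : A -> H -> H) (U : G -> H -> H).

Definition integrated (f : G -> A) : H -> H :=
  fun xi => \sum_(g \in [set: G]) pi (f g) (U g xi).

Definition calB (calA : set A) : set (H -> H) :=
  integrated @` Cc calA.

Section Reduced.
Variables (l2 : ell2 (R := R) G) (HG : hilbert_tensor H l2).

(* The image of a delta_x under the left regular representation *)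
Definition regular_monomial (a : A) (x : G) : HG -> HG :=
  app (clspan [set p | exists xi y, p =
    (tens HG xi (delta l2 y),
     tens HG
       (pi (rho (y^-1 * x^-1)%g a ** sigma (y^-1 * x^-1)%g x) xi)
       (delta l2 (x * y)%g))]).

Definition left_regular (f : G -> A) : HG -> HG :=
  fun z => \sum_(g \in [set: G]) regular_monomial (f g) g z.

End Reduced.

Section LengthTriple.
Variables (V : hilbertType R) (ell : G -> V -> V).
Variables (l2 : ell2 (R := R) G) (L : hilbert_tensor l2 V).

Definition Mell : graph L :=
  clspan [set p | exists x v, p =
    (tens L (delta l2 x) v, tens L (delta l2 x) (ell x v))].

Definition lambda (g : G) : L -> L :=
  app (clspan [set p | exists x v, p =
    (tens L (delta l2 x) v, tens L (delta l2 (g * x)%g) v)]).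

Definition lambda_Cc : set (L -> L) :=
  [set T | exists2 c : G -> R[i], Cc setT c
     & T = fun z => \sum_(g \in [set: G]) c g *: lambda g z].

Section Equivariant.
Variables (D : graph H) (K : hilbert_tensor H L) (HH : hilbert_sum K K).

Definition hat_monomial (a : A) (h : G) : HH -> HH :=
  app (clspan [set p | exists xi x v,
    let z := tens K xi (tens L (delta l2 x) v) in
    let w := tens K (pi a (U h xi)) (tens L (delta l2 (h * x)%g) v) in
    p = (inj1 HH z, inj1 HH w) \/ p = (inj2 HH z, inj2 HH w)]).

Definition hat_rep (f : G -> A) : HH -> HH :=
  fun z => \sum_(g \in [set: G]) hat_monomial (f g) g z.

Definition D_tilde : graph HH :=
  clspan [set p | exists xi xi' eta eta', [/\ D (xi, xi'), Mell (eta, eta') &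
    p = (inj1 HH (tens K xi eta),
         inj2 HH (tens K xi' eta + 'i%C *: tens K xi eta')) \/
    p = (inj2 HH (tens K xi eta),
         inj1 HH (tens K xi' eta - 'i%C *: tens K xi eta'))]].

End Equivariant.
End LengthTriple.
End Construction.
Arguments left_regular {R A G} rho sigma {H} pi {l2} HG f z.
Arguments Mell {R G V} ell {l2} L.
Arguments lambda_Cc {R G V l2} L.
Arguments hat_rep {R A G H} pi U {V l2 L K} HH f z.
Arguments D_tilde {R G H V} ell {l2 L} D {K} HH.

Section Length.
Context {R : realType} {G : groupType} {V : hilbertType R}.

Definition finite_dimensional : Prop :=
  exists n (b : 'I_n -> V), lin_span (range b) = setT.

Definition hermitian_op (T : V -> V) : Prop :=
  bounded_op T /\ forall v w, dot (T v) w = dot v (T w).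

(* The real part of the spectrum, which is all of it for Hermitian T *)
Definition spectrum (T : V -> V) : set R :=
  [set t | ~ bijective (fun v => T v - (t%:C)%C *: v)].

Definition translation_bounded (ell : G -> V -> V) : Prop :=
  forall y, exists M, forall x,
    bounded_by (fun v => ell x v - ell (y^-1 * x)%g v) M.

Definition proper_length (ell : G -> V -> V) : Prop :=
  [/\ forall g, (forall v, ell g v = 0) <-> g = 1%g,
      forall a b : R,
        finite_set ([set t | exists x, spectrum (ell x) t] `&` `[a, b])
    & forall t : R, finite_set [set x | spectrum (ell x) t]].

End Length.
Arguments finite_dimensional {R} V.

(* Main.v *)
Require Import Defs.
From mathcomp Require Import all_boot all_order all_algebra.
From mathcomp Require Import all_classical all_reals all_analysis.
From mathcomp Require Import complex finmap.
From mathcomp Require Import ring lra.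

Set Implicit Arguments.
Unset Strict Implicit.
Unset Printing Implicit Defensive.

Import Order.TTheory GRing.Theory Num.Theory.
Import numFieldNormedType.Exports.
Local Open Scope classical_set_scope.
Local Open Scope ring_scope.

(* In an orthonormal basis of eigenvectors of D, with eigenvalues d i, an
   operator X is a matrix and [|D|, .]^k multiplies its entries by
   (|d i| - |d j|)^k; up to a bounded perturbation |d i| may be replaced by
   n i = sqrt(1 + d i ^ 2). The matrix of ad_Delta^k(X), weighted symmetrically
   by Delta^(-k/4) on both sides, has entries
   ((n i - n j) (b i / b j + b j / b i))^k X i j with b i = sqrt(n i), and
   b i b j / (b i ^ 2 + b j ^ 2) is a Schur multiplier. Hence X lies in
   Dom^infty([|D|, .]) iff all these weighted commutators are bounded, iff
   ad_Delta^k(X) has order k for every k; this gives (2) and (3), since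
   regularity passes to sums and products of operators.
   For (1), Dtilde^2 = D^2 (x) 1 + 1 (x) M^2, so that the weighted commutators
   of P (x) Q are binomial sums of tensor products of those of P and Q, with
   contractions as coefficients. That the equivariant construction represents
   the reduced crossed product is Fell's absorption principle. *)

(** * Boundedness of matrices and Schur multipliers *)

Section Forms.
Context {R : realType}.
Local Notation C := (R[i]).

(** With operators turned into matrices, every claim says that a certain multiplier preserves
    bounded matrices; domain questions are settled once, in [bounded_comm_mx]. The obstacle is that
    dividing by [n i + n j], which recovers a commutator with N = diag n from one with N^2, is not a
    product [g i * h j]. After multiplication by [b i * b j] it is harmless, because the Cauchy
    kernel is positive with a controlled diagonal; this dictates the symmetric weight. In the other
    direction the ratio [b i / b j] is unbounded, but [n i / n j = 1 + (n i - n j) / n j] trades it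
    for one more commutator, so the equivalence is proved for all orders at once. The factor 1/2 in
    the bound of the multiplier is used again for real Sobolev exponents: thanks to it the midpoint
    of two exponents inherits their common constant. In (1) the operator [D_tilde] is not diagonal
    in the tensor basis, but its absolute value is, since [D_tilde] squares to a scalar on each pair
    of corresponding basis vectors. The commutator with [D_tilde] itself is computed on generators
    of its graph. *)

Definition sqn (z : C) : R := complex.Re z ^+ 2 + complex.Im z ^+ 2.

Lemma sqn_ge0 z : 0 <= sqn z.
Proof. by rewrite addr_ge0 ?sqr_ge0. Qed.

Lemma sqn0 : sqn 0 = 0.
Proof. by rewrite /sqn /= expr0n addr0. Qed.

Lemma sqnM z w : sqn (z * w) = sqn z * sqn w.
Proof. by case: z w => [a b] [c d]; rewrite /sqn /=; ring. Qed.

Lemma sqn_real (x : R) : sqn x%:C%C = x ^+ 2.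
Proof. by rewrite /sqn /= expr0n addr0. Qed.

Lemma sqnJ (z : C) : sqn z^* = sqn z.
Proof. by case: z => [a b]; rewrite /sqn /= sqrrN. Qed.

Lemma mulcJ (z : C) : z * z^* = (sqn z)%:C%C.
Proof. by case: z => [a b]; apply/eqP; rewrite eq_complex /sqn /=; apply/andP; split; apply/eqP; ring. Qed.

Lemma ReJ (z : C) : complex.Re z^* = complex.Re z.
Proof. by case: z. Qed.

Lemma sqn_eq0 (z : C) : (sqn z == 0) = (z == 0).
Proof.
case: z => [a b]; rewrite /sqn eq_complex /= paddr_eq0 ?sqr_ge0 //.
by rewrite !sqrf_eq0.
Qed.

Lemma normc_sqn (z : C) : `|z| ^+ 2 = (sqn z)%:C%C.
Proof. by rewrite sqr_normc -mulcJ. Qed.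

Lemma Re_sum I (s : seq I) (F : I -> C) :
  complex.Re (\sum_(i <- s) F i) = \sum_(i <- s) complex.Re (F i).
Proof.
by elim: s => [|i s IH]; rewrite ?big_nil // !big_cons -IH; case: (F i) (\sum_(_ <- _) _) => [a b] [c d].
Qed.

Lemma ReM_real (x : R) (z : C) : complex.Re (x%:C%C * z) = x * complex.Re z.
Proof. by case: z => a b /=; rewrite mul0r subr0. Qed.

Definition sqs (I : Type) (s : seq I) (c : I -> C) : R := \sum_(i <- s) sqn (c i).

Lemma sqs_ge0 I (s : seq I) c : 0 <= sqs s c.
Proof. by apply: sumr_ge0 => i _; exact: sqn_ge0. Qed.

Lemma sqsZ I (s : seq I) (x : R) c : sqs s (fun i => x%:C%C * c i) = x ^+ 2 * sqs s c.
Proof. by rewrite mulr_sumr; apply: eq_bigr => i _; rewrite sqnM sqn_real. Qed.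

Lemma sqs_mul_le I (s : seq I) (g c : I -> C) B : (forall i, sqn (g i) <= B) ->
  sqs s (fun i => g i * c i) <= B * sqs s c.
Proof.
move=> gB; rewrite mulr_sumr; apply: ler_sum => i _.
by rewrite sqnM ler_wpM2r ?sqn_ge0.
Qed.

(** Bilinear on purpose: conjugating [c'] does not change [sqs], so the bounds are those of the
    sesquilinear form, and conjugates appear only where the form is compared with [dot]. *)
Definition mform I J (a : I -> J -> C) (s : seq I) (t : seq J) c c' : C :=
  \sum_(i <- s) \sum_(j <- t) a i j * c j * c' i.

(* Bounding real parts and a sum of squares is, up to a factor of two and after
   rescaling c and c', the usual bound of a sesquilinear form. *)
Definition bddM (I J : eqType) (M : R) (a : I -> J -> C) : Prop :=
  0 <= M /\ forall s t c c', uniq s -> uniq t ->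
    complex.Re (mform a s t c c') <= M * (sqs t c + sqs s c').

Definition bdd (I J : eqType) (a : I -> J -> C) : Prop := exists M, bddM M a.

Definition smul I J (m : I -> J -> R) (a : I -> J -> C) : I -> J -> C :=
  fun i j => (m i j)%:C%C * a i j.

Section Bdd.
Context {I J : eqType}.
Implicit Types (a b : I -> J -> C) (m : I -> J -> R).

Lemma bdd_ext a b : (forall i j, a i j = b i j) -> bdd a -> bdd b.
Proof.
by move=> ab; suff -> : b = a by []; apply/funext => i; apply/funext => j.
Qed.

Lemma mform_mul a s t (g : I -> C) (h : J -> C) c c' :
  mform (fun i j => g i * a i j * h j) s t c c' =
  mform a s t (fun j => h j * c j) (fun i => g i * c' i).
Proof. by apply: eq_bigr => i _; apply: eq_bigr => j _; ring. Qed.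

Lemma bddM_le M M' a : M <= M' -> bddM M a -> bddM M' a.
Proof.
move=> MM' [M0 aM]; split; first exact: le_trans MM'.
move=> s t c c' us ut; apply: (le_trans (aM s t c c' us ut)).
by rewrite ler_wpM2r // addr_ge0 ?sqs_ge0.
Qed.

Lemma bdd_mul a (g : I -> C) (h : J -> C) B : (forall i, sqn (g i) <= B) ->
  (forall j, sqn (h j) <= B) -> bdd a -> bdd (fun i j => g i * a i j * h j).
Proof.
move=> gB hB [M [M0 aM]].
exists (M * `|B|); split => [|s t c c' us ut]; first by rewrite mulr_ge0.
rewrite mform_mul; apply: (le_trans (aM _ _ _ _ us ut)).
rewrite -mulrA ler_wpM2l // mulrDr lerD //.
  by apply: sqs_mul_le => j; apply: (le_trans (hB j)); rewrite ler_norm.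
by apply: sqs_mul_le => i; apply: (le_trans (gB i)); rewrite ler_norm.
Qed.

Lemma bddM_add M N a b : bddM M a -> bddM N b ->
  bddM (M + N) (fun i j => a i j + b i j).
Proof.
move=> [M0 aM] [N0 bN]; split => [|s t c c' us ut]; first by rewrite addr_ge0.
have -> : mform (fun i j => a i j + b i j) s t c c' =
    mform a s t c c' + mform b s t c c'.
  rewrite /mform -big_split /=; apply: eq_bigr => i _.
  by rewrite -big_split /=; apply: eq_bigr => j _; rewrite -!mulrA -mulrDl.
by rewrite raddfD /= mulrDl lerD ?aM ?bN.
Qed.

Lemma bdd_add a b : bdd a -> bdd b -> bdd (fun i j => a i j + b i j).
Proof. by move=> [M aM] [N bN]; exists (M + N); exact: bddM_add. Qed.

Lemma bdd0 : bdd (fun (_ : I) (_ : J) => 0).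
Proof.
exists 0; split=> // s t c c' _ _; rewrite mul0r /mform big1 // => i _.
by rewrite big1 // => j _; rewrite !mul0r.
Qed.

Lemma bdd_sum K (r : seq K) (a : K -> I -> J -> C) : (forall k, bdd (a k)) ->
  bdd (fun i j => \sum_(k <- r) a k i j).
Proof.
move=> ba; elim: r => [|k r IH].
  by apply: bdd_ext bdd0 => i j; rewrite big_nil.
by apply: bdd_ext (bdd_add (ba k) IH) => i j; rewrite big_cons.
Qed.

Lemma bdd_smul_mul a (g : I -> R) (h : J -> R) B : (forall i, `|g i| <= B) ->
  (forall j, `|h j| <= B) -> bdd a -> bdd (smul (fun i j => g i * h j) a).
Proof.
move=> gB hB ba.
have hyp (x : R) : `|x| <= B -> sqn x%:C%C <= B ^+ 2.
  by move=> xB; rewrite sqn_real -real_normK ?num_real // ler_sqr ?nnegrE //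
     (le_trans _ xB).
apply: bdd_ext (bdd_mul (g := fun i => (g i)%:C%C) (h := fun i => (h i)%:C%C)
  (B := B ^+ 2) _ _ ba) => [i j|i|j]; try exact: hyp.
by rewrite /smul rmorphM /=; ring.
Qed.

Lemma smulA m m' a : smul m (smul m' a) = smul (fun i j => m i j * m' i j) a.
Proof.
by apply/funext => i; apply/funext => j; rewrite /smul rmorphM mulrA.
Qed.

Lemma eq_smul m m' a : (forall i j, m i j = m' i j) -> smul m a = smul m' a.
Proof.
by move=> mm; apply/funext => i; apply/funext => j; rewrite /smul mm.
Qed.

Lemma smul1 a : smul (fun _ _ => 1) a = a.
Proof. by apply/funext => i; apply/funext => j; rewrite /smul mul1r. Qed.

(** Test the form with [c'] equal to [x] times the conjugate of [h], [x] real. This gives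
    [x * S <= M * (q + x ^+ 2 * S)], and the best choice [x = 1 / (2 * M)] yields the constant
    [4 * M ^+ 2]. *)
Lemma bdd_rows M a s t c : bddM M a -> uniq s -> uniq t ->
  sqs s (fun i => \sum_(j <- t) a i j * c j) <= 4 * M ^+ 2 * sqs t c.
Proof.
move=> [M0 aM] us ut; set h := fun i => _.
set S := sqs s h; set q := sqs t c.
have key (x : R) : x * S <= M * (q + x ^+ 2 * S).
  have := aM s t c (fun i => x%:C%C * (h i)^*) us ut.
  rewrite sqsZ /q (_ : sqs s (fun i => (h i)^*) = S); last first.
    by apply: eq_bigr => i _; rewrite sqnJ.
  apply: le_trans; rewrite Re_sum mulr_sumr; apply: ler_sum => i _.
  rewrite -mulr_suml -/(h i) mulrCA mulcJ ReM_real.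
  by rewrite lexx.
have S0 : 0 <= S by exact: sqs_ge0.
have q0 : 0 <= q by exact: sqs_ge0.
have [M0'|Mn] := eqVneq M 0.
  by move: (key 1); rewrite M0' mul1r !mul0r => /le_trans; apply; rewrite expr0n mulr0 mul0r.
have Mp : 0 < M by rewrite lt_def Mn.
move: (key (2 * M)^-1) => kM.
have : S * (2 * M)^-1 - S * (4 * M)^-1 <= M * q.
  rewrite lerBlDr (le_trans _ (le_trans kM _)) //; first by rewrite mulrC.
  by rewrite mulrDr lerD2l le_eqVlt; apply/orP; left; apply/eqP; field.
rewrite (_ : S * (2 * M)^-1 - S * (4 * M)^-1 = S / (4 * M)); last by field.
by rewrite ler_pdivrMr ?mulr_gt0 // => /le_trans; apply; rewrite le_eqVlt; apply/orP; left; apply/eqP; ring.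
Qed.

End Bdd.

Lemma bdd_tr (I J : eqType) (a : I -> J -> C) : bdd a -> bdd (fun j i => a i j).
Proof.
move=> [M [M0 aM]]; exists M; split => // s t c c' us ut.
have := aM t s c' c ut us; rewrite addrC; apply: le_trans.
rewrite /mform exchange_big /= le_eqVlt; apply/orP; left; apply/eqP.
by congr (complex.Re _); apply: eq_bigr => i _; apply: eq_bigr => j _; ring.
Qed.

End Forms.

Section Schur.
Context {R : realType}.
Local Notation C := (R[i]).

Section SchurMultiplier.
Context {I : eqType}.
Implicit Types (a X : I -> I -> C) (b : I -> R).

(* With al i = (a i - p) / (a i + p), the Cauchy kernel K i j = 1 / (a i + a j)
   satisfies K i j = 2 p / ((a i + p) (a j + p)) + al i * al j * K i j, and the
   last term vanishes where a takes the value p; so K is a finite sum of rank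
   one positive kernels on each finite set. *)
Lemma cauchy_kernel M X (a : I -> R) (s t : seq I) : (forall i, 0 < a i) ->
  bddM M X -> uniq s -> uniq t -> forall (r : seq R) c c',
  (forall i, a i \notin r -> c i = 0) -> (forall i, a i \notin r -> c' i = 0) ->
  complex.Re (mform (smul (fun i j => (a i + a j)^-1) X) s t c c') <=
  M * (\sum_(j <- t) sqn (c j) / (2 * a j) + \sum_(i <- s) sqn (c' i) / (2 * a i)).
Proof.
move=> a0 [M0 XM] us ut; elim=> [|p r IH] c c' c0 c'0.
  rewrite /mform big1 => [|i _]; last first.
    by rewrite big1 // => j _; rewrite c0 // mulr0 mul0r.
  by rewrite mulr_ge0 // addr_ge0 // sumr_ge0 // => i _;
    rewrite divr_ge0 ?sqn_ge0 // mulr_ge0 // ltW.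
have [p0|p0] := ltP 0 p; last first.
  have nr i : (a i \in p :: r) = (a i \in r).
    rewrite inE; case: eqP => // ap; by move: (a0 i); rewrite ap ltNge p0.
  by apply: IH => i ir; [apply: c0|apply: c'0]; rewrite nr.
pose v i := (a i + p)^-1; pose al i := (a i - p) / (a i + p).
have ap i : 0 < a i + p by rewrite addr_gt0.
have -> : mform (smul (fun i j => (a i + a j)^-1) X) s t c c' =
   (2 * p)%:C%C * mform X s t (fun j => (v j)%:C%C * c j) (fun i => (v i)%:C%C * c' i)
   + mform (smul (fun i j => (a i + a j)^-1) X) s t
       (fun j => (al j)%:C%C * c j) (fun i => (al i)%:C%C * c' i).
  rewrite /mform mulr_sumr -big_split /=; apply: eq_bigr => i _.
  rewrite mulr_sumr -big_split /=; apply: eq_bigr => j _.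
  rewrite /smul.
  have {1}-> : (a i + a j)^-1 = (2 * p) * v i * v j + (a i + a j)^-1 * al i * al j.
    rewrite /v /al; field.
    by rewrite !gt_eqF // addr_gt0.
  by rewrite !(rmorphD, rmorphM) /=; ring.
rewrite raddfD /= ReM_real.
(* The kernel identity on the diagonal: 1 / (2 a_i) = 2 p v_i^2 + al_i^2 / (2 a_i). *)
have -> : M * (\sum_(j <- t) sqn (c j) / (2 * a j) + \sum_(i <- s) sqn (c' i) / (2 * a i))
  = 2 * p * (M * (sqs t (fun j => (v j)%:C%C * c j) + sqs s (fun i => (v i)%:C%C * c' i)))
   + M * (\sum_(j <- t) sqn ((al j)%:C%C * c j) / (2 * a j) +
          \sum_(i <- s) sqn ((al i)%:C%C * c' i) / (2 * a i)).
  have E (u : seq I) d : \sum_(j <- u) sqn (d j) / (2 * a j) =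
     2 * p * sqs u (fun j => (v j)%:C%C * d j) +
     \sum_(j <- u) sqn ((al j)%:C%C * d j) / (2 * a j).
    rewrite mulr_sumr -big_split /=; apply: eq_bigr => j _.
    rewrite !sqnM !sqn_real /v /al; field.
    by rewrite !gt_eqF.
  have alg (x y A B A' B' : R) : x * (y * A + B + (y * A' + B')) =
    y * (x * (A + A')) + x * (B + B') by ring.
  by rewrite (E t c) (E s c') alg.
apply: lerD.
  by rewrite ler_pM2l ?mulr_gt0 // XM.
apply: IH => i ir.
  have [e|ne] := eqVneq (a i) p; first by rewrite /al e subrr mul0r mul0r.
  by rewrite c0 ?mulr0 // inE negb_or ne ir.
have [e|ne] := eqVneq (a i) p; first by rewrite /al e subrr mul0r mul0r.
by rewrite c'0 ?mulr0 // inE negb_or ne ir.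
Qed.

(** The reciprocal of [b i / b j + b j / b i], that is, half the hyperbolic secant of log b_i - log
    b_j. *)
Definition mu b i j : R := b i * b j / (b i ^+ 2 + b j ^+ 2).

(** [mu b] is the Cauchy kernel of [b ^+ 2] with the weights [b i] and [b j] absorbed into the
    coefficients. The constant is halved because its diagonal is 1/2; interpolation depends on this
    exact value. *)
Lemma bddM_mu M X b : (forall i, 0 < b i) -> bddM M X ->
  bddM (M / 2) (smul (mu b) X).
Proof.
move=> b0 XM; have [M0 _] := XM; split=> [|s t c c' us ut].
  by rewrite divr_ge0.
pose r := [seq b i ^+ 2 | i <- s ++ t].
(* Coefficients are cut off outside the finite sets, so that they vanish wherever [b i ^+ 2] is not
   in [r], as [cauchy_kernel] requires. *)
pose z (u : seq I) (d : I -> C) i : C := if i \in u then (b i)%:C%C * d i else 0.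
have b2 i : 0 < b i ^+ 2 by rewrite exprn_gt0.
have nr u d i : (forall j, j \in u -> j \in s ++ t) ->
    b i ^+ 2 \notin r -> z u d i = 0.
  move=> us'; rewrite /z; case: ifP => // iu /negP; case; apply/mapP; exists i => //.
  exact: us'.
have := cauchy_kernel (a := fun i => b i ^+ 2) (r := r) (c := z t c)
   (c' := z s c') b2 XM us ut.
have -> : mform (smul (fun i j => (b i ^+ 2 + b j ^+ 2)^-1) X) s t (z t c) (z s c')
   = mform (smul (mu b) X) s t c c'.
  rewrite /mform big_seq [RHS]big_seq; apply: eq_bigr => i is_.
  rewrite big_seq [RHS]big_seq; apply: eq_bigr => j jt.
  rewrite /z is_ jt /smul /mu !rmorphM /=; ring.
move=> /(_ _ _)/le_trans; apply.
- by move=> i; apply: nr => j jt; rewrite mem_cat jt orbT.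
- by move=> i; apply: nr => j js; rewrite mem_cat js.
have E u d : \sum_(j <- u) sqn (z u d j) / (2 * b j ^+ 2) = sqs u d / 2.
  rewrite mulr_suml big_seq [RHS]big_seq; apply: eq_bigr => i iu.
  rewrite /z iu sqnM sqn_real; field; by rewrite gt_eqF.
by rewrite !E -mulrDl mulrAC mulrA.
Qed.

Lemma bdd_mu X b : (forall i, 0 < b i) -> bdd X -> bdd (smul (mu b) X).
Proof. by move=> b0 [M XM]; exists (M / 2); exact: bddM_mu. Qed.

End SchurMultiplier.

(** * Matrices all of whose iterated commutators with a diagonal are bounded *)

Section Sat.
Context {I : eqType}.
Implicit Types (X Y : I -> I -> C) (f g : I -> R).

Definition sat f X : Prop :=
  forall k, bdd (smul (fun i j => (f i - f j) ^+ k) X).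

Lemma sat_ext f X Y : (forall i j, X i j = Y i j) -> sat f X -> sat f Y.
Proof.
by move=> XY; suff -> : Y = X by []; apply/funext => i; apply/funext => j.
Qed.

Lemma sat_add f X Y : sat f X -> sat f Y -> sat f (fun i j => X i j + Y i j).
Proof.
move=> fX fY k; apply: bdd_ext (bdd_add (fX k) (fY k)) => i j.
by rewrite /smul mulrDr.
Qed.

Lemma sat_bdd f X : sat f X -> bdd X.
Proof. by move=> /(_ 0%N); under eq_smul do rewrite expr0; rewrite smul1. Qed.

Lemma smulC (m m' : I -> I -> R) X : smul m (smul m' X) = smul m' (smul m X).
Proof. by rewrite !smulA; apply: eq_smul => i j; rewrite mulrC. Qed.

Lemma sat_comm f X : sat f X -> sat f (smul (fun i j => f i - f j) X).
Proof. by move=> fX k; rewrite smulA; under eq_smul do rewrite -exprSr; exact: fX. Qed.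

Lemma sat_smul_mul f X (g h : I -> R) B : (forall i, `|g i| <= B) ->
  (forall i, `|h i| <= B) -> sat f X -> sat f (smul (fun i j => g i * h j) X).
Proof.
by move=> gB hB fX k; rewrite smulC; exact: (bdd_smul_mul gB hB).
Qed.

Lemma sat_smulD f X (m m' : I -> I -> R) : sat f (smul m X) -> sat f (smul m' X) ->
  sat f (smul (fun i j => m i j + m' i j) X).
Proof.
by move=> h1 h2; apply: sat_ext (sat_add h1 h2) => i j; rewrite /smul rmorphD mulrDl.
Qed.

Lemma sat_mu f X b : (forall i, 0 < b i) -> sat f X -> sat f (smul (mu b) X).
Proof. by move=> b0 fX k; rewrite smulC; exact: bdd_mu. Qed.

(** Diagonal matrices commute with each other, so one commutator with diag f' is a commutator with
    diag f plus left and right products with the bounded diagonal f' - f, and stays in [sat f].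
    Hence the induction on [k] for all [X] at once. *)
Lemma sat_perturb f f' X B : (forall i, `|f' i - f i| <= B) -> sat f X -> sat f' X.
Proof.
move=> fB fX k; elim: k X fX => [|k IH] X fX.
  by under eq_smul do rewrite expr0; rewrite smul1; exact: sat_bdd fX.
pose B' := Num.max B 1.
have h1 i : `|f' i - f i| <= B' by rewrite le_max fB.
have h2 : `|1 : R| <= B' by rewrite normr1 le_max lexx orbT.
have h2' : `|-1 : R| <= B' by rewrite normrN1 le_max lexx orbT.
suff H : sat f (smul (fun i j => (f i - f j) + ((f' i - f i) * 1 + -1 * (f' j - f j))) X).
  have := IH _ H; rewrite smulA (eq_smul (m' := fun i j => (f' i - f' j) ^+ k.+1)) //.
  by move=> i j; rewrite exprSr; congr (_ * _); ring.
apply: sat_smulD; first exact: sat_comm.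
apply: sat_smulD.
  by apply: (sat_smul_mul (g := fun i => f' i - f i) (h := fun=> 1) h1).
by apply: (sat_smul_mul (g := fun=> -1) (h := fun i => f' i - f i) (B := B')).
Qed.

Section Weight.
Variable (n : I -> R).
Hypothesis n1 : forall i, 1 <= n i.

Let n0 i : 0 < n i. Proof. exact: lt_le_trans (n1 i). Qed.
Let nN0 i : n i != 0. Proof. by rewrite gt_eqF. Qed.
Let nV i : `|(n i)^-1| <= 1.
Proof. by rewrite ger0_norm ?invr_ge0 ?(ltW (n0 _)) // invf_le1. Qed.

(** [n i / n j] is unbounded, but equals [1 + (n i - n j) / n j]: one commutator followed by the
    contraction [1 / n j]. *)
Lemma sat_ratio X : sat n X -> sat n (smul (fun i j => n i / n j) X).
Proof.
move=> nX.
rewrite (eq_smul (m' := fun i j => 1 + (n i - n j) * (1 * (n j)^-1))); last first.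
  by move=> i j; field.
apply: sat_smulD; first by rewrite smul1.
under eq_smul do rewrite mulrC; rewrite -smulA.
by apply: (sat_smul_mul (B := 1)) (sat_comm nX) => // i; rewrite normr1.
Qed.

Lemma sat_ratioV X : sat n X -> sat n (smul (fun i j => n j / n i) X).
Proof.
move=> nX.
rewrite (eq_smul (m' := fun i j => 1 + (n i - n j) * ((n i)^-1 * -1))); last first.
  by move=> i j; field.
apply: sat_smulD; first by rewrite smul1.
under eq_smul do rewrite mulrC; rewrite -smulA.
by apply: (sat_smul_mul (B := 1)) (sat_comm nX) => // i; rewrite normrN1.
Qed.

(** The ratio of square roots is [mu b i j * (1 + n i / n j)], a Schur multiplier times one that
    costs a single commutator. *)
Lemma sat_sqrt_ratio X (b : I -> R) : (forall i, 0 < b i) ->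
  (forall i, n i = b i ^+ 2) -> sat n X -> sat n (smul (fun i j => b i / b j) X).
Proof.
move=> b0 nb nX; have bN0 i : b i != 0 by rewrite gt_eqF.
rewrite (eq_smul (m' := fun i j => mu b i j * (1 + n i / n j))); last first.
  move=> i j; rewrite /mu !nb; field.
  by rewrite ?bN0 ?andbT ?gt_eqF ?addr_gt0 ?exprn_gt0.
rewrite -smulA; apply: sat_mu => //; apply: sat_smulD; first by rewrite smul1.
exact: sat_ratio.
Qed.

Lemma sat_sqrt_ratioV X (b : I -> R) : (forall i, 0 < b i) ->
  (forall i, n i = b i ^+ 2) -> sat n X -> sat n (smul (fun i j => b j / b i) X).
Proof.
move=> b0 nb nX; have bN0 i : b i != 0 by rewrite gt_eqF.
rewrite (eq_smul (m' := fun i j => n j / n i * (b i / b j))); last first.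
  by move=> i j; rewrite !nb; field; rewrite ?bN0.
by rewrite -smulA; apply: sat_ratioV; exact: sat_sqrt_ratio.
Qed.

Lemma sat_pow (m : I -> I -> R) : 
  (forall X, sat n X -> sat n (smul m X)) ->
  forall k X, sat n X -> sat n (smul (fun i j => m i j ^+ k) X).
Proof.
move=> mP; elim=> [|k IH] X nX.
  by under eq_smul do rewrite expr0; rewrite smul1.
by under eq_smul do rewrite exprS; rewrite -smulA; apply/mP/IH.
Qed.

(* The matrix of N^(-k/2) ad_(N^2)^k (X) N^(-k/2), with N = diag n = diag b^2. *)
Definition symm_ad (b : I -> R) k X :=
  smul (fun i j => ((n i ^+ 2 - n j ^+ 2) / (b i * b j)) ^+ k) X.

(** From right to left order [k] alone suffices, since [n i - n j] is [mu b i j] times the symmetric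
    weight. From left to right the unbounded factor [b i / b j + b j / b i] consumes further
    commutators. *)
Lemma sat_symm_ad X (b : I -> R) : (forall i, 0 < b i) ->
  (forall i, n i = b i ^+ 2) -> sat n X <-> forall k, bdd (symm_ad b k X).
Proof.
move=> b0 nb; have bN0 i : b i != 0 by rewrite gt_eqF.
split=> [nX k|bX k].
  apply: (@sat_bdd n); apply: sat_pow nX => {}X nX.
  rewrite (eq_smul (m' := fun i j => (n i - n j) * (b i / b j + b j / b i))).
    rewrite -smulA; apply: sat_comm; apply: sat_smulD.
      exact: sat_sqrt_ratio.
    exact: sat_sqrt_ratioV.
  by move=> i j; rewrite !nb; field; rewrite ?bN0.
rewrite (eq_smul (m' := fun i j => mu b i j ^+ k * ((n i ^+ 2 - n j ^+ 2) / (b i * b j)) ^+ k)).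
  rewrite -smulA; elim: {1}k => [|l IH].
    by under eq_smul do rewrite expr0; rewrite smul1; exact: bX.
  by under eq_smul do rewrite exprS; rewrite -smulA; apply: bdd_mu.
move=> i j; rewrite -exprMn; congr (_ ^+ _); rewrite /mu !nb; field.
by rewrite ?bN0 ?andbT ?gt_eqF ?addr_gt0 ?exprn_gt0.
Qed.

End Weight.
End Sat.
End Schur.

Lemma cvg_sum_seq (K : numFieldType) (V : normedModType K) (T I : Type)
    (F : set_system T) (r : seq I) (f : I -> T -> V) (l : I -> V) : Filter F ->
  (forall i, f i x @[x --> F] --> l i) ->
  \sum_(i <- r) f i x @[x --> F] --> \sum_(i <- r) l i.
Proof.
move=> FF fl; elim: r => [|i r IH].
  by under eq_fun do rewrite big_nil; rewrite big_nil; exact: cvg_cst.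
by under eq_fun do rewrite big_cons; rewrite big_cons; exact: cvgD.
Qed.

(** * Tensor products, direct sums and permutation matrices *)

Section Rectangles.
Context {R : realType}.
Local Notation C := (R[i]).

Lemma big_subseq_if (V : nmodType) (I : eqType) (s r : seq I) (F : I -> V) :
  uniq s -> uniq r -> {subset s <= r} ->
  \sum_(i <- s) F i = \sum_(i <- r) if i \in s then F i else 0.
Proof.
move=> us ur sr; rewrite -big_mkcond -big_filter; apply: perm_big.
apply: uniq_perm => //; first by rewrite filter_uniq.
by move=> i; rewrite mem_filter; case: (boolP (i \in s)) => // /sr ->.
Qed.

Lemma ler_sum_subseq (I : eqType) (s r : seq I) (F : I -> R) :
  uniq s -> uniq r -> {subset s <= r} -> (forall i, 0 <= F i) ->
  \sum_(i <- s) F i <= \sum_(i <- r) F i.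
Proof.
move=> us ur sr F0; rewrite (big_subseq_if F us ur sr); apply: ler_sum => i _.
by case: ifP.
Qed.

Lemma mform_ext (I J : eqType) (a : I -> J -> C) s s' t t' c c' :
  uniq s -> uniq s' -> uniq t -> uniq t' -> {subset s <= s'} -> {subset t <= t'} ->
  mform a s t c c' = mform a s' t' (fun j => if j \in t then c j else 0)
                                   (fun i => if i \in s then c' i else 0).
Proof.
move=> us us' ut ut' ss tt.
rewrite /mform (big_subseq_if _ us us' ss); apply: eq_bigr => i _.
case: ifP => _; last by rewrite big1 // => j _; rewrite mulr0.
rewrite (big_subseq_if _ ut ut' tt); apply: eq_bigr => j _.
by case: ifP => _; rewrite ?mulr0 ?mul0r.
Qed.

Lemma sqs_ext (I : eqType) (s s' : seq I) (c : I -> C) :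
  uniq s -> uniq s' -> {subset s <= s'} ->
  sqs s' (fun i => if i \in s then c i else 0) = sqs s c.
Proof.
move=> us us' ss; rewrite /sqs (big_subseq_if _ us us' ss).
by apply: eq_bigr => i _; case: ifP => // _; rewrite sqn0.
Qed.

(** Extending coefficients by zero changes neither side, so finite sets of pairs may be enlarged to
    rectangles, over which sums iterate. *)
Lemma bddM_rect (I1 I2 J1 J2 : eqType) M (a : I1 * I2 -> J1 * J2 -> C) : 0 <= M ->
  (forall s1 s2 t1 t2 c c', uniq s1 -> uniq s2 -> uniq t1 -> uniq t2 ->
    let s := [seq (i, j) | i <- s1, j <- s2] in
    let t := [seq (i, j) | i <- t1, j <- t2] in
    complex.Re (mform a s t c c') <= M * (sqs t c + sqs s c')) -> bddM M a.
Proof.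
move=> M0 aM; split => // s t c c' us ut.
have rect (A B : eqType) (r : seq (A * B)) : exists r1 r2,
    [/\ uniq r1, uniq r2 & {subset r <= [seq (i, j) | i <- r1, j <- r2]}].
  exists (undup (map fst r)), (undup (map snd r)); rewrite !undup_uniq; split => //.
  move=> [x y] xy; apply/allpairsP; exists (x, y); rewrite !mem_undup; split => //=.
    by apply/mapP; exists (x, y).
  by apply/mapP; exists (x, y).
have [s1 [s2 [us1 us2 ss]]] := rect _ _ s.
have [t1 [t2 [ut1 ut2 tt]]] := rect _ _ t.
have U (A B : eqType) (r1 : seq A) (r2 : seq B) : uniq r1 -> uniq r2 ->
    uniq [seq (i, j) | i <- r1, j <- r2].
  by move=> u1 u2; apply: allpairs_uniq => // -[x y] [x' y'].
rewrite (mform_ext _ _ _ us (U _ _ _ _ us1 us2) ut (U _ _ _ _ ut1 ut2) ss tt).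
rewrite -(sqs_ext c ut (U _ _ _ _ ut1 ut2) tt) -(sqs_ext c' us (U _ _ _ _ us1 us2) ss).
exact: aM.
Qed.

Lemma sqs_allpairs (A B : Type) (r1 : seq A) (r2 : seq B) (c : A * B -> C) :
  sqs [seq (i, j) | i <- r1, j <- r2] c = \sum_(i <- r1) sqs r2 (fun j => c (i, j)).
Proof. by rewrite /sqs big_allpairs. Qed.

(** a (x) b factors as (a (x) 1)(1 (x) b). For each second row index the bound of [a] is applied to
    the vector already transformed by [b], whose squares [bdd_rows] controls by [4 * N ^+ 2]; the 1
    in the maximum serves the [c'] terms. *)
Lemma bdd_tens (I1 I2 J1 J2 : eqType) (a : I1 -> J1 -> C) (b : I2 -> J2 -> C) :
  bdd a -> bdd b -> bdd (fun (x : I1 * I2) (y : J1 * J2) => a x.1 y.1 * b x.2 y.2).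
Proof.
move=> [M [M0 aM]] [N [N0 bN]]; exists (M * Num.max (4 * N ^+ 2) 1).
apply: bddM_rect; first by rewrite mulr_ge0 // le_max ler01 orbT.
move=> s1 s2 t1 t2 c c' us1 us2 ut1 ut2 /=.
rewrite !sqs_allpairs.
have -> : mform (fun (x : I1 * I2) (y : J1 * J2) => a x.1 y.1 * b x.2 y.2)
    [seq (i, j) | i <- s1, j <- s2] [seq (i, j) | i <- t1, j <- t2] c c' =
  \sum_(p <- s2) mform a s1 t1 (fun j => \sum_(l <- t2) b p l * c (j, l))
     (fun i => c' (i, p)).
  rewrite /mform big_allpairs exchange_big; apply: eq_bigr => p _.
  apply: eq_bigr => i _; rewrite big_allpairs; apply: eq_bigr => j _.
  by rewrite mulr_sumr mulr_suml; apply: eq_bigr => l _ /=; ring.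
rewrite Re_sum; apply: (@le_trans _ _ (\sum_(p <- s2) M *
   (sqs t1 (fun j => \sum_(l <- t2) b p l * c (j, l)) + sqs s1 (fun i => c' (i, p))))).
  by apply: ler_sum => p _; exact: aM.
rewrite -mulr_sumr -mulrA ler_wpM2l // big_split /= mulrDr lerD //.
  rewrite /sqs exchange_big mulr_sumr; apply: ler_sum => j _.
  apply: (le_trans (bdd_rows (fun l => c (j, l)) (conj N0 bN) us2 ut2)).
  by rewrite ler_wpM2r ?sqs_ge0 // le_max lexx.
rewrite /sqs exchange_big /= ler_peMl //.
  by apply: sumr_ge0 => i _; apply: sumr_ge0 => p _; exact: sqn_ge0.
by rewrite le_max lexx orbT.
Qed.

(** The block-diagonal case, with one constant for all blocks. It provides the unitary acting by a
    different [U g] on each summand in Fell absorption. *)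
Lemma bdd_dsum (I J K : eqType) M (u : K -> I -> J -> C) : (forall k, bddM M (u k)) ->
  0 <= M ->
  bdd (fun (x : I * K) (y : J * K) => if x.2 == y.2 then u y.2 x.1 y.1 else 0).
Proof.
move=> uM M0; exists M; apply: bddM_rect => // s1 s2 t1 t2 c c' us1 us2 ut1 ut2 /=.
rewrite !sqs_allpairs.
have -> : mform (fun (x : I * K) (y : J * K) => if x.2 == y.2 then u y.2 x.1 y.1 else 0)
    [seq (i, j) | i <- s1, j <- s2] [seq (i, j) | i <- t1, j <- t2] c c' =
  \sum_(p <- [seq p <- s2 | p \in t2]) mform (u p) s1 t1 (fun j => c (j, p))
     (fun i => c' (i, p)).
  rewrite big_filter big_mkcond /= /mform big_allpairs exchange_big; apply: eq_bigr => p _.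
  case: ifP => pt; last first.
    rewrite big1 // => i _; rewrite big_allpairs big1 // => j _.
    rewrite big_seq big1 //= => l lt; case: eqP => [e|_]; last by rewrite !mul0r.
    by rewrite e lt in pt.
  apply: eq_bigr => i _; rewrite big_allpairs; apply: eq_bigr => j _ /=.
  rewrite (bigD1_seq p) //= eqxx big1 ?addr0 // => l; rewrite eq_sym => /negPf ->.
  by rewrite !mul0r.
have uf : uniq [seq p <- s2 | p \in t2] by rewrite filter_uniq.
rewrite Re_sum; apply: (@le_trans _ _ (\sum_(p <- [seq p <- s2 | p \in t2]) M *
   (sqs t1 (fun j => c (j, p)) + sqs s1 (fun i => c' (i, p))))).
  by apply: ler_sum => p _; apply: (uM p).2.
rewrite -mulr_sumr ler_wpM2l // big_split /= lerD // /sqs [leLHS]exchange_big /=;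
  apply: ler_sum => i _; apply: ler_sum_subseq => //; try (by move=> ?; exact: sqn_ge0);
  by move=> p; rewrite mem_filter => /andP[].
Qed.

Lemma bdd_perm (I J : eqType) (phi : I -> J) : injective phi ->
  bdd (fun i j => (j == phi i)%:R : C).
Proof.
move=> phiI; exists 1; split => // s t c c' us ut; rewrite mul1r.
have -> : mform (fun i j => (j == phi i)%:R : C) s t c c' =
   \sum_(i <- [seq i <- s | phi i \in t]) c (phi i) * c' i.
  rewrite big_filter big_mkcond /=; apply: eq_bigr => i _.
  case: ifP => it; last first.
    rewrite big_seq big1 // => j jt; case: eqP => [e|_]; last by rewrite !mul0r.
    by rewrite -e jt in it.
  rewrite (bigD1_seq (phi i)) //= eqxx mul1r big1 ?addr0 // => j /negPf ->.
  by rewrite !mul0r.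
have uf : uniq [seq i <- s | phi i \in t] by rewrite filter_uniq.
rewrite Re_sum; apply: (@le_trans _ _ (\sum_(i <- [seq i <- s | phi i \in t])
   (sqn (c (phi i)) + sqn (c' i)))).
  apply: ler_sum => i _; case: (c _) (c' i) => [x y] [z w]; rewrite /sqn /=.
  by have := sqr_ge0 (x - z); have := sqr_ge0 (y + w); nra.
rewrite big_split /= lerD //; last first.
  apply: ler_sum_subseq => // [i|i]; last exact: sqn_ge0.
  by rewrite mem_filter => /andP[].
rewrite -(big_map phi xpredT (fun j => sqn (c j))).
apply: ler_sum_subseq => // [|j|j]; last exact: sqn_ge0.
  by rewrite map_inj_uniq.
by case/mapP=> i; rewrite mem_filter => /andP[it _] ->.
Qed.

Lemma bdd_unit (a0 b0 : bool) :
  bdd (fun a b : bool => ((a == a0) && (b == b0))%:R : C).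
Proof.
(* The permutation of the booleans that takes [a0] to [b0]; 0/1 weights on rows and columns then
   isolate a single entry. *)
pose phi a := a (+) (a0 (+) b0).
have phiI : injective phi by apply: addIb.
apply: bdd_ext (bdd_mul (g := fun a => (a == a0)%:R) (h := fun b => (b == b0)%:R)
  (B := 1) _ _ (bdd_perm phiI)).
- by case: a0 b0 @phi phiI => [] [] phi _ [] []; rewrite /phi /= ?(mul0r, mulr0, mul1r, mulr1).
- by move=> a; case: (a == a0); rewrite /= /sqn /= ?expr1n ?expr0n /= ?addr0.
- by move=> a; case: (a == b0); rewrite /= /sqn /= ?expr1n ?expr0n /= ?addr0.
Qed.

Section SatTensor.
Context {I J : eqType}.
Variables (n : I -> R) (m : J -> R).
Hypotheses (n1 : forall i, 1 <= n i) (m1 : forall j, 1 <= m j).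

(** For [n] and [m] of the form sqrt(1 + d^2), these are the eigenvalues of the square root of 2 +
    D^2 (x) 1 + 1 (x) M^2, a bounded perturbation of the absolute value of the Dirac operator. *)
Definition nm (x : I * J) : R := Num.sqrt (n x.1 ^+ 2 + m x.2 ^+ 2).

Lemma nm_ge x : n x.1 <= nm x /\ m x.2 <= nm x.
Proof.
have n0 : 0 <= n x.1 by apply: le_trans (n1 _).
have m0 : 0 <= m x.2 by apply: le_trans (m1 _).
split; [rewrite -[leLHS](ger0_norm n0)|rewrite -[leLHS](ger0_norm m0)];
  rewrite -sqrtr_sqr ler_wsqrtr //.
  by rewrite lerDl sqr_ge0.
by rewrite lerDr sqr_ge0.
Qed.

(** Commutators with diag [nm] do not split over the two factors, those with its square do, because
    [nm ^+ 2] is a sum. This is why [sat] is passed through [symm_ad] on both sides. *)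
Lemma sat_tens (X : I -> I -> C) (Y : J -> J -> C) : sat n X -> sat m Y ->
  sat nm (fun x y => X x.1 y.1 * Y x.2 y.2).
Proof.
move=> nX mY.
pose b i := Num.sqrt (n i); pose d j := Num.sqrt (m j); pose w x := Num.sqrt (nm x).
have n0 i : 0 < n i by apply: lt_le_trans (n1 i).
have m0 j : 0 < m j by apply: lt_le_trans (m1 j).
have nm1 x : 1 <= nm x by apply: le_trans (nm_ge x).1.
have nm0 x : 0 < nm x by apply: lt_le_trans (nm1 x).
have b0 i : 0 < b i by rewrite sqrtr_gt0.
have d0 j : 0 < d j by rewrite sqrtr_gt0.
have w0 x : 0 < w x by rewrite sqrtr_gt0.
have nb i : n i = b i ^+ 2 by rewrite sqr_sqrtr // ltW.
have md j : m j = d j ^+ 2 by rewrite sqr_sqrtr // ltW.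
have nmw x : nm x = w x ^+ 2 by rewrite sqr_sqrtr // ltW.
apply/(sat_symm_ad nm1 _ w0 nmw) => k.
have SX := (sat_symm_ad n1 X b0 nb).1 nX; have SY := (sat_symm_ad m1 Y d0 md).1 mY.
have bw x : b x.1 <= w x by rewrite ler_wsqrtr //; exact: (nm_ge x).1.
have dw x : d x.2 <= w x by rewrite ler_wsqrtr //; exact: (nm_ge x).2.
(* The change of weight: the factors are divided by powers of [b] and [d], the tensor product by
   powers of [w]. It is a contraction because [b] and [d] are at most [w]. *)
pose r (l : 'I_k.+1) (x : I * J) : R := (b x.1 / w x) ^+ (k - l) * (d x.2 / w x) ^+ l.
have r1 l x : `|r l x| <= 1.
  have h1 : 0 <= b x.1 / w x <= 1.
    by apply/andP; split; [rewrite divr_ge0 // ltW|rewrite ler_pdivrMr // mul1r].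
  have h2 : 0 <= d x.2 / w x <= 1.
    by apply/andP; split; [rewrite divr_ge0 // ltW|rewrite ler_pdivrMr // mul1r].
  have [/andP[h10 h11] /andP[h20 h21]] := conj h1 h2.
  rewrite ger0_norm ?mulr_ge0 ?exprn_ge0 //.
  by rewrite mulr_ile1 ?exprn_ge0 ?exprn_ile1.
apply: bdd_ext (bdd_sum (index_enum 'I_k.+1) (a := fun l : 'I_k.+1 =>
  smul (fun x y => r l x * (r l y *+ 'C(k, l)))
  (fun x y => symm_ad n b (k - l) X x.1 y.1 * symm_ad m d l Y x.2 y.2)) _); last first.
  move=> l; apply: (@bdd_smul_mul _ _ _ _ (r l) (fun y => r l y *+ 'C(k, l)) ('C(k, l))%:R).
  - by move=> x; apply: (le_trans (r1 l x)); rewrite ler1n bin_gt0 -ltnS.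
  - by move=> x; rewrite normrMn -[leLHS]mulr_natl ler_piMr.
  - exact: bdd_tens.
move=> x y; rewrite /symm_ad /smul /=.
have -> : nm x ^+ 2 - nm y ^+ 2 = (n x.1 ^+ 2 - n y.1 ^+ 2) + (m x.2 ^+ 2 - m y.2 ^+ 2).
  by rewrite !sqr_sqrtr ?addr_ge0 ?sqr_ge0 //; ring.
rewrite expr_div_n exprDn mulr_suml rmorph_sum mulr_suml; apply: eq_bigr => l _.
have alg (u p q : R) (z z' : C) :
    u%:C%C * (p%:C%C * z * (q%:C%C * z')) = (u * p * q)%:C%C * (z * z').
  by rewrite !rmorphM /=; ring.
rewrite alg; congr (_%:C%C * _).
rewrite /r !expr_div_n !exprMn -mulr_natl -[in RHS]mulr_natl.
have kl : (k = (k - l) + l)%N by rewrite subnK // -ltnS.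
rewrite [in w x ^+ k]kl [in w y ^+ k]kl !exprD.
have N0 z (e : nat) : w z ^+ e != 0 by rewrite expf_neq0 // gt_eqF.
have N1 z (e : nat) : b z ^+ e != 0 by rewrite expf_neq0 // gt_eqF.
have N2 z (e : nat) : d z ^+ e != 0 by rewrite expf_neq0 // gt_eqF.
by field; rewrite !N0 !N1 !N2.
Qed.

End SatTensor.

(** * Interpolation between real powers of the weight *)

Section Interpolation.
Context {I : eqType}.

Lemma continuous_powR_exp (x : R) : 0 < x -> continuous (fun s : R => x `^ s).
Proof.
move=> x0 s; rewrite /powR gt_eqF //.
apply: continuous_comp; last exact: continuous_expR.
by apply: cvgM; [exact: cvg_id|exact: cvg_cst].
Qed.

(* bddM_mu passes from the exponents s and t to (s + t) / 2; bisection and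
   continuity in s then reach every exponent in [0, 1]. *)
Lemma bddM_powR M (X : I -> I -> C) (n : I -> R) : (forall i, 0 < n i) ->
  bddM M X -> bddM M (smul (fun i j => n i / n j) X) ->
  forall s, 0 <= s <= 1 -> bddM M (smul (fun i j => n i `^ s * n j `^ (- s)) X).
Proof.
move=> n0 X0 X1 s0 s01; pose m s i j := n i `^ s * n j `^ (- s).
pose S := [set s | bddM M (smul (m s) X)].
have np i s : 0 < n i `^ s by rewrite powR_gt0.
have S0 : S 0.
  rewrite /S /= (eq_smul (m' := fun _ _ => 1)) ?smul1 // => i j.
  by rewrite /m oppr0 !powRr0 mulr1.
have S1 : S 1.
  rewrite /S /= (eq_smul (m' := fun i j => n i / n j)) // => i j.
  by rewrite /m powRN !powRr1 // ltW.
have Smid s t : S s -> S t -> S ((s + t) / 2).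
  (* For x = n_i / n_j this is x^((s+t)/2) = (x^s + x^t) / (x^((t-s)/2) + x^((s-t)/2)), where the
     reciprocal of the denominator is [mu b i j]. The two constants [M] add up and the factor 1/2
     brings back [M]. *)
  move=> Ss St; pose b i := n i `^ ((t - s) / 2).
  have b0 i : 0 < b i by exact: np.
  have /(bddM_mu b0) := bddM_add Ss St.
  rewrite (_ : (M + M) / 2 = M); last by field.
  rewrite /S /=.
  set Y := smul _ _; set Z := smul _ _; suff -> : Y = Z by [].
  apply/funext => i; apply/funext => j; rewrite /Y /Z /smul -mulrDl mulrA -rmorphD -rmorphM.
  congr (_%:C%C * _); rewrite /mu /m.
  have E1 : forall l, n l `^ t = b l ^+ 2 * n l `^ s.
    move=> l; rewrite /b expr2 -!powRD ?(gt_eqF (n0 _)) ?implybT //; congr (_ `^ _); by field.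
  have E2 : forall l, n l `^ ((s + t) / 2) = b l * n l `^ s.
    move=> l; rewrite /b -!powRD ?(gt_eqF (n0 _)) ?implybT //; congr (_ `^ _); by field.
  rewrite !powRN !E1 !E2; field.
  by rewrite !gt_eqF ?addr_gt0 ?exprn_gt0.
have near k : exists a b, [/\ S a, S b, a <= s0 <= b & b - a <= (2 ^+ k)^-1].
  elim: k => [|k [a [b [Sa Sb /andP[as0 s0b] ba]]]].
    by exists 0, 1; rewrite expr0 invr1 subr0.
  have E : (2 ^+ k.+1 : R)^-1 = (2 ^+ k)^-1 / 2 by rewrite exprS invfM mulrC.
  have [le|lt] := leP s0 ((a + b) / 2).
    exists a, ((a + b) / 2); split; [by []|exact: Smid|by rewrite as0|].
    by rewrite E; lra.
  exists ((a + b) / 2), b; split; [exact: Smid|by []|by rewrite (ltW lt)|].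
  by rewrite E; lra.
split=> [|s t c c' us ut]; first exact: X0.1.
pose F (u : R) := \sum_(i <- s) \sum_(j <- t) m u i j * complex.Re (X i j * c j * c' i).
have FE u : complex.Re (mform (smul (m u) X) s t c c') = F u.
  rewrite Re_sum; apply: eq_bigr => i _; rewrite Re_sum; apply: eq_bigr => j _.
  by rewrite /smul -ReM_real !mulrA.
have cF : continuous F.
  move=> u; apply: cvg_sum_seq => i; apply: cvg_sum_seq => j.
  apply: cvgM; last exact: cvg_cst.
  apply: cvgM; first exact: continuous_powR_exp.
  apply: (@continuous_comp _ _ _ (fun u => - u) (fun v => n j `^ v)).
    exact: opp_continuous.
  exact: continuous_powR_exp.
rewrite -/(m s0) FE; set B := _ * _.
rewrite leNgt; apply/negP => BF.
have /cvgrPdist_lt/(_ (F s0 - B)) := cF s0; rewrite subr_gt0 => /(_ BF).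
move=> /nbhs_ballP[e /= e0 he].
have [k ke] : exists k, (2 ^+ k : R)^-1 < e.
  have [k hk] := ltr_add_invr e0; exists k.+1; rewrite add0r in hk.
  apply: le_lt_trans hk; rewrite lef_pV2 ?posrE ?exprn_gt0 //.
  by rewrite -natrX ler_nat ltnW // ltn_expl.
have [a [b [Sa _ /andP[as0 s0b] ba]]] := near k.
have := he a; rewrite /ball /= ger0_norm ?subr_ge0 // => /(_ _)/le_lt_trans.
have as0e : s0 - a < e by apply: le_lt_trans ke; lra.
move=> /(_ (F s0 - F a) (ler_norm _) as0e).
have := Sa.2 s t c c' us ut; rewrite FE -/B; lra.
Qed.

(** The integer part of the exponent is a power of [n i / n j] or its inverse and stays within
    [sat]. Only the fractional part is interpolated, since interpolation yields boundedness
    alone. *)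
Lemma sat_bdd_powR (X : I -> I -> C) (n : I -> R) (s : R) : (forall i, 1 <= n i) ->
  sat n X -> bdd (smul (fun i j => n i `^ s * n j `^ (- s)) X).
Proof.
move=> n1 nX.
have n0 i : 0 < n i by apply: lt_le_trans (n1 i).
pose z := Num.floor s; pose u := s - z%:~R.
have u01 : 0 <= u <= 1.
  rewrite subr_ge0 floor_le_tmp //= lerBlDr addrC ltW //.
  by have := floorD1_gt s; rewrite intrD.
have : sat n (smul (fun i j => n i `^ z%:~R * n j `^ (- z%:~R)) X).
  case: z {u u01} => k.
    rewrite (eq_smul (m' := fun i j => (n i / n j) ^+ k)).
      by apply: sat_pow nX => Y nY; exact: sat_ratio.
    by move=> i j; rewrite powRN !powR_mulrn ?(ltW (n0 _)) // expr_div_n.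
  rewrite (eq_smul (m' := fun i j => (n j / n i) ^+ k.+1)).
    by apply: sat_pow nX => Y nY; exact: sat_ratioV.
  move=> i j; rewrite NegzE rmorphN opprK powRN /= !powR_mulrn ?(ltW (n0 _)) //.
  by rewrite expr_div_n mulrC.
move=> nY; have [[M XM] [N XN]] := conj (sat_bdd nY) (sat_bdd (sat_ratio n1 nY)).
have MN1 : M <= Num.max M N by rewrite le_max lexx.
have MN2 : N <= Num.max M N by rewrite le_max lexx orbT.
exists (Num.max M N).
have := bddM_powR n0 (bddM_le MN1 XM) (bddM_le MN2 XN) u01; rewrite smulA.
rewrite (eq_smul (m' := fun i j => n i `^ s * n j `^ (- s))) // => i j.
have E k v : n k `^ v = n k `^ (z%:~R + (v - z%:~R)) by rewrite addrCA subrr addr0.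
rewrite !powRN (E i s) (E j s) -/u !powRD ?(gt_eqF (n0 _)) ?implybT //.
by field; rewrite !gt_eqF ?powR_gt0.
Qed.

End Interpolation.
End Rectangles.

(** * Hilbert spaces *)

Section ClosedSubspaces.
Context {R : realType}.
Local Notation C := (R[i]).

(** The predicates for which a property checked on a total set passes to the whole space; nearly all
    density arguments below are inductions over such a predicate, as in [total_ind]. *)
Definition subsp (E : normedModType C) (P : set E) : Prop :=
  [/\ closed P, P 0 & forall (a : C) x y, P x -> P y -> P (a *: x + y)].

Lemma subsp_sum (E : normedModType C) (P : set E) I (r : seq I) (c : I -> C) x :
  subsp P -> (forall i, P (x i)) -> P (\sum_(i <- r) c i *: x i).
Proof.
move=> [_ P0 Plin] Px; elim: r => [|i r IH]; first by rewrite big_nil.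
by rewrite big_cons; apply: Plin.
Qed.

Lemma lin_span_sub (E : lmodType C) (S : set E) : S `<=` lin_span S.
Proof.
move=> x Sx; exists 1%N, (fun=> 1), (fun=> x); split => //.
by rewrite big_ord_recl big_ord0 scale1r addr0.
Qed.

Lemma lin_span_lin (E : lmodType C) (S : set E) (a : C) x y :
  lin_span S x -> lin_span S y -> lin_span S (a *: x + y).
Proof.
move=> [n [c [v [Sv ->]]]] [m [d [w [Sw ->]]]].
exists (n + m)%N, (fun j => match fintype.split j with inl i => a * c i | inr i => d i end),
  (fun j => match fintype.split j with inl i => v i | inr i => w i end).
split=> [j|]; first by case: (fintype.split j).
rewrite big_split_ord /= scaler_sumr; congr (_ + _); apply: eq_bigr => i _.
  by rewrite (unsplitK (inl i : 'I_n + 'I_m)) scalerA.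
by rewrite (unsplitK (inr i : 'I_n + 'I_m)).
Qed.

Lemma lin_span0 (E : lmodType C) (S : set E) : lin_span S 0.
Proof.
exists 0%N, (fun=> 0), (fun=> 0); split; first by case.
by rewrite big_ord0.
Qed.

Lemma lin_span_min (E : normedModType C) (S P : set E) :
  subsp P -> S `<=` P -> lin_span S `<=` P.
Proof. by move=> sP SP x [n [c [v [Sv ->]]]]; apply: subsp_sum => // j; exact: SP. Qed.

Lemma clspan_sub (E : normedModType C) (S P : set E) :
  subsp P -> S `<=` P -> closure (lin_span S) `<=` P.
Proof.
move=> sP SP; have [cP _ _] := sP.
by rewrite closureE; apply: smallest_sub => //; exact: lin_span_min.
Qed.

Lemma closed_preim (S T : topologicalType) (f : S -> T) (A : set T) :
  continuous f -> closed A -> closed (f @^-1` A).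
Proof. by move=> cf; move/continuous_closedP: cf; apply. Qed.

Lemma closure_subsp (E : normedModType C) (S : set E) :
  S 0 -> (forall (a : C) x y, S x -> S y -> S (a *: x + y)) -> subsp (closure S).
Proof.
move=> S0 Slin; split; [exact: closed_closure|exact: subset_closure|].
have cB : closed (closure S) by exact: closed_closure.
move=> a.
have step1 y : S y -> forall x, closure S x -> closure S (a *: x + y).
  move=> Sy; pose Q := (fun x => a *: x + y) @^-1` closure S.
  have cQ : closed Q.
    apply: closed_preim => // x; apply: cvgD; last exact: cvg_cst.
    by apply: cvgZr; exact: cvg_id.
  have : closure S `<=` Q.
    rewrite {1}closureE; apply: smallest_sub => // x Sx.
    by apply: subset_closure; exact: Slin.
  by move=> + x Sx; apply.
move=> x y Sx Sy; pose Q := (fun y => a *: x + y) @^-1` closure S.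
have cQ : closed Q.
  by apply: closed_preim => // z; apply: cvgD; [exact: cvg_cst|exact: cvg_id].
have : closure S `<=` Q.
  by rewrite {1}closureE; apply: smallest_sub => // z Sz; exact: step1.
by apply.
Qed.

Lemma subsp_clspan (E : normedModType C) (S : set E) : subsp (closure (lin_span S)).
Proof. by apply: closure_subsp; [exact: lin_span0|move=> a x y; exact: lin_span_lin]. Qed.

Lemma total_ind (E : normedModType C) (S P : set E) : dense (lin_span S) ->
  subsp P -> S `<=` P -> forall x, P x.
Proof.
move=> dS sP SP x; apply: (clspan_sub sP SP) => B.
rewrite nbhsE => -[A [oA Ax] AB].
have [y [Ay Sy]] := dS A (ex_intro _ x Ax) oA.
by exists y; split => //; exact: AB.
Qed.

Lemma closed_eq0 (S : topologicalType) (V : normedModType C) (f : S -> V) :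
  continuous f -> closed [set x | f x = 0].
Proof.
move=> cf; apply: (closed_preim cf (A := [set 0])).
apply: accessible_closed_set1; apply: hausdorff_accessible; exact: norm_hausdorff.
Qed.

Lemma closed_eqf (S : topologicalType) (V : normedModType C) (f g : S -> V) :
  continuous f -> continuous g -> closed [set x | f x = g x].
Proof.
move=> cf cg; rewrite (_ : [set x | _] = [set x | f x - g x = 0]).
  by apply: closed_eq0 => x; apply: cvgB; [exact: cf|exact: cg].
by apply/seteqP; split=> x /= => [->|/eqP]; rewrite ?subrr // subr_eq0 => /eqP.
Qed.

Lemma bounded_additive_continuous (E F : normedModType C) (f : E -> F) (M : C) :
  (forall x y, f (x - y) = f x - f y) -> (forall x, `|f x| <= M * `|x|) ->
  continuous f.
Proof.
move=> fB fM x; apply/cvgrPdist_lt => e e0.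
have M0 : 0 < `|M| + 1 by rewrite ltr_wpDl.
apply/nbhs_ballP; exists (e / (`|M| + 1)); first by rewrite /= divr_gt0.
move=> y; rewrite -ball_normE /= => xy.
rewrite -fB; apply: (@le_lt_trans _ _ (`|M| * `|x - y|)).
  have := fM (x - y) => h; have h0 := le_trans (normr_ge0 _) h.
  by rewrite (le_trans h) // -[leLHS](ger0_norm h0) normrM normr_id.
apply: (@le_lt_trans _ _ ((`|M| + 1) * `|x - y|)).
  by rewrite ler_wpM2r // lerDl.
by rewrite mulrC -ltr_pdivlMr.
Qed.

Lemma continuous_Re : continuous (fun z : (C : numFieldType) => complex.Re z).
Proof.
move=> z; apply/(@cvgrPdist_lt _ _ _ _ (nbhs_filter z)) => e e0.
have eC : 0 < e%:C%C by rewrite ltcR.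
apply/nbhs_ballP; exists e%:C%C => //= w; rewrite -ball_normE /= => zw.
have := le_lt_trans (normc_ge_Re (z - w)) zw; rewrite ltcR.
by case: z w {zw} => a b [c d].
Qed.

Lemma closed_Re_le (S : topologicalType) (f : S -> (C : numFieldType)) (b : R) :
  continuous f -> closed [set x | complex.Re (f x) <= b].
Proof.
move=> cf; apply: (closed_preim (f := fun x => complex.Re (f x)) (A := [set y | y <= b])).
  by move=> x; apply: continuous_comp; [exact: cf|exact: continuous_Re].
exact: closed_le.
Qed.

End ClosedSubspaces.

Section Dot.
Context {R : realType}.
Local Notation C := (R[i]).

Section Basic.
Context {H : hilbertType R}.
Implicit Types x y z : H.

Lemma dotDl x y z : dot (x + y) z = dot x z + dot y z.
Proof. by rewrite -[x in LHS]scale1r dotDZl mul1r. Qed.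

Lemma dot0l z : dot 0 z = 0 :> C.
Proof. by apply: (addrI (dot (0 : H) z)); rewrite -dotDl !addr0. Qed.

Lemma dotZl a x z : dot (a *: x) z = a * dot x z.
Proof. by rewrite -[a *: x]addr0 dotDZl dot0l addr0. Qed.

Lemma dotNl x z : dot (- x) z = - dot x z.
Proof. by rewrite -scaleN1r dotZl mulN1r. Qed.

Lemma dotBl x y z : dot (x - y) z = dot x z - dot y z.
Proof. by rewrite dotDl dotNl. Qed.

Lemma dotDr x y z : dot z (x + y) = dot z x + dot z y.
Proof. by rewrite dotC dotDl rmorphD /= -!dotC. Qed.

Lemma dotZr a x z : dot z (a *: x) = a^* * dot z x.
Proof. by rewrite dotC dotZl rmorphM /= -!dotC. Qed.

Lemma dot0r z : dot z 0 = 0 :> C.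
Proof. by rewrite dotC dot0l rmorph0. Qed.

Lemma dotNr x z : dot z (- x) = - dot z x.
Proof. by rewrite dotC dotNl rmorphN /= -dotC. Qed.

Lemma dotBr x y z : dot z (x - y) = dot z x - dot z y.
Proof. by rewrite dotDr dotNr. Qed.

Lemma dot_suml I (r : seq I) (F : I -> H) z :
  dot (\sum_(i <- r) F i) z = \sum_(i <- r) dot (F i) z.
Proof.
elim: r => [|i r IH]; first by rewrite !big_nil dot0l.
by rewrite !big_cons dotDl IH.
Qed.

Lemma dot_sumr I (r : seq I) (F : I -> H) z :
  dot z (\sum_(i <- r) F i) = \sum_(i <- r) dot z (F i).
Proof.
elim: r => [|i r IH]; first by rewrite !big_nil dot0r.
by rewrite !big_cons dotDr IH.
Qed.

Definition nrm2 x : R := complex.Re (dot x x).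

Lemma dotxx x : dot x x = (nrm2 x)%:C%C.
Proof.
rewrite /nrm2 RRe_real // dot_norm; apply: ger0_real.
by rewrite exprn_ge0.
Qed.

Lemma normr_nrm2 x : `|x| ^+ 2 = (nrm2 x)%:C%C.
Proof. by rewrite -dot_norm dotxx. Qed.

Lemma nrm2_ge0 x : 0 <= nrm2 x.
Proof. by rewrite -ler0c -normr_nrm2 exprn_ge0. Qed.

Lemma nrm2_eq0 x : (nrm2 x == 0) = (x == 0).
Proof.
rewrite -(inj_eq (@complexI R)) -normr_nrm2 sqrf_eq0 normr_eq0 //.
Qed.

Lemma nrm20 : nrm2 0 = 0.
Proof. by rewrite /nrm2 dot0l. Qed.

Lemma nrm2Z a x : nrm2 (a *: x) = sqn a * nrm2 x.
Proof. by rewrite /nrm2 dotZl dotZr mulrA mulcJ dotxx ReM_real. Qed.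

Lemma nrm2D x y : nrm2 (x + y) = nrm2 x + nrm2 y + 2 * complex.Re (dot x y).
Proof.
rewrite /nrm2 dotDl !dotDr !raddfD /= [dot y x]dotC ReJ; ring.
Qed.

Lemma nrm2N x : nrm2 (- x) = nrm2 x.
Proof. by rewrite /nrm2 dotNl dotNr opprK. Qed.

Lemma nrm2B x y : nrm2 (x - y) = nrm2 x + nrm2 y - 2 * complex.Re (dot x y).
Proof. by rewrite nrm2D nrm2N dotNr raddfN /= mulrN. Qed.

Lemma nrm2D_le x y : nrm2 (x + y) <= 2 * (nrm2 x + nrm2 y).
Proof.
have := nrm2_ge0 (x - y); rewrite nrm2B nrm2D; lra.
Qed.

Lemma Re_dot_le x y : 2 * complex.Re (dot x y) <= nrm2 x + nrm2 y.
Proof. have := nrm2_ge0 (x - y); rewrite nrm2B; lra. Qed.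

Lemma CauchySchwarz x y : sqn (dot x y) <= nrm2 x * nrm2 y.
Proof.
have [->|y0] := eqVneq y 0; first by rewrite dot0r sqn0 nrm20 mulr0.
have ny : 0 < nrm2 y by rewrite lt_def nrm2_eq0 y0 nrm2_ge0.
have := nrm2_ge0 ((nrm2 y)%:C%C *: x - dot x y *: y).
rewrite nrm2B !nrm2Z sqn_real dotZl dotZr [_^* * _]mulrC mulcJ -rmorphM /=.
rewrite (_ : _ - _ = nrm2 y * (nrm2 x * nrm2 y - sqn (dot x y))); last by ring.
by rewrite pmulr_rge0 // subr_ge0.
Qed.

Lemma sqn_norm (z : C) (x : H) (B : R) : 0 <= B -> sqn z <= B ^+ 2 * nrm2 x ->
  `|z| <= B%:C%C * `|x|.
Proof.
move=> B0 h; rewrite -ler_sqr ?nnegrE ?mulr_ge0 ?normr_ge0 ?ler0c //.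
by rewrite exprMn normr_nrm2 normc_sqn -rmorphXn -rmorphM /= lecR.
Qed.

Lemma dotl_continuous z : continuous (fun x : H => dot x z : (C : numFieldType)).
Proof.
apply: (bounded_additive_continuous (M := (Num.sqrt (nrm2 z))%:C%C)).
  by move=> x y; exact: dotBl.
move=> x; apply: sqn_norm; first exact: sqrtr_ge0.
by rewrite sqr_sqrtr ?nrm2_ge0 // mulrC CauchySchwarz.
Qed.

Lemma dotr_continuous z : continuous (fun x : H => dot z x : (C : numFieldType)).
Proof.
apply: (bounded_additive_continuous (M := (Num.sqrt (nrm2 z))%:C%C)).
  by move=> x y; exact: dotBr.
move=> x; apply: sqn_norm; first exact: sqrtr_ge0.
by rewrite sqr_sqrtr ?nrm2_ge0 // CauchySchwarz.
Qed.

Lemma closed_nrm2_le (S : topologicalType) (f : S -> H) b : continuous f ->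
  closed [set x | nrm2 (f x) <= b].
Proof.
move=> cf.
(* [nrm2 z <= b] holds iff 2 Re <z, y> is at most [b + nrm2 y] for every [y]; for the converse take
   y = z. So the set is an intersection of closed half-spaces. *)
rewrite (_ : [set x | _] =
  \bigcap_(y in [set: H]) [set x | complex.Re (dot (f x) y) <= (b + nrm2 y) / 2]).
  apply: closed_bigI => y _; apply: closed_Re_le => x.
  by apply: (continuous_comp (g := fun z : H => dot z y : (C : numFieldType)) (cf x));
      exact: dotl_continuous.
apply/seteqP; split=> x /= => [fb y _|/(_ (f x) I)].
  by have := Re_dot_le (f x) y; rewrite /=; lra.
by rewrite /= -/(nrm2 _); lra.
Qed.

End Basic.

Lemma ler_norm_nrm2 (H K : hilbertType R) (x : H) (y : K) (B : R) : 0 <= B ->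
  (`|x| <= B%:C%C * `|y|) = (nrm2 x <= B ^+ 2 * nrm2 y).
Proof.
move=> B0; rewrite -ler_sqr ?nnegrE ?mulr_ge0 ?ler0c //.
by rewrite exprMn !normr_nrm2 -rmorphXn -rmorphM /= lecR.
Qed.

Section Operators.
Context {H K : hilbertType R}.
Implicit Types (T S : H -> K).

Lemma linD T : linear T -> forall x y, T (x + y) = T x + T y.
Proof. by move=> lT x y; rewrite -[x in LHS]scale1r lT scale1r. Qed.

Lemma lin0 T : linear T -> T 0 = 0.
Proof. by move=> lT; apply: (addrI (T 0)); rewrite -linD // !addr0. Qed.

Lemma linZ T : linear T -> forall (a : C) x, T (a *: x) = a *: T x.
Proof. by move=> lT a x; rewrite -[a *: x]addr0 lT lin0 // addr0. Qed.

Lemma linN T : linear T -> forall x, T (- x) = - T x.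
Proof. by move=> lT x; rewrite -scaleN1r linZ // scaleN1r. Qed.

Lemma linB T : linear T -> forall x y, T (x - y) = T x - T y.
Proof. by move=> lT x y; rewrite linD // linN. Qed.

Lemma lin_sum T : linear T -> forall I (r : seq I) (F : I -> H),
  T (\sum_(i <- r) F i) = \sum_(i <- r) T (F i).
Proof.
move=> lT I r F; elim: r => [|i r IH]; first by rewrite !big_nil lin0.
by rewrite !big_cons linD // IH.
Qed.

Lemma bounded_byP T M : bounded_by T M -> bounded_by T `|M|.
Proof.
move=> h x; have h0 := le_trans (normr_ge0 _) (h x).
by rewrite (le_trans (h x)) // -[leLHS](ger0_norm h0) normrM normr_id.
Qed.

Lemma bounded_opP T : bounded_op T <->
  linear T /\ exists B, forall x, nrm2 (T x) <= B * nrm2 x.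
Proof.
split=> -[lT [B TB]]; split=> //.
  exists ((complex.Re `|B|) ^+ 2) => x; rewrite -ler_norm_nrm2; last first.
    by rewrite -ler0c RRe_real ?normr_ge0 // ger0_real.
  by rewrite RRe_real ?ger0_real //; exact: bounded_byP.
exists (Num.sqrt `|B|)%:C%C => x; rewrite ler_norm_nrm2 ?sqrtr_ge0 //.
rewrite sqr_sqrtr ?normr_ge0 // (le_trans (TB x)) // ler_wpM2r ?nrm2_ge0 //.
exact: ler_norm.
Qed.

Lemma bounded_op_continuous T : bounded_op T -> continuous T.
Proof.
by move=> [lT [M TM]]; apply: (bounded_additive_continuous (M := M)) => //; exact: linB.
Qed.

Lemma bounded_op_lin S T (a : C) : bounded_op S -> bounded_op T ->
  bounded_op (fun x => a *: S x + T x).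
Proof.
move=> /bounded_opP[lS [A SA]] /bounded_opP[lT [B TB]]; apply/bounded_opP.
split=> [c x y|].
  rewrite lS lT !scalerDr !scalerA [a * c]mulrC -!addrA; congr (_ + _).
  by rewrite addrCA.
exists (2 * (sqn a * A + B)) => x; apply: (le_trans (nrm2D_le _ _)).
rewrite -mulrA ler_pM2l // mulrDl lerD // nrm2Z -mulrA ler_wpM2l //.
exact: sqn_ge0.
Qed.

Lemma bounded_op0 : bounded_op (fun _ : H => 0 : K).
Proof.
apply/bounded_opP; split => [a x y|]; first by rewrite scaler0 addr0.
by exists 0 => x; rewrite nrm20 mul0r.
Qed.

Lemma bounded_op_sum I (r : seq I) (T : I -> H -> K) : (forall i, bounded_op (T i)) ->
  bounded_op (fun x => \sum_(i <- r) T i x).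
Proof.
move=> bT; elim: r => [|i r IH].
  by under eq_fun do rewrite big_nil; exact: bounded_op0.
under eq_fun do rewrite big_cons -[T i _]scale1r; exact: bounded_op_lin.
Qed.

End Operators.

Lemma bounded_op_id (H : hilbertType R) : bounded_op (id : H -> H).
Proof. by apply/bounded_opP; split=> //; exists 1 => x; rewrite mul1r. Qed.

Lemma bounded_op_comp (H K L : hilbertType R) (S : K -> L) (T : H -> K) :
  bounded_op S -> bounded_op T -> bounded_op (S \o T).
Proof.
move=> /bounded_opP[lS [A SA]] /bounded_opP[lT [B TB]]; apply/bounded_opP.
split=> [c x y|]; first by rewrite /= lT lS.
exists (`|A| * B) => x /=; apply: (le_trans (SA _)).
apply: (@le_trans _ _ (`|A| * nrm2 (T x))).
  by rewrite ler_wpM2r ?nrm2_ge0 // ler_norm.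
by rewrite -mulrA ler_wpM2l.
Qed.

End Dot.

(** * Orthonormal bases *)

Section FiniteSubsets.
Context {I : eqType}.

(** Limits along this filter are unordered sums: duplicate-free finite sequences directed by
    inclusion, over an index set of any cardinality. *)
Definition fins : set_system (seq I) :=
  filter_from setT (fun r : seq I => [set s : seq I | uniq s /\ {subset r <= s}]).

Global Instance fins_filter : ProperFilter fins.
Proof.
apply: filter_from_proper; last first.
  move=> r _; exists (undup r); rewrite /= undup_uniq; split => // i.
  by rewrite mem_undup.
apply: filter_fromT_filter; first by exists [::].
move=> r r'; exists (r ++ r') => s /= [us rs]; split; split=> // i ir;
  by apply: rs; rewrite mem_cat ir ?orbT.
Qed.

Lemma fins_uniq : \forall s \near fins, uniq s.
Proof. by exists [::] => // s []. Qed.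

Lemma fins_mem i : \forall s \near fins, uniq s /\ i \in s.
Proof. by exists [:: i] => // s [us si]; split => //; apply: si; rewrite mem_head. Qed.

End FiniteSubsets.

Section OrthonormalFamilies.
Context {R : realType} {H : hilbertType R} {I : eqType}.
Local Notation C := (R[i]).
Variable e : I -> H.

Definition orthonormal : Prop := forall i j, dot (e i) (e j) = (i == j)%:R :> C.

Definition onb : Prop := orthonormal /\ forall x, (forall i, dot x (e i) = 0 :> C) -> x = 0.

Hypothesis oe : orthonormal.

Lemma dot_fin s (c : I -> C) k : uniq s ->
  dot (\sum_(i <- s) c i *: e i) (e k) = if k \in s then c k else 0.
Proof.
move=> us; rewrite dot_suml.
case: ifP => ks.
  rewrite (bigD1_seq k) //= dotZl oe eqxx mulr1 big1 ?addr0 // => i /negPf ik.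
  by rewrite dotZl oe ik mulr0.
rewrite big_seq big1 // => i is_; rewrite dotZl oe; case: eqP => [ik|_]; last by rewrite mulr0.
by rewrite -ik is_ in ks.
Qed.

Lemma nrm2_fin s (c : I -> C) : uniq s -> nrm2 (\sum_(i <- s) c i *: e i) = sqs s c.
Proof.
move=> us; rewrite /nrm2 dot_sumr Re_sum /sqs big_seq [RHS]big_seq.
apply: eq_bigr => i is_; rewrite dotZr dot_fin // is_ mulrC mulcJ.
by [].
Qed.

Lemma bessel s x : uniq s -> sqs s (fun i => dot x (e i)) <= nrm2 x.
Proof.
move=> us; pose y := \sum_(i <- s) dot x (e i) *: e i.
have := nrm2_ge0 (x - y); rewrite nrm2B nrm2_fin //.
have -> : dot x y = (sqs s (fun i => dot x (e i)))%:C%C.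
  rewrite dot_sumr rmorph_sum; apply: eq_bigr => i _.
  by rewrite dotZr mulrC mulcJ.
rewrite /=; lra.
Qed.

Lemma riesz_fischer (c : I -> C) B : (forall s, uniq s -> sqs s c <= B) ->
  exists x, [/\ forall i, dot x (e i) = c i, nrm2 x <= B
    & (\sum_(i <- s) c i *: e i) @[s --> fins] --> x].
Proof.
move=> cB; pose z s := \sum_(i <- s) c i *: e i.
pose S := [set sqs s c | s in [set s | uniq s]].
have supS : has_sup S.
  split; first by exists (sqs [::] c), [::].
  by exists B => _ [s us <-]; exact: cB.
have : cvg (z s @[s --> fins]).
  apply: cauchy_cvg; apply: cauchy_exP => eps eps0.
  have [e1 e10 ->] : exists2 e1 : R, 0 < e1 & eps = e1%:C%C.
    exists (complex.Re eps); last by rewrite RRe_real // gtr0_real.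
    by rewrite -ltcR RRe_real // gtr0_real.
  have e12 : 0 < e1 ^+ 2 by rewrite exprn_gt0.
  (* The square sum over [s0] is within [e1 ^+ 2] of the supremum, so enlarging [s0] moves the
     partial sum by less than [e1], by orthonormality. *)
  have [_ [s0 us0 <-] hs0] := sup_adherent e12 supS.
  exists (z s0); exists s0 => // s [us s0s].
  rewrite /= -ball_normE /= distrC.
  pose d i := if i \in s0 then 0 else c i.
  have -> : z s - z s0 = \sum_(i <- s) d i *: e i.
    rewrite /z (big_subseq_if _ us0 us s0s) -sumrB; apply: eq_bigr => i _.
    by rewrite /d; case: ifP => _; rewrite ?subrr ?scale0r ?subr0.
  rewrite -ltr_sqr ?nnegrE ?normr_ge0 ?ler0c ?ltW // normr_nrm2 nrm2_fin // -rmorphXn ltcR.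
  have -> : sqs s d = sqs s c - sqs s0 c.
    rewrite /sqs (big_subseq_if _ us0 us s0s) -sumrB; apply: eq_bigr => i _.
    by rewrite /d; case: ifP => _; rewrite ?subrr ?sqn0 ?subr0.
  have : sqs s c <= sup S by apply: sup_upper_bound => //; exists s.
  by move: hs0; lra.
move=> /cvg_ex[x zx]; exists x; split => //.
  move=> i; apply: (cvg_unique (@norm_hausdorff _ (C : numFieldType)) (F := dot (z s) (e i) @[s --> fins])).
    exact: (cvg_comp _ _ zx (@dotl_continuous _ H (e i) x)).
  apply: cvg_near_cst; near=> s.
  have [us is_] : uniq s /\ i \in s by near: s; exact: fins_mem.
  by rewrite dot_fin // is_.
apply: (closed_cvg (fun x => nrm2 x <= B) _ _ _ zx).
  by apply: (@closed_nrm2_le _ _ H id) => ?; exact: cvg_id.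
near=> s; have us : uniq s by near: s; exact: fins_uniq.
by rewrite nrm2_fin // cB.
Unshelve. all: by end_near.
Qed.

End OrthonormalFamilies.

Section Onb.
Context {R : realType} {H : hilbertType R} {I : eqType} (e : I -> H).
Local Notation C := (R[i]).
Hypothesis oe : onb e.

Let on : orthonormal e. Proof. exact: oe.1. Qed.

Lemma onb_eq x y : (forall i, dot x (e i) = dot y (e i)) -> x = y.
Proof.
move=> xy; apply/eqP; rewrite -subr_eq0; apply/eqP; apply: oe.2 => i.
by rewrite dotBl xy subrr.
Qed.

Lemma fourier x : (\sum_(i <- s) dot x (e i) *: e i) @[s --> fins] --> x.
Proof.
have [y [yc _ yl]] := riesz_fischer on (fun s us => bessel on x us).
by rewrite {2}(_ : x = y) //; apply: onb_eq => i; rewrite yc.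
Qed.

Lemma onb_ind (P : set H) : subsp P -> (forall i, P (e i)) -> forall x, P x.
Proof.
move=> sP Pe x; have [cP _ _] := sP.
by apply: (closed_cvg P cP _ _ (@fourier x)); near=> s; exact: subsp_sum.
Unshelve. all: by end_near.
Qed.

Lemma nrm2_le_coef x B : (forall s, uniq s -> sqs s (fun i => dot x (e i)) <= B) ->
  nrm2 x <= B.
Proof.
move=> /(riesz_fischer on)[y [yc yB _]].
by rewrite (_ : x = y) //; apply: onb_eq => i; rewrite yc.
Qed.

Lemma vec_of_coef (c : I -> C) B : (forall s, uniq s -> sqs s c <= B) ->
  exists x, forall i, dot x (e i) = c i.
Proof. by move=> /(riesz_fischer on)[x [xc _ _]]; exists x. Qed.

Lemma vec_dominated (c : I -> C) (y : H) B : 0 <= B ->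
  (forall i, sqn (c i) <= B * sqn (dot y (e i))) ->
  exists x, forall i, dot x (e i) = c i.
Proof.
move=> B0 cy; apply: (@vec_of_coef _ (B * nrm2 y)) => s us.
apply: (@le_trans _ _ (B * sqs s (fun i => dot y (e i)))).
  by rewrite mulr_sumr; apply: ler_sum => i _.
by rewrite ler_wpM2l // bessel.
Qed.

End Onb.

Lemma op_ext (R : realType) (H K : hilbertType R) (I : eqType) (e : I -> H)
    (S T : H -> K) : onb e -> bounded_op S -> bounded_op T ->
  (forall i, S (e i) = T (e i)) -> forall x, S x = T x.
Proof.
move=> oe bS bT ST; apply: (onb_ind oe) => //; split.
- by apply: closed_eqf; exact: bounded_op_continuous.
- by rewrite /= (lin0 bS.1) (lin0 bT.1).
- by move=> a x y /= Sx Sy; rewrite bS.1 bT.1 Sx Sy.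
Qed.

Lemma dense_onb (R : realType) (H : hilbertType R) (I : eqType) (e : I -> H) :
  orthonormal e -> dense (lin_span (range e)) -> onb e.
Proof.
move=> oe de; split => // x xe.
suff : forall y, dot y x = 0 by move=> /(_ x)/eqP; rewrite dotxx => /eqP[/eqP]; rewrite nrm2_eq0 => /eqP.
apply: (total_ind de).
  split; [exact: (closed_eq0 (V := (R[i] : numFieldType)) (@dotl_continuous _ H x))|exact: dot0l|].
  by move=> a y z /= yx zx; rewrite dotDl dotZl yx zx mulr0 addr0.
by move=> _ [i _ <-] /=; rewrite dotC xe rmorph0.
Qed.

Section Matrices.
Context {R : realType} {H K : hilbertType R} {I J : eqType}.
Local Notation C := (R[i]).
Variables (e : I -> H) (f : J -> K).
Hypotheses (oe : onb e) (of_ : onb f).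

Definition mx (T : H -> K) : J -> I -> C := fun j i => dot (T (e i)) (f j).

Lemma bddM_mx T B : linear T -> (forall x, nrm2 (T x) <= B * nrm2 x) -> 0 <= B ->
  bddM (1 + B) (mx T).
Proof.
move=> lT TB B0; split; first by rewrite addr_ge0.
move=> s t c c' us ut.
have -> : mform (mx T) s t c c' =
    dot (T (\sum_(i <- t) c i *: e i)) (\sum_(j <- s) (c' j)^* *: f j).
  rewrite dot_sumr; apply: eq_bigr => j _.
  rewrite dotZr conjCK (lin_sum lT) dot_suml mulr_sumr; apply: eq_bigr => i _.
  by rewrite (linZ lT) dotZl /mx; ring.
set x := \sum_(_ <- t) _; set y := \sum_(_ <- s) _.
have xE : nrm2 x = sqs t c by exact: nrm2_fin oe.1 _ _ ut.
have yE : nrm2 y = sqs s c'.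
  by rewrite (nrm2_fin of_.1) //; apply: eq_bigr => j _; rewrite sqnJ.
have := Re_dot_le (T x) y; have := TB x; rewrite xE yE.
have := sqs_ge0 t c; have := sqs_ge0 s c'; nra.
Qed.

Lemma bdd_mx T : bounded_op T -> bdd (mx T).
Proof.
move=> /bounded_opP[lT [B TB]]; exists (1 + `|B|); apply: bddM_mx => // x.
by rewrite (le_trans (TB x)) // ler_wpM2r ?nrm2_ge0 // ler_norm.
Qed.

(** Each row is square summable, hence given by a vector [r j], and [T x] must have the coefficients
    [dot x (r j)]. Their squares are bounded by the optimisation of [bdd_rows], for finitely many
    rows at a time, with the inequality passed to the limit over the partial sums of [x]. *)
Lemma op_of_mx (a : J -> I -> C) : bdd a ->
  exists2 T : H -> K, bounded_op T & forall i j, mx T j i = a j i.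
Proof.
move=> ba; have [M aM] := ba; have [M0 _] := aM.
have rowP j : exists r : H, forall i, dot r (e i) = (a j i)^*.
  have [N aN] := bdd_tr ba.
  (* Row [j] is the image of one basis vector under the transposed matrix. *)
  apply: (vec_of_coef oe (B := 4 * N ^+ 2 * sqs [:: j] (fun=> 1))) => s us.
  have := bdd_rows (s := s) (t := [:: j]) (fun=> 1) aN us isT.
  apply: le_trans; rewrite le_eqVlt; apply/orP; left; apply/eqP.
  by apply: eq_bigr => i _; rewrite big_cons big_nil addr0 mulr1 sqnJ.
have {rowP}[r rE] := choice rowP.
have TP x : exists y : K, (forall j, dot y (f j) = dot x (r j)) /\
    nrm2 y <= 4 * M ^+ 2 * nrm2 x.
  have hb s : uniq s -> sqs s (fun j => dot x (r j)) <= 4 * M ^+ 2 * nrm2 x.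
    move=> us; set S := sqs s _.
    pose g u := \sum_(j <- s) dot u (r j) * (dot x (r j))^*.
    have gx : complex.Re (g x) = S.
      by rewrite /g Re_sum; apply: eq_bigr => j _; rewrite mulcJ.
    have key (tau : R) : tau * S <= M * (nrm2 x + tau ^+ 2 * S).
      have cg : continuous ((fun u => tau%:C%C * g u) : H -> (C : numFieldType)).
        move=> u; apply: (@cvgM (C : numFieldType)); first exact: cvg_cst.
        apply: (@cvg_sum_seq _ (C : numFieldType) _ _ _ s (fun j u => dot u (r j) * (dot x (r j))^*)) => j.
        by apply: (@cvgM (C : numFieldType)); [exact: dotl_continuous|exact: cvg_cst].
      rewrite -[in leLHS]gx -ReM_real.
      apply: (closed_cvg (fun u => complex.Re (tau%:C%C * g u) <= M * (nrm2 x + tau ^+ 2 * S))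
        _ _ _ (@fourier _ _ _ _ oe x)); first exact: (closed_Re_le cg).
      near=> t; have ut : uniq t by near: t; exact: fins_uniq.
      have := aM.2 s t (fun i => dot x (e i)) (fun j => tau%:C%C * (dot x (r j))^*) us ut.
      rewrite sqsZ (_ : sqs s (fun j => (dot x (r j))^*) = S); last first.
        by apply: eq_bigr => j _; rewrite sqnJ.
      have := bessel oe.1 x ut; set q := sqs t _ => qx.
      rewrite (_ : mform _ _ _ _ _ = tau%:C%C * g (\sum_(i <- t) dot x (e i) *: e i)).
        by move=> /le_trans; apply; rewrite ler_wpM2l // lerD2r.
      rewrite /g mulr_sumr; apply: eq_bigr => j _.
      rewrite dot_suml mulr_suml mulr_sumr; apply: eq_bigr => i _.
      by rewrite dotZl [dot (e i) _]dotC rE conjCK; ring.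
    have S0 : 0 <= S by exact: sqs_ge0.
    have x0 := nrm2_ge0 x.
    have [M0'|Mn] := eqVneq M 0.
      by move: (key 1); rewrite M0' mul1r !mul0r => /le_trans; apply; rewrite expr0n mulr0 mul0r.
    have Mp : 0 < M by rewrite lt_def Mn.
    have kM := key (2 * M)^-1.
    have : S * (2 * M)^-1 - S * (4 * M)^-1 <= M * nrm2 x.
      rewrite lerBlDr (le_trans _ (le_trans kM _)) //; first by rewrite mulrC.
      by rewrite mulrDr lerD2l le_eqVlt; apply/orP; left; apply/eqP; field.
    rewrite (_ : S * (2 * M)^-1 - S * (4 * M)^-1 = S / (4 * M)); last by field.
    rewrite ler_pdivrMr ?mulr_gt0 // => /le_trans; apply.
    by rewrite le_eqVlt; apply/orP; left; apply/eqP; ring.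
  have [y [yc yB _]] := riesz_fischer of_.1 hb.
  by exists y.
have {TP}[T TE] := choice TP.
exists T.
  apply/bounded_opP; split=> [b x y|]; last first.
    by exists (4 * M ^+ 2) => x; exact: (TE x).2.
  apply: (onb_eq of_) => j; rewrite dotDl dotZl !(TE _).1.
  by rewrite dotDl dotZl.
by move=> i j; rewrite /mx (TE _).1 dotC rE conjCK.
Unshelve. all: by end_near.
Qed.

Lemma mx_inj S T : bounded_op S -> bounded_op T ->
  (forall j i, mx S j i = mx T j i) -> forall x, S x = T x.
Proof. by move=> bS bT ST; apply: (op_ext oe) => // i; apply: (onb_eq of_) => j; exact: ST. Qed.

End Matrices.

(** * Diagonal operators and their commutators *)

Lemma fst_continuous (E F : topologicalType) : continuous (fun p : E * F => p.1).
Proof. by move=> p; exact: cvg_fst. Qed.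

Lemma snd_continuous (E F : topologicalType) : continuous (fun p : E * F => p.2).
Proof. by move=> p; exact: cvg_snd. Qed.

Lemma comp_continuous (S T U : topologicalType) (g : T -> U) (f : S -> T) :
  continuous g -> continuous f -> continuous (fun x => g (f x)).
Proof. by move=> cg cf x; exact: (cvg_comp _ _ (cf x) (cg (f x))). Qed.

Lemma continuous_dotl (R : realType) (H : hilbertType R) (S : topologicalType)
    (f : S -> H) z : continuous f -> continuous (fun p => dot (f p) z : (R[i] : numFieldType)).
Proof. by move=> cf; exact: (comp_continuous (@dotl_continuous _ H z) cf). Qed.

(** The set expresses N T = T N + B on graphs. Being a closed subspace, it contains the graph of [N]
    as soon as it contains generators of it. *)
Lemma subsp_comm (R : realType) (H : hilbertType R) (N : set (H * H)) (T B : H -> H) :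
  subsp N -> bounded_op T -> bounded_op B ->
  subsp [set p : H * H | N (T p.1, T p.2 + B p.1)].
Proof.
move=> [cN N0 Nlin] bT bB; split.
- apply: (closed_preim (f := fun p : H * H => (T p.1, T p.2 + B p.1)) _ cN) => p.
  have cT := bounded_op_continuous bT; have cB := bounded_op_continuous bB.
  apply: cvg_pair; first exact: (comp_continuous cT (@fst_continuous H H)).
  apply: cvgD; first exact: (comp_continuous cT (@snd_continuous H H)).
  exact: (comp_continuous cB (@fst_continuous H H)).
- by rewrite /= !(lin0 bT.1) (lin0 bB.1) addr0.
- move=> a p q Pp Pq; rewrite /= !bT.1 bB.1.
  have := Nlin a _ _ Pp Pq; congr (N (_, _)) => /=.
  by rewrite scalerDr -!addrA; congr (_ + _); rewrite addrCA.
Qed.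

Section Diagonal.
Context {R : realType} {H : hilbertType R} {I : eqType}.
Local Notation C := (R[i]).
Variable e : I -> H.
Hypothesis oe : onb e.

(** The domain is implicit and maximal: [x] lies in it when some vector has the coefficients [d i]
    times those of [x]. *)
Definition diagG (d : I -> R) : graph H :=
  [set p | forall i, dot p.2 (e i) = (d i)%:C%C * dot p.1 (e i)].

Lemma subsp_diagG d : subsp (diagG d).
Proof.
split.
- rewrite (_ : diagG d = \bigcap_(i in [set: I]) [set p : H * H |
     dot p.2 (e i) = (d i)%:C%C * dot p.1 (e i)]); last first.
    by apply/seteqP; split=> p h i => [_|]; [exact: h|exact: (h i Logic.I)].
  apply: closed_bigI => i _.
  apply: (closed_eqf (V := (C : numFieldType))
    (f := fun p : H * H => dot p.2 (e i)) (g := fun p : H * H => (d i)%:C%C * dot p.1 (e i))) => p.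
    exact: (continuous_dotl (@snd_continuous H H)).
  apply: (@cvgM (C : numFieldType)); first exact: cvg_cst.
  exact: (continuous_dotl (@fst_continuous H H)).
- by move=> i /=; rewrite !dot0l mulr0.
- move=> a [x y] [x' y'] h h' i /=.
  by rewrite !dotDl !dotZl (h i) (h' i) /=; ring.
Qed.

Lemma diagG_e d i : diagG d (e i, (d i)%:C%C *: e i).
Proof.
move=> k /=; rewrite dotZl oe.1; case: eqP => [->//|_]; by rewrite !mulr0.
Qed.

Lemma diagG_fun d x y y' : diagG d (x, y) -> diagG d (x, y') -> y = y'.
Proof. by move=> h h'; apply: (onb_eq oe) => i; rewrite (h i) (h' i). Qed.

Lemma app_diagG d x y : diagG d (x, y) -> app (diagG d) x = y.
Proof.
move=> h; apply: (@diagG_fun d x) => //.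
exact: (@xgetI _ 0 [set y | diagG d (x, y)] y h).
Qed.

Lemma dom_diagG d x : dom (diagG d) x -> diagG d (x, app (diagG d) x).
Proof. by move=> [y h]; rewrite (app_diagG h). Qed.

(** The basis spans a core: the partial Fourier sums of [x] and of [y] converge together in the
    graph. *)
Lemma diagG_ind d (P : set (H * H)) : subsp P ->
  (forall i, P (e i, (d i)%:C%C *: e i)) -> diagG d `<=` P.
Proof.
move=> sP Pe [x y] xy; have [cP _ _] := sP.
have cx : (\sum_(i <- s) dot x (e i) *: e i,
    \sum_(i <- s) dot y (e i) *: e i) @[s --> fins] --> (x, y).
  by apply: cvg_pair; exact: fourier.
apply: (closed_cvg P cP _ _ cx); near=> s.
rewrite (_ : (_, _) = \sum_(i <- s) dot x (e i) *: (e i, (d i)%:C%C *: e i)).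
  exact: subsp_sum.
elim: {+}s => [|i r IH]; first by rewrite !big_nil.
rewrite !big_cons -IH; congr (_, _); congr (_ + _).
by rewrite (xy i) /= scalerA mulrC.
Unshelve. all: by end_near.
Qed.

Lemma diagG_fin d (s : seq I) (c : I -> C) :
  diagG d (\sum_(i <- s) c i *: e i, \sum_(i <- s) (c i * (d i)%:C%C) *: e i).
Proof.
have -> : (\sum_(i <- s) c i *: e i, \sum_(i <- s) (c i * (d i)%:C%C) *: e i) =
    \sum_(i <- s) c i *: (e i, (d i)%:C%C *: e i).
  elim: s => [|i r IH]; first by rewrite !big_nil.
  by rewrite !big_cons -IH; congr (_, _); congr (_ + _); rewrite /= scalerA.
by apply: subsp_sum; [exact: subsp_diagG|exact: diagG_e].
Qed.

(** A [t]-eigenvector has nonzero coefficients only where [d i = t]. Thus the functional calculus,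
    defined through all eigenvectors, can be read off in any eigenbasis. *)
Lemma fcalc_diagG d f : fcalc (diagG d) f = diagG (fun i => f (d i)).
Proof.
apply/seteqP; split.
  apply: clspan_sub; first exact: subsp_diagG.
  move=> [x y] [t [/= xt ->]] i /=; have := xt i; rewrite /= !dotZl.
  have [->|x0] := eqVneq (dot x (e i)) 0; first by rewrite !mulr0.
  by move=> /(mulIf x0)/complexI ->.
apply: diagG_ind; first exact: subsp_clspan.
move=> i; apply: subset_closure; apply: lin_span_sub; exists (d i); split => //.
exact: diagG_e.
Qed.

Lemma Delta_diagG d : Delta (diagG d) = diagG (fun i => 1 + d i ^+ 2).
Proof.
apply/seteqP; split=> [[x w] [y [z /= [xy yz ->]]] i|[x w] /= xw].
  by rewrite /= dotDl (yz i) (xy i) /= rmorphD rmorphXn /= expr2; ring.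
have [y yE] : exists y, forall i, dot y (e i) = (d i)%:C%C * dot x (e i).
  apply: (vec_dominated oe (y := w) (B := 1)) => // i.
  rewrite (xw i) /= !sqnM !sqn_real mul1r ler_wpM2r ?sqn_ge0 //.
  by have := sqr_ge0 (d i); nra.
exists y, (w - x); split; [exact: yE| |by rewrite addrC subrK].
by move=> i /=; rewrite dotBl (xw i) yE /= rmorphD rmorphXn /= expr2; ring.
Qed.

Lemma dense_dom_diagG d x : closure (dom (diagG d)) x.
Proof.
apply: (closed_cvg (closure (dom (diagG d))) _ _ _ (@fourier _ _ _ _ oe x)).
  exact: closed_closure.
near=> s; apply: subset_closure; exists (\sum_(i <- s) (dot x (e i) * (d i)%:C%C) *: e i).
exact: diagG_fin.
Unshelve. all: by end_near.
Qed.

(** [phi] is an unbounded composite, such as a commutator with [N] or a product with powers of the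
    weight, and is controlled only on finite combinations of basis vectors. *)
Lemma mx_bounded_fin (a : I -> I -> C) (phi : H -> H) B : 0 <= B ->
  (forall s c, uniq s -> forall i, dot (phi (\sum_(j <- s) c j *: e j)) (e i) =
     \sum_(j <- s) a i j * c j) ->
  (forall s c, uniq s -> nrm2 (phi (\sum_(j <- s) c j *: e j)) <= B * sqs s c) ->
  bdd a.
Proof.
move=> B0 ha hB; exists (1 + B); split => [|s t c c' us ut]; first by rewrite addr_ge0.
have -> : mform a s t c c' =
    dot (phi (\sum_(j <- t) c j *: e j)) (\sum_(i <- s) (c' i)^* *: e i).
  rewrite dot_sumr; apply: eq_bigr => i _.
  by rewrite dotZr conjCK ha // mulrC mulr_suml.
set x := phi _; set y := \sum_(_ <- s) _.
have yE : nrm2 y = sqs s c'.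
  by rewrite (nrm2_fin oe.1) //; apply: eq_bigr => j _; rewrite sqnJ.
have := Re_dot_le x y; have := hB t c ut; rewrite -/x yE.
have := sqs_ge0 t c; have := sqs_ge0 s c'; nra.
Qed.

Section Commutator.
Variable d : I -> R.
Local Notation N := (diagG d).

Definition dcom (a : I -> I -> C) := smul (fun i j => d i - d j) a.

(** The relation N T = T N + B, which contains the invariance of the domain. It replaces
    [comm_closure] in algebraic manipulations, where [app] would be awkward. *)
Definition is_comm (T B : H -> H) : Prop := forall x y, N (x, y) -> N (T x, T y + B x).

Lemma is_comm_mx T B : bounded_op T -> bounded_op B ->
  (forall i j, mx e e B i j = dcom (mx e e T) i j) -> is_comm T B.
Proof.
move=> bT bB TB x y xy.
pose P := [set p : H * H | N (T p.1, T p.2 + B p.1)].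
suff : P (x, y) by [].
apply: (@diagG_ind d P) xy => [|j].
  exact: (subsp_comm (subsp_diagG d)).
move=> i /=; rewrite dotDl (linZ bT.1) dotZl -![dot _ (e i)]/(mx e e _ i j) TB /dcom /smul rmorphB.
ring.
Qed.

Lemma is_comm_closure T B : bounded_op T -> bounded_op B -> is_comm T B ->
  bounded_comm N T /\ comm_closure N T = B.
Proof.
move=> bT bB TB.
have E x : dom N x -> app N (T x) - T (app N x) = B x.
  move=> [y xy]; rewrite (app_diagG xy) (app_diagG (TB _ _ xy)).
  by rewrite addrAC subrr add0r.
split.
  split; first by move=> x [y xy]; eexists; exact: TB xy.
  by have [M BM] := bB.2; exists M => x dx; rewrite E.
pose S := [set (x, app N (T x) - T (app N x)) | x in dom N].
have cB := bounded_op_continuous bB.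
have cl : closed [set p : H * H | p.2 = B p.1].
  apply: closed_eqf => p; first exact: cvg_snd.
  exact: (comp_continuous cB (@fst_continuous H H)).
have S1 p : closure S p -> p.2 = B p.1.
  rewrite closureE => h; apply: (h [set p : H * H | p.2 = B p.1]); split => //.
  by move=> _ [x dx <-] /=; rewrite E.
have S2 x : closure S (x, B x).
  pose Q := (fun x => (x, B x)) @^-1` closure S.
  suff : Q x by [].
  have := dense_dom_diagG d (x := x); rewrite closureE; apply; split.
    apply: closed_preim; last exact: closed_closure.
    by move=> z; apply: cvg_pair; [exact: cvg_id|exact: cB].
  by move=> z dz; apply: subset_closure; exists z; rewrite ?E.
apply/funext => x; rewrite /comm_closure /app.
exact: (S1 (x, _) (@xgetI _ 0 [set y | closure S (x, y)] (B x) (S2 x))).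
Qed.

Lemma bounded_comm_bdd T : bounded_op T -> bounded_comm N T -> bdd (dcom (mx e e T)).
Proof.
move=> bT [dT [M TM]].
have [B B0 TB] : exists2 B, 0 <= B & forall x, dom N x ->
    nrm2 (app N (T x) - T (app N x)) <= B * nrm2 x.
  exists ((complex.Re `|M|) ^+ 2) => [|x dx]; first exact: sqr_ge0.
  rewrite -ler_norm_nrm2; last by rewrite -ler0c RRe_real ?normr_ge0 // ger0_real.
  have h := TM x dx; have h0 := le_trans (normr_ge0 _) h.
  rewrite RRe_real ?ger0_real // (le_trans h) //.
  by rewrite -[leLHS](ger0_norm h0) normrM normr_id.
apply: (mx_bounded_fin (phi := fun x => app N (T x) - T (app N x)) B0) => s c us;
  have fx := diagG_fin d s c; set x := \sum_(_ <- _) _ in fx *; set y := (X in diagG d (_, X)) in fx;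
  have dx : dom N x by exists y.
  move=> i; rewrite (app_diagG fx) dotBl (dom_diagG (dT x dx)) /x /y.
  rewrite !(lin_sum bT.1) !dot_suml mulr_sumr -sumrB; apply: eq_bigr => j _.
  rewrite !(linZ bT.1) !dotZl /dcom /smul /mx rmorphB; ring.
by rewrite (le_trans (TB x dx)) // (nrm2_fin oe.1).
Qed.

(** Boundedness of the commutator matrix already forces [T] to preserve the domain: the matrix
    defines an operator [B], and N T = T N + B, true on the basis, extends to the whole graph
    because the basis spans a core. *)
Lemma bounded_comm_mx T : bounded_op T -> bdd (dcom (mx e e T)) ->
  [/\ bounded_comm N T, bounded_op (comm_closure N T), is_comm T (comm_closure N T)
    & mx e e (comm_closure N T) = dcom (mx e e T)].
Proof.
move=> bT /(op_of_mx oe oe)[B bB BE].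
have TB : is_comm T B by apply: is_comm_mx => // i j; exact: BE.
have [bc ->] := is_comm_closure bT bB TB; split => //.
by apply/funext => i; apply/funext => j; exact: BE.
Qed.

Lemma dom_deltaP k T : dom_delta N k T <->
  bounded_op T /\ forall l, (l <= k)%N -> bdd (iter l dcom (mx e e T)).
Proof.
elim: k T => [|k IH] T.
  split=> [[bT _]|[bT _]]; split => // l; rewrite leqn0 => /eqP ->.
  exact: bdd_mx.
split=> [[bT [bc /IH[bB BE]]]|[bT TE]].
  have [_ _ _ E] := bounded_comm_mx bT (bounded_comm_bdd bT bc).
  split => // -[_|l lk]; first exact: bdd_mx.
  by rewrite iterSr -E; exact: BE.
have [bc bB TB E] := bounded_comm_mx bT (TE 1%N isT).
split => //; split => //; apply/IH; split => // l lk.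
by rewrite E -iterSr; exact: TE.
Qed.

Lemma iter_dcom k a : iter k dcom a = smul (fun i j => (d i - d j) ^+ k) a.
Proof.
elim: k => [|k IH]; first by under eq_smul do rewrite expr0; rewrite smul1.
by rewrite iterS IH /dcom smulA; under [RHS]eq_smul do rewrite exprS.
Qed.

Lemma dom_delta_inftyP T : dom_delta_infty N T <-> bounded_op T /\ sat d (mx e e T).
Proof.
split=> [h|[bT sT] k].
  split; first exact: (h 0%N).1.
  by move=> k; rewrite -iter_dcom; exact: ((dom_deltaP k T).1 (h k)).2.
by apply/dom_deltaP; split => // l _; rewrite iter_dcom; exact: sT.
Qed.

Lemma is_comm_comp S A T B : bounded_op S -> is_comm S A -> is_comm T B ->
  is_comm (S \o T) (fun x => S (B x) + A (T x)).
Proof.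
move=> bS SA TB x y xy; have := SA _ _ (TB _ _ xy).
by rewrite /= (linD bS.1) addrA.
Qed.

Lemma is_comm_lin S A T B (a : C) : is_comm S A -> is_comm T B ->
  is_comm (fun x => a *: S x + T x) (fun x => a *: A x + B x).
Proof.
move=> SA TB x y xy; have [_ _ Nlin] := subsp_diagG d.
have := Nlin a _ _ (SA _ _ xy) (TB _ _ xy); congr (N (_, _)) => /=.
by rewrite scalerDr -!addrA; congr (_ + _); rewrite addrCA.
Qed.

Lemma dom_delta_bounded k T : dom_delta N k T -> bounded_op T.
Proof. by case: k => [|k] []. Qed.

Lemma dom_delta_comm k T : dom_delta N k.+1 T ->
  [/\ bounded_op T, dom_delta N k (comm_closure N T) & is_comm T (comm_closure N T)].
Proof.
move=> [bT [bc dB]]; split => //.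
by have [] := bounded_comm_mx bT (bounded_comm_bdd bT bc).
Qed.

Lemma dom_delta_le k T : dom_delta N k.+1 T -> dom_delta N k T.
Proof.
move=> /dom_deltaP[bT h]; apply/dom_deltaP; split => // l lk.
by apply: h; exact: leqW.
Qed.

Lemma dom_deltaS k T B : bounded_op T -> is_comm T B -> dom_delta N k B ->
  dom_delta N k.+1 T.
Proof.
move=> bT TB dB; have [bc E] := is_comm_closure bT (dom_delta_bounded dB) TB.
by split => //; split => //; rewrite E.
Qed.

Lemma dom_delta_lin k S T (a : C) : dom_delta N k S -> dom_delta N k T ->
  dom_delta N k (fun x => a *: S x + T x).
Proof.
elim: k S T => [|k IH] S T.
  by move=> [bS _] [bT _]; split => //; exact: bounded_op_lin.
move=> /dom_delta_comm[bS dA SA] /dom_delta_comm[bT dB TB].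
apply: (dom_deltaS _ (is_comm_lin a SA TB)); first exact: bounded_op_lin.
exact: IH.
Qed.

Lemma dom_delta_comp k S T : dom_delta N k S -> dom_delta N k T ->
  dom_delta N k (S \o T).
Proof.
elim: k S T => [|k IH] S T.
  by move=> [bS _] [bT _]; split => //; exact: bounded_op_comp.
move=> dS dT; have [bS dA SA] := dom_delta_comm dS.
have [bT dB TB] := dom_delta_comm dT.
apply: (dom_deltaS _ (is_comm_comp bS SA TB)); first exact: bounded_op_comp.
rewrite (_ : (fun x => _) = fun x => 1 *: (S \o comm_closure N T) x + (comm_closure N S \o T) x).
  by apply: dom_delta_lin; apply: IH => //; exact: dom_delta_le.
by apply/funext => x; rewrite scale1r.
Qed.

End Commutator.

Variable d : I -> R.
Local Notation N := (diagG d).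
Local Notation Nabs := (diagG (fun i => `|d i|)).

Lemma absop_diagG : absop N = Nabs.
Proof. exact: fcalc_diagG. Qed.

(** The condition on a single element of the algebra. [bounded_comm] is included because only then
    is [comm_closure] the bounded extension of the commutator. *)
Definition regular_op (T : H -> H) : Prop :=
  [/\ bounded_comm N T, dom_delta_infty (absop N) T
    & dom_delta_infty (absop N) (comm_closure N T)].

Lemma regular_op_bounded T : regular_op T -> bounded_op T.
Proof. by move=> [_ /(_ 0%N)[]]. Qed.

Lemma regular_op_is_comm T : regular_op T ->
  is_comm d T (comm_closure N T) /\ bounded_op (comm_closure N T).
Proof.
move=> rT; have bT := regular_op_bounded rT; have [bc _ _] := rT.
by have [] := bounded_comm_mx bT (bounded_comm_bdd bT bc).
Qed.

Lemma regular_op_intro T B : is_comm d T B -> dom_delta_infty (absop N) T ->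
  dom_delta_infty (absop N) B -> regular_op T.
Proof.
move=> TB dT dB; have bT := (dT 0%N).1; have bB := (dB 0%N).1.
by have [bc E] := is_comm_closure bT bB TB; split => //; rewrite E.
Qed.

Lemma regular_op_lin S T (a : C) : regular_op S -> regular_op T ->
  regular_op (fun x => a *: S x + T x).
Proof.
move=> rS rT; have [SA bA] := regular_op_is_comm rS; have [TB bB] := regular_op_is_comm rT.
have [_ dS dA] := rS; have [_ dT dB] := rT.
apply: (regular_op_intro (is_comm_lin a SA TB)) => k; rewrite absop_diagG;
  by apply: dom_delta_lin; rewrite -absop_diagG.
Qed.

Lemma regular_op_comp S T : regular_op S -> regular_op T -> regular_op (S \o T).
Proof.
move=> rS rT; have [SA bA] := regular_op_is_comm rS; have [TB bB] := regular_op_is_comm rT.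
have bS := regular_op_bounded rS.
have [_ dS dA] := rS; have [_ dT dB] := rT.
apply: (regular_op_intro (is_comm_comp bS SA TB)) => k; rewrite absop_diagG.
  by apply: dom_delta_comp; rewrite -absop_diagG.
rewrite (_ : (fun x => _) = fun x => 1 *: (S \o comm_closure N T) x + (comm_closure N S \o T) x).
  by apply: dom_delta_lin; apply: dom_delta_comp; rewrite -absop_diagG.
by apply/funext => x; rewrite scale1r.
Qed.

Lemma regular_op0 : regular_op (fun=> 0).
Proof.
have b0 : bounded_op (fun _ : H => 0 : H) by exact: bounded_op0.
have m0 : forall i j, mx e e (fun=> 0) i j = 0 by move=> i j; rewrite /mx dot0l.
have d0 : dom_delta_infty (absop N) (fun=> 0).
  rewrite absop_diagG; apply/dom_delta_inftyP; split => // k.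
  by apply: bdd_ext bdd0 => i j; rewrite /smul m0 mulr0.
apply: (@regular_op_intro _ (fun=> 0)) => //.
by apply: is_comm_mx => // i j; rewrite /dcom /smul !m0 mulr0.
Qed.

End Diagonal.

(** * Spectral decomposition of operators with compact resolvent *)

Lemma closure_min (T : topologicalType) (S P : set T) : closed P -> S `<=` P ->
  closure S `<=` P.
Proof. by move=> cP SP; rewrite closureE; apply: smallest_sub. Qed.

Lemma conjC_real (R : realType) (x : R) : (x%:C%C : R[i])^* = x%:C%C.
Proof. exact: conjc_real. Qed.

Lemma norm_le1 (R : realType) (H : hilbertType R) (x : H) : (`|x| <= 1) = (nrm2 x <= 1).
Proof.
rewrite -ler_sqr ?nnegrE ?normr_ge0 ?ler01 // expr1n normr_nrm2.
by rewrite (_ : 1 = 1%:C%C) // lecR.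
Qed.

Section Spectral.
Context {R : realType} {H : hilbertType R}.
Local Notation C := (R[i]).

Lemma dense_closureP (S : set H) : dense S <-> forall x, closure S x.
Proof.
split=> [dS x B|cS U [x Ux] oU].
  rewrite nbhsE => -[A [oA Ax] AB].
  have [y [Ay Sy]] := dS A (ex_intro _ x Ax) oA.
  by exists y; split => //; exact: AB.
have [y [Sy Uy]] := cS x U (open_nbhs_nbhs (conj oU Ux)).
by exists y.
Qed.

Lemma continuous_dotr (S : topologicalType) (f : S -> H) z : continuous f ->
  continuous (fun p => dot z (f p) : (C : numFieldType)).
Proof. by move=> cf; exact: (comp_continuous (@dotr_continuous _ H z) cf). Qed.

Lemma continuous_nrm2 : continuous (@nrm2 R H).
Proof.
rewrite (_ : @nrm2 R H = fun x => complex.Re (`|x| * `|x|)); last first.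
  by apply/funext => x; rewrite -expr2 normr_nrm2.
have cf : continuous (fun x : H => `|x| * `|x| : (C : numFieldType)).
  by move=> x; apply: (@cvgM (C : numFieldType)); exact: norm_continuous.
exact: (comp_continuous (@continuous_Re R) cf).
Qed.

Section Symmetric.
Variable D : graph H.
Hypothesis sD : self_adjoint D.

Lemma sa_sym x y u v : D (x, y) -> D (u, v) -> dot y u = dot x v.
Proof. by move=> xy uv; exact: (sD.2 u v).1 uv x y xy. Qed.

Lemma sa_lin (a : C) x y u v : D (x, y) -> D (u, v) -> D (a *: x + u, a *: y + v).
Proof.
move=> xy uv; apply/sD.2 => z w zw.
by rewrite !dotDr !dotZr (sa_sym zw xy) (sa_sym zw uv).
Qed.

Lemma sa_00 : D (0, 0).
Proof. by apply/sD.2 => z w _; rewrite !dot0r. Qed.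

Lemma sa_scale (a : C) x y : D (x, y) -> D (a *: x, a *: y).
Proof. by move=> xy; have := sa_lin a xy sa_00; rewrite !addr0. Qed.

Lemma sa_0 w : D (0, w) -> w = 0.
Proof.
move=> w0; suff : forall u, dot u w = 0.
  by move=> /(_ w)/eqP; rewrite dotxx => /eqP[/eqP]; rewrite nrm2_eq0 => /eqP.
move=> u; apply: (closure_min (P := [set u | dot u w = 0]) _ _ ((dense_closureP _).1 sD.1 u)).
  exact: (closed_eq0 (V := (C : numFieldType)) (@dotl_continuous _ H w)).
by move=> z [v zv] /=; rewrite -(sa_sym zv w0) dot0r.
Qed.

End Symmetric.

(** Zorn's lemma. [E] will be the set of all unit vectors, giving a basis, or the unit eigenvectors
    of [D], giving an eigenbasis. *)
Lemma max_orthonormal (E : set H) : (forall x, E x -> nrm2 x = 1) ->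
  exists S : set H, [/\ S `<=` E, orthonormal (fun x : S => val x) &
    forall x, E x -> ~ forall y : S, dot x (val y) = 0].
Proof.
move=> E1.
pose P := [set S : set H | S `<=` E /\ forall x y, S x -> S y -> x != y -> dot x y = 0].
have [F FP tF|S [[SE So] Smax]] := Zorn_bigcup (P := P).
  split=> [x [S FS Sx]|x y [S FS Sx] [T FT Ty] xy]; first exact: (FP S FS).1.
  have [ST|TS] := tF S T FS FT.
    by apply: (FP T FT).2 => //; exact: ST.
  by apply: (FP S FS).2 => //; exact: TS.
exists S; split => //.
  move=> x y; have [->|xy] := eqVneq x y.
    by rewrite dotxx E1 //; apply: SE; exact: set_valP.
  by apply: So; [exact: set_valP|exact: set_valP|rewrite (inj_eq val_inj)].
move=> x Ex xo.
have nSx : ~ S x.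
  move=> Sx; have /= := xo (SigSub (mem_set Sx)).
  by rewrite dotxx E1 // => /complexI/eqP; rewrite oner_eq0.
have xo' y : S y -> dot x y = 0 by move=> Sy; exact: xo (SigSub (mem_set Sy)).
apply: (Smax (S `|` [set x])).
  split; first by move=> y Sy; left.
  by move=> h; apply: nSx; apply: h; right.
split=> [y [/SE//|->//]|y z [Sy|->] [Sz|->]].
- exact: So.
- by move=> _; rewrite dotC xo' // rmorph0.
- by move=> _; exact: xo'.
- by rewrite eqxx.
Qed.

Lemma exists_onb : exists (I : choiceType) (e : I -> H), onb e.
Proof.
have [S [_ So Smax]] := @max_orthonormal [set x | nrm2 x = 1] (fun x h => h).
exists S, (fun x : S => val x); split => // x xo.
apply/eqP; apply: contrapT => /negP x0.
have nx : 0 < nrm2 x by rewrite lt_def nrm2_eq0 x0 nrm2_ge0.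
apply: (Smax ((Num.sqrt (nrm2 x))^-1%:C%C *: x)).
  by rewrite /= nrm2Z sqn_real exprVn sqr_sqrtr ?nrm2_ge0 // mulVf // gt_eqF.
by move=> y; rewrite dotZl xo mulr0.
Qed.

Lemma subsp_orthogonal (S : set H) : subsp [set x | forall y, S y -> dot x y = 0].
Proof.
split.
- rewrite (_ : [set x | _] = \bigcap_(y in S) [set x | dot x y = 0]) //.
  apply: closed_bigI => y _.
  exact: (closed_eq0 (V := (C : numFieldType)) (@dotl_continuous _ H y)).
- by move=> y _; rewrite dot0l.
- by move=> a x z xS zS y Sy; rewrite dotDl dotZl xS // zS // mulr0 addr0.
Qed.

(* mu is the supremum of <A x, x> on the unit ball of M; it is attained by
   compactness, since |A x - mu x|^2 <= mu (mu - <A x, x>). *)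
Lemma compact_eigenvector (A : H -> H) (M : set H) (x0 : H) : compact_op A ->
  (forall x y, dot (A x) y = dot x (A y)) -> (forall x, 0 <= complex.Re (dot (A x) x)) ->
  subsp M -> (forall x, M x -> M (A x)) -> M x0 -> 0 < complex.Re (dot (A x0) x0) ->
  exists mu v, [/\ 0 < mu, M v, v != 0 & A v = (mu : R)%:C%C *: v].
Proof.
move=> [bA cA] sA pA sM MA Mx0 qx0; have /bounded_opP[lA [B AB]] := bA.
have [cM M0 Mlin] := sM.
have MZ (a : C) x : M x -> M (a *: x) by move=> Mx; have := Mlin a _ _ Mx M0; rewrite addr0.
pose q x := complex.Re (dot (A x) x).
have qZ (t : R) x : q (t%:C%C *: x) = t ^+ 2 * q x.
  by rewrite /q (linZ lA) dotZl dotZr conjC_real mulrA -rmorphM ReM_real expr2.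
pose S := [set q x | x in [set x | M x /\ nrm2 x <= 1]].
have x0n : 0 < nrm2 x0.
  rewrite lt_def nrm2_ge0 nrm2_eq0 andbT; apply: contraTneq qx0 => ->.
  by rewrite dot0r ltxx.
have unit x : M x -> 0 < nrm2 x -> S (q x / nrm2 x).
  move=> Mx nx; exists ((Num.sqrt (nrm2 x))^-1%:C%C *: x).
    split; first exact: MZ.
    by rewrite nrm2Z sqn_real exprVn sqr_sqrtr ?nrm2_ge0 // mulVf // gt_eqF.
  by rewrite qZ exprVn sqr_sqrtr ?nrm2_ge0 // mulrC.
have supS : has_sup S.
  split; first by exists (q x0 / nrm2 x0); exact: unit.
  exists (`|B| + 1) => _ [x [Mx nx] <-].
  have := Re_dot_le (A x) x; have := AB x; have := ler_norm B; rewrite /q.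
  have := nrm2_ge0 x; have := normr_ge0 B; nra.
set mu := sup S.
have mu0 : 0 < mu.
  apply: (@lt_le_trans _ _ (q x0 / nrm2 x0)); first by rewrite divr_gt0.
  by apply: sup_upper_bound => //; exact: unit.
have qmu x : M x -> q x <= mu * nrm2 x.
  move=> Mx; have [/eqP|nx] := eqVneq (nrm2 x) 0.
    by rewrite nrm2_eq0 => /eqP ->; rewrite /q dot0r nrm20 mulr0.
  have nx0 : 0 < nrm2 x by rewrite lt_def nx nrm2_ge0.
  by rewrite -ler_pdivrMr //; apply: sup_upper_bound => //; exact: unit.
have key x : M x -> nrm2 x <= 1 -> nrm2 (A x - mu%:C%C *: x) <= mu * (mu - q x).
  move=> Mx nx.
  (* The form [q] is nonnegative at x - A x / mu, and [q (A x)] is at most mu |A x|^2. *)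
  have N : nrm2 (A x) <= mu * q x.
    have qB (t : R) : q (x - t%:C%C *: A x) = q x - 2 * t * nrm2 (A x) + t ^+ 2 * q (A x).
      have ReB (y z : C) : complex.Re (y - z) = complex.Re y - complex.Re z by case: y z => ? ? [].
      rewrite /q (linB lA) (linZ lA) dotBl !dotBr !dotZl !dotZr conjC_real.
      by rewrite (sA (A x) x) !dotxx !ReB !ReM_real /=; ring.
    have := pA (x - mu^-1%:C%C *: A x); rewrite -/(q _) qB.
    have := qmu (A x) (MA _ Mx); move: (nrm2 (A x)) (q x) (q (A x)) => n a b.
    move=> bn h.
    have : mu^-1 ^+ 2 * b <= mu^-1 * n.
      rewrite expr2 -mulrA.
      rewrite ler_pM2l ?invr_gt0 // mulrC ler_pdivrMr //; lra.
    move=> h2; have : mu^-1 * n <= a by lra.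
    by rewrite mulrC ler_pdivrMr // mulrC.
  rewrite nrm2B nrm2Z sqn_real dotZr conjC_real ReM_real -/(q x).
  have := qmu _ Mx; nra.
(* The last condition keeps [K] away from 0, so that a limit of approximate eigenvectors is nonzero.
   It holds for [A x] when [q x] is at least mu / 2, by Cauchy-Schwarz. *)
pose K := closure (A @` [set x | `|x| <= 1]) `&` (M `&` [set y | mu ^+ 2 / 4 <= nrm2 y]).
have cK : compact K.
  apply: compact_closedI => //; apply: closedI => //.
  apply: (closed_preim (A := [set y | mu ^+ 2 / 4 <= y]) continuous_nrm2).
  exact: closed_ge.
pose phi y := nrm2 (A y - mu%:C%C *: y).
have cphi : continuous phi.
  have cf : continuous (fun y => A y - mu%:C%C *: y).
    move=> y; apply: cvgB; first exact: bounded_op_continuous.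
    by apply: cvgZr; exact: cvg_id.
  exact: (comp_continuous continuous_nrm2 cf).
have cphiK : compact (phi @` K).
  by apply: continuous_compact => //; exact: continuous_subspaceT.
have clphi : closed (phi @` K) by apply: compact_closed => //; exact: norm_hausdorff.
suff : (phi @` K) 0.
  move=> [v [_ [Mv vn]] /eqP]; rewrite nrm2_eq0 subr_eq0 => /eqP Av.
  exists mu, v; split => //; rewrite -nrm2_eq0 gt_eqF //.
  by apply: lt_le_trans vn; rewrite divr_gt0 // exprn_gt0.
apply: clphi => U /nbhs_ballP[eps /= eps0 epsU].
(* The first bound puts [A x] into [K]. The second makes [phi (A x)], which is at most (|B| + 1) mu
   eta, smaller than [eps]. *)
pose eta := Num.min (mu / 2) (eps / (2 * (mu * (`|B| + 1)))).
have mB : 0 < mu * (`|B| + 1) by rewrite mulr_gt0 // ltr_wpDl.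
have eta0 : 0 < eta by rewrite lt_min !divr_gt0 // mulr_gt0.
have [_ [x [Mx nx] <-] qx] := sup_adherent eta0 supS.
have eta1 : eta <= mu / 2 by rewrite ge_min lexx.
have eta2 : eta <= eps / (2 * (mu * (`|B| + 1))) by rewrite ge_min lexx orbT.
exists (phi (A x)); split.
  exists (A x) => //; split; last split.
  - apply: subset_closure; exists x => //=.
    by rewrite norm_le1.
  - exact: MA.
  - have := CauchySchwarz (A x) x.
    have qr : q x ^+ 2 <= sqn (dot (A x) x) by rewrite /sqn lerDl sqr_ge0.
    have := nrm2_ge0 (A x) => nA h.
    have : q x ^+ 2 <= nrm2 (A x) by nra.
    have : mu / 2 <= q x by rewrite -/mu in qx; lra.
    move=> h1 h2; rewrite /=; nra.
apply: epsU; rewrite /ball /= sub0r normrN ger0_norm ?nrm2_ge0 //.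
have -> : phi (A x) = nrm2 (A (A x - mu%:C%C *: x)).
  by rewrite /phi (linB lA) (linZ lA).
apply: (le_lt_trans (AB _)).
apply: (@le_lt_trans _ _ ((`|B| + 1) * (mu * eta))).
  apply: (@le_trans _ _ ((`|B| + 1) * nrm2 (A x - mu%:C%C *: x))).
    by rewrite ler_wpM2r ?nrm2_ge0 // (le_trans (ler_norm B)) // lerDl.
  rewrite ler_wpM2l ?addr_ge0 // (le_trans (key x Mx nx)) // ler_wpM2l ?(ltW mu0) //.
  by rewrite -/mu in qx; lra.
rewrite mulrA [(_ + 1) * mu]mulrC -ltr_pdivlMl //.
apply: (le_lt_trans eta2); set m := mu * _ in mB *.
have p : 0 < m^-1 * eps by rewrite mulr_gt0 ?invr_gt0.
rewrite (_ : eps / (2 * m) = (m^-1 * eps) / 2); first by lra.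
by field; rewrite gt_eqF.
Qed.

(* An eigenvector v' of 1 + D^2 orthogonal to S satisfies D^2 v' = t^2 v', so
   D v' + t v' or D v' - t v' is an eigenvector of D, unless both vanish and
   then D v' = 0. *)
Lemma eigenvector_in (D : graph H) (S : set H) (x0 : H) : self_adjoint D ->
  compact_resolvent D -> (forall y, S y -> exists t : R, D (y, t%:C%C *: y)) ->
  x0 != 0 -> (forall y, S y -> dot x0 y = 0) ->
  exists2 v, v != 0 & (forall y, S y -> dot v y = 0) /\ exists t : R, D (v, t%:C%C *: v).
Proof.
move=> sD [T [[bT cT] _ TD]] SD x0n x0S.
pose A := T \o T.
have AD y : Delta D (A y, y) by apply/TD.
have bA : bounded_op A by exact: bounded_op_comp.
have cA : compact_op A.
  split => //.
  have bTT := bounded_op_continuous bT.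
  have := bT => /bounded_opP[lT [B TB]].
  (* [k] bounds the norm of [T], so [A] maps the unit ball into [k] times the image of the unit ball
     under [T], whose closure is compact. *)
  pose k : R := Num.sqrt (`|B| + 1).
  have k0 : 0 < k by rewrite sqrtr_gt0 ltr_wpDl.
  pose f (z : H) := k%:C%C *: z.
  have cf : continuous f by move=> z; apply: cvgZr; exact: cvg_id.
  have cfK : compact (f @` closure (T @` [set x | `|x| <= 1])).
    by apply: continuous_compact => //; exact: continuous_subspaceT.
  apply: (subclosed_compact _ cfK); first exact: closed_closure.
  rewrite [X in X `<=` _]closureE; apply: smallest_sub.
    by apply: compact_closed => //; exact: norm_hausdorff.
  move=> _ [x /= x1 <-]; exists (T (k^-1%:C%C *: T x)).
    apply: subset_closure; exists (k^-1%:C%C *: T x) => //=.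
    rewrite -[leRHS](mul1r 1) -[X in _ <= X * _]/((1 : R)%:C%C).
    have k1 : `|T x| <= k%:C%C * `|x|.
      rewrite ler_norm_nrm2 ?(ltW k0) // sqr_sqrtr ?addr_ge0 //.
      by rewrite (le_trans (TB x)) // ler_wpM2r ?nrm2_ge0 // (le_trans (ler_norm B)) // lerDl.
    rewrite normrZ ger0_norm ?ler0c ?invr_ge0 ?(ltW k0) // fmorphV mulrC ler_pdivrMr ?ltcR //.
    by rewrite !mul1r (le_trans k1) // ler_piMr // ler0c ltW.
  by rewrite /f /= (linZ lT) scalerA -rmorphM /= divff ?gt_eqF // scale1r.
have DE x y : Delta D (x, y) -> exists w, D (x, w) /\ D (w, y - x).
  by move=> [w [z [/= xw wz ->]]]; exists w; rewrite addrAC subrr add0r.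
have sA x y : dot (A x) y = dot x (A y).
  have [w [xw wx]] := DE _ _ (AD x); have [w' [yw wy]] := DE _ _ (AD y).
  rewrite -[y in LHS](subrK (A y)) -[x in RHS](subrK (A x)) dotDr dotDl.
  congr (_ + _); rewrite -(sa_sym sD xw wy) -(sa_sym sD wx yw) //.
have pA' x : dot (A x) x = (nrm2 (A x))%:C%C + dot (A x) (x - A x).
  by rewrite -dotxx -dotDr addrCA subrr addr0.
have pA2 x w : D (A x, w) -> D (w, x - A x) -> dot (A x) (x - A x) = (nrm2 w)%:C%C.
  by move=> xw wx; rewrite -(sa_sym sD xw wx) dotxx.
have pA x : 0 <= complex.Re (dot (A x) x).
  have [w [xw wx]] := DE _ _ (AD x).
  by rewrite pA' (pA2 _ w) // raddfD /= addr_ge0 // nrm2_ge0.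
pose M := [set x | forall y, S y -> dot x y = 0].
have sM : subsp M by exact: subsp_orthogonal.
(* For an eigenvector [y] with eigenvalue [t], (1 + t^2) <A x, y> = <x, y> = 0. *)
have MA x : M x -> M (A x).
  move=> Mx y Sy; have [w [xw wx]] := DE _ _ (AD x); have [t yt] := SD y Sy.
  have E1 : dot w y = t%:C%C * dot (A x) y.
    by rewrite (sa_sym sD xw yt) dotZr conjC_real.
  have : dot (x - A x) y = t%:C%C * dot w y.
    by rewrite (sa_sym sD wx yt) dotZr conjC_real.
  rewrite dotBl Mx // E1 sub0r mulrA -rmorphM => h.
  have : (1 + t * t)%:C%C * dot (A x) y = 0.
    by rewrite rmorphD mulrDl -h mul1r subrr.
  move=> /eqP; rewrite mulf_eq0 => /orP[|/eqP//].
  have p : 0 < 1 + t * t by have := sqr_ge0 t; nra.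
  by rewrite (inj_eq (@complexI R) _ 0) (gt_eqF p).
have qx0 : 0 < complex.Re (dot (A x0) x0).
  rewrite lt_def pA andbT; apply: contraNneq x0n => q0.
  have [w [xw wx]] := DE _ _ (AD x0).
  move: q0; rewrite pA' (pA2 _ w) // raddfD /= => /eqP.
  rewrite paddr_eq0 ?nrm2_ge0 // !nrm2_eq0 => /andP[/eqP Ax0 /eqP w0].
  by move: wx; rewrite Ax0 w0 subr0 => /(sa_0 sD) ->.
have [mu [v [mu0 Mv v0 Av]]] := compact_eigenvector cA sA pA sM MA x0S qx0.
have [w [vw wv]] := DE _ _ (AD v).
(* [la] is the eigenvalue of D^2 at [v'], since 1 + D^2 takes [v'] to [v], which is [v'] divided by
   [mu]. *)
pose v' := A v; pose la := (1 - mu) / mu.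
have v'0 : v' != 0 by rewrite /v' Av scaler_eq0 negb_or v0 andbT (inj_eq (@complexI R) _ 0) gt_eqF.
have Mv' : M v' by exact: MA.
have wv' : D (w, la%:C%C *: v').
  rewrite (_ : la%:C%C *: v' = v - A v) // /v' Av scalerA -rmorphM /= /la divfK ?gt_eqF //.
  by rewrite rmorphB scalerBl scale1r.
have la0 : 0 <= la.
  have := sa_sym sD vw wv'; rewrite dotxx dotZr conjC_real dotxx -rmorphM => /complexI h.
  have nv' : 0 < nrm2 v' by rewrite lt_def nrm2_eq0 v'0 nrm2_ge0.
  by rewrite -(pmulr_lge0 _ nv') -h nrm2_ge0.
pose t := Num.sqrt la; have tt : t * t = la by rewrite -expr2 sqr_sqrtr.
have Mw : M w.
  move=> y Sy; have [s ys] := SD y Sy.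
  by rewrite (sa_sym sD vw ys) dotZr Mv' // mulr0.
have eig (s : R) : s * s = la -> D (s%:C%C *: v' + w, s%:C%C *: (s%:C%C *: v' + w)).
  move=> ss; have := sa_lin sD s%:C%C vw wv'; congr (D (_, _)).
  by rewrite scalerDr scalerA -rmorphM /= ss addrC.
have Mu (s : R) y : S y -> dot (s%:C%C *: v' + w) y = 0.
  by move=> Sy; rewrite dotDl dotZl Mv' // Mw // mulr0 addr0.
have [u0|u0] := eqVneq (t%:C%C *: v' + w) 0; last first.
  by exists (t%:C%C *: v' + w) => //; split; [exact: Mu|exists t; exact: eig].
have [u1|u1] := eqVneq ((- t)%:C%C *: v' + w) 0; last first.
  exists ((- t)%:C%C *: v' + w) => //; split; first exact: Mu.
  by exists (- t); apply: eig; rewrite mulrNN.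
have w0 : w = 0.
  have h : (t%:C%C *: v' + w) + ((- t)%:C%C *: v' + w) = w + w.
    by rewrite addrACA -scalerDl -rmorphD subrr scale0r add0r.
  move: h; rewrite u0 u1 addr0 -mulr2n -scaler_nat => /esym/eqP.
  by rewrite scaler_eq0 pnatr_eq0 => /eqP.
by exists v' => //; split => //; exists 0; rewrite scale0r -[X in D (_, X)]w0.
Qed.

End Spectral.

(** * Diagonal operators: self-adjointness, discreteness and compact resolvent *)

Section DiagonalSelfAdjoint.
Context {R : realType} {H : hilbertType R} {I : choiceType}.
Local Notation C := (R[i]).
Variable e : I -> H.
Hypothesis oe : onb e.

Lemma diagG_sym (d : I -> R) x y u v : diagG e d (x, y) -> diagG e d (u, v) ->
  dot v x = dot u y.
Proof.
move=> xy uv.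
apply: (@diagG_ind _ _ _ e oe d [set p : H * H | dot p.2 x = dot p.1 y]) uv => [|i].
  split.
  - apply: (closed_eqf (V := (C : numFieldType)) (f := fun p : H * H => dot p.2 x)
      (g := fun p : H * H => dot p.1 y)).
      exact: (continuous_dotl (@snd_continuous H H)).
    exact: (continuous_dotl (@fst_continuous H H)).
  - by rewrite /= !dot0l.
  - by move=> a p q /= hp hq; rewrite !dotDl !dotZl hp hq.
rewrite /= dotZl dotC [RHS]dotC (xy i) rmorphM /= -!dotC.
by congr (_ * _); rewrite conjC_real.
Qed.

Lemma self_adjoint_diagG (d : I -> R) : self_adjoint (diagG e d).
Proof.
split; first by apply/dense_closureP; exact: dense_dom_diagG.
move=> x y; split => [xy u v uv|h i /=]; first exact: diagG_sym uv.
have := h _ _ (diagG_e oe d i); rewrite dotZl => E.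
by rewrite dotC -E rmorphM /= -dotC conjC_real.
Qed.

(** Pairing with the eigenvectors puts [D] inside the symmetric operator [diagG e d], and a
    self-adjoint operator has no proper symmetric extension. *)
Lemma diagG_self_adjoint (D : graph H) (d : I -> R) : self_adjoint D ->
  (forall i, D (e i, (d i)%:C%C *: e i)) -> D = diagG e d.
Proof.
move=> sD De.
have sub : D `<=` diagG e d.
  move=> [x y] xy i /=; rewrite (sa_sym sD xy (De i)) dotZr conjC_real //.
apply/seteqP; split => // -[x y] xy; apply/sD.2 => u v uv.
by apply: diagG_sym xy _; exact: sub.
Qed.

Lemma diag_op (g : I -> R) B : (forall i, `|g i| <= B) ->
  exists T : H -> H, [/\ forall x i, dot (T x) (e i) = (g i)%:C%C * dot x (e i),
    forall x y, dot (T x) y = dot x (T y) & forall x, nrm2 (T x) <= B ^+ 2 * nrm2 x].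
Proof.
move=> gB.
have g2 i : g i ^+ 2 <= B ^+ 2.
  by rewrite -real_normK ?num_real // ler_sqr ?nnegrE // (le_trans _ (gB i)).
have h x i : sqn ((g i)%:C%C * dot x (e i)) <= B ^+ 2 * sqn (dot x (e i)).
  by rewrite sqnM sqn_real ler_wpM2r ?sqn_ge0.
have ex x : exists y, forall i, dot y (e i) = (g i)%:C%C * dot x (e i).
  by apply: (vec_dominated oe (y := x) (B := B ^+ 2)) => //; exact: sqr_ge0.
have [T TE] := choice ex; exists T; split => //.
  move=> x y; apply: (@diagG_sym g y (T y) x (T x)) => i /=; exact: TE.
move=> x; apply: (nrm2_le_coef oe) => s us.
apply: (@le_trans _ _ (B ^+ 2 * sqs s (fun i => dot x (e i)))).
  by rewrite /sqs mulr_sumr; apply: ler_sum => i _; rewrite TE.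
by rewrite ler_wpM2l ?sqr_ge0 // (bessel oe.1).
Qed.

(** Indices are counted, not values, so finite multiplicity of the eigenvalues is included. *)
Definition discrete (d : I -> R) : Prop := forall B, finite_set [set i | d i ^+ 2 <= B].

Lemma ultra_bounded (T : Type) (F : set_system T) (f : T -> R) : UltraFilter F ->
  F [set z | `|f z| <= 1] -> exists p, forall r, 0 < r -> F [set z | `|f z - p| <= r].
Proof.
move=> uF fF; have pF : ProperFilter F by exact: ultra_proper.
have fF' : F (f @^-1` `[-1, 1]%classic).
  by apply: filterS fF => z; rewrite /= ler_norml => h; rewrite /= in_itv.
have [p [_ cp]] := @segment_compact R (-1) 1 (f z @[z --> F]) _ fF'.
exists p => r r0; have [//|nr] := in_ultra_setVsetC [set z | `|f z - p| <= r] uF.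
have [y [ny yp]] := cp [set y | ~ `|y - p| <= r] (ball p r) nr (nbhsx_ballx p r r0).
by exfalso; apply: ny; move: yp; rewrite -ball_normE /= distrC => /ltW.
Qed.

(** Along an ultrafilter on the closed image of the ball each coordinate converges, and outside a
    finite set of indices the vectors are uniformly small; so the ultrafilter is Cauchy. *)
Lemma compact_diag (g : I -> R) (T : H -> H) : (forall i, `|g i| <= 1) ->
  (forall x i, dot (T x) (e i) = (g i)%:C%C * dot x (e i)) ->
  (forall r, 0 < r -> finite_set [set i | r < `|g i|]) ->
  compact (closure (T @` [set x | `|x| <= 1])).
Proof.
move=> g1 TE gf; rewrite compact_ultra => F uF FK.
have pF : ProperFilter F by exact: ultra_proper.
set K := closure _ in FK *.
have coefK i : F [set z | sqn (dot z (e i)) <= 1].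
  apply: filterS FK; apply: closure_min.
    apply: (closed_preim (f := fun z => sqn (dot z (e i))) (A := [set y | y <= 1])); last exact: closed_le.
    rewrite (_ : (fun z => _) = fun z => nrm2 (dot z (e i) *: e i)); last first.
      by apply/funext => z; rewrite nrm2Z /nrm2 oe.1 eqxx mulr1.
    apply: (comp_continuous continuous_nrm2) => z.
    by apply: cvgZl; exact: dotl_continuous.
  move=> _ [x /= + <-]; rewrite norm_le1 => x1; rewrite TE sqnM sqn_real.
  have := bessel oe.1 x (s := [:: i]) isT; rewrite /sqs big_seq1 => xi.
  have := g1 i; rewrite ler_norml => /andP[? ?].
  have := sqn_ge0 (dot x (e i)); have : g i ^+ 2 <= 1 by nra.
  by have := sqr_ge0 (g i); nra.
have lim i : exists c : C, forall r, 0 < r -> F [set z | sqn (dot z (e i) - c) <= r ^+ 2 *+ 2].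
  have ReF : F [set z | `|complex.Re (dot z (e i))| <= 1].
    apply: filterS (coefK i) => z /=; case: (dot z (e i)) => x y.
    by rewrite /sqn /= ler_norml; have := sqr_ge0 x; have := sqr_ge0 y; nra.
  have ImF : F [set z | `|complex.Im (dot z (e i))| <= 1].
    apply: filterS (coefK i) => z /=; case: (dot z (e i)) => x y.
    by rewrite /sqn /= ler_norml; have := sqr_ge0 x; have := sqr_ge0 y; nra.
  have [a aF] := ultra_bounded uF ReF; have [b bF] := ultra_bounded uF ImF.
  exists (Complex a b) => r r0; apply: filterS (filterI (aF r r0) (bF r r0)) => z [] /=.
  case: (dot z (e i)) => x y /=; rewrite /sqn /= !ler_norml => /andP[? ?] /andP[? ?]; nra.
have [c cF] := choice lim.
suff : cauchy F.
  move=> /cauchy_cvg/cvg_ex[p Fp]; exists p; split; last exact: Fp.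
  by apply: (closed_cvg K _ _ p (Fp : id z @[z --> F] --> p)); [exact: closed_closure|exact: FK].
apply: cauchy_exP => eps eps0.
have [e1 e10 ->] : exists2 e1 : R, 0 < e1 & eps = e1%:C%C.
  exists (complex.Re eps); last by rewrite RRe_real // gtr0_real.
  by rewrite -ltcR RRe_real // gtr0_real.
(* The tail contributes at most r^2 and the coordinates in [s] at most 2 r^2 to the squared
   distance, which is thus at most 2 (r^2 + 2 r^2) and below (3 r)^2. Dividing [r] by the size of
   [s] plus one in [eta] ensures the second bound. *)
pose r := e1 / 3; have r0 : 0 < r by rewrite divr_gt0.
have [s0 s0E] := (finite_seqP _).1 (gf r r0).
pose s := undup s0; have us : uniq s by exact: undup_uniq.
have sE i : i \notin s -> `|g i| <= r.
  rewrite mem_undup => is_; rewrite leNgt; apply/negP => gi.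
  by move/negP: is_; apply; have : [set` s0] i by rewrite -s0E.
pose x := \sum_(i <- s) c i *: e i; exists x.
pose eta := r / (size s).+1%:R.
have eta0 : 0 < eta by rewrite divr_gt0.
have Pz : F [set z | nrm2 (z - \sum_(i <- s) dot z (e i) *: e i) <= r ^+ 2].
  apply: filterS FK; apply: closure_min.
    apply: closed_nrm2_le => z; apply: cvgB; first exact: cvg_id.
    apply: (@cvg_sum_seq _ H _ _ _ s (fun i z => dot z (e i) *: e i)) => i.
    by apply: cvgZl; exact: dotl_continuous.
  move=> _ [y /= + <-]; rewrite norm_le1 => y1.
  apply: (nrm2_le_coef oe) => t ut.
  apply: (@le_trans _ _ (r ^+ 2 * sqs t (fun i => dot y (e i)))).
    rewrite mulr_sumr; apply: ler_sum => i _.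
    rewrite dotBl (dot_fin oe.1) //; case: ifPn => is_.
      by rewrite subrr sqn0 mulr_ge0 ?sqr_ge0 ?sqn_ge0.
    rewrite subr0 TE sqnM sqn_real ler_wpM2r ?sqn_ge0 //.
    by rewrite -real_normK ?num_real // ler_sqr ?nnegrE ?(ltW r0) // sE.
  by rewrite ler_piMr ?sqr_ge0 // (le_trans (bessel oe.1 _ ut)).
have Cz : F [set z | forall i, i \in s -> sqn (dot z (e i) - c i) <= eta ^+ 2 *+ 2].
  elim: {+}s => [|i t IH]; first by apply: filterS filterT.
  apply: filterS (filterI (cF i eta eta0) IH) => z [zi zt] j.
  by rewrite inE => /orP[/eqP ->|/zt].
apply: filterS (filterI Pz Cz) => z [zP zC].
rewrite -ball_normE /= distrC -ltr_sqr ?nnegrE ?normr_ge0 ?ler0c ?ltW //.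
rewrite normr_nrm2 -rmorphXn ltcR.
have -> : z - x = (z - \sum_(i <- s) dot z (e i) *: e i) +
    \sum_(i <- s) (dot z (e i) - c i) *: e i.
  have -> : \sum_(i <- s) (dot z (e i) - c i) *: e i = \sum_(i <- s) dot z (e i) *: e i - x.
    by rewrite /x -sumrB; apply: eq_bigr => i _; rewrite scalerBl.
  by rewrite addrA subrK.
apply: (le_lt_trans (nrm2D_le _ _)); rewrite (nrm2_fin oe.1) //.
have : sqs s (fun i => dot z (e i) - c i) <= 2 * r ^+ 2.
  apply: (@le_trans _ _ (\sum_(i <- s) (eta ^+ 2 *+ 2))).
    by rewrite /sqs big_seq [leRHS]big_seq; apply: ler_sum => i; exact: zC.
  rewrite big_const_seq count_predT iter_addr_0 -[leLHS]mulr_natl -(mulr_natl (eta ^+ 2)).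
  suff : (size s)%:R * eta ^+ 2 <= r ^+ 2 by lra.
  rewrite /eta expr_div_n mulrCA ler_piMr ?sqr_ge0 // ler_pdivrMr ?exprn_gt0 // mul1r.
  by rewrite -natrX ler_nat -mulnn mulSn ltnW // ltnS leq_addr.
move: zP; rewrite (_ : e1 = 3 * r); last by rewrite /r; field.
have r20 : 0 < r ^+ 2 by rewrite exprn_gt0.
by rewrite /= (_ : (3 * r) ^+ 2 = 9 * r ^+ 2); [lra|ring].
Qed.

Lemma compact_resolvent_diagG (d : I -> R) : discrete d -> compact_resolvent (diagG e d).
Proof.
move=> dd.
pose n i := Num.sqrt (1 + d i ^+ 2); pose g i := (n i)^-1; pose h i := Num.sqrt (g i).
have p i : 1 <= 1 + d i ^+ 2 by rewrite lerDl sqr_ge0.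
have n1 i : 1 <= n i by rewrite -sqrtr1 ler_wsqrtr.
have n0 i : 0 < n i by apply: lt_le_trans (n1 i).
have g0 i : 0 <= g i by rewrite invr_ge0 ltW.
have g1 i : `|g i| <= 1 by rewrite ger0_norm // invf_le1.
have h1 i : `|h i| <= 1.
  by rewrite ger0_norm ?sqrtr_ge0 // -sqrtr1 ler_wsqrtr // -(ger0_norm (g0 i)).
have [T [TE Tsym TB]] := diag_op g1; have [S [SE Ssym SB]] := diag_op h1.
have lT : linear T.
  by move=> a x y; apply: (onb_eq oe) => i; rewrite dotDl dotZl !TE dotDl dotZl; ring.
have bT : bounded_op T by apply/bounded_opP; split => //; exists (1 ^+ 2).
exists T; split.
- split => //; apply: compact_diag g1 TE _ => r r0.
  apply: sub_finite_set (dd (r ^- 2)) => i /=.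
  rewrite ger0_norm // /g => ri.
  have : n i <= r^-1 by rewrite -(invrK (n i)) lef_pV2 ?posrE ?invr_gt0 // ltW.
  rewrite -ler_sqr ?nnegrE ?invr_ge0 ?(ltW (n0 i)) ?(ltW r0) // sqr_sqrtr; last exact: le_trans (p i).
  by rewrite exprVn => /(le_trans _); apply; rewrite lerDr.
(* Positivity of [T] comes from its square root [S]: <T x, x> = |S x|^2. *)
- move=> x; have -> : T x = S (S x).
    apply: (onb_eq oe) => i; rewrite TE !SE mulrA -rmorphM /= -expr2 sqr_sqrtr //.
  by rewrite Ssym dotxx ler0c nrm2_ge0.
- move=> x y; rewrite (Delta_diagG oe).
  have nn i : n i ^+ 2 = 1 + d i ^+ 2 by rewrite sqr_sqrtr // (le_trans _ (p i)).
  split=> [xy|->] => [|i /=].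
    apply: (onb_eq oe) => i; rewrite !TE (xy i) /= !mulrA -!rmorphM -nn /g.
    by rewrite expr2 mulrA divfK ?gt_eqF // -[_ * n i]mulrC divff ?gt_eqF ?mul1r.
  have gg : (1 + d i ^+ 2) * g i * g i = 1 by rewrite -nn /g; field; rewrite gt_eqF.
  by rewrite !TE !mulrA -!rmorphM gg mul1r.
Qed.

End DiagonalSelfAdjoint.

Section SpectralTheorem.
Context {R : realType} {H : hilbertType R}.

(** The vectors [T (e i)] lie in a compact set, yet one more application of [T] turns them into the
    orthogonal vectors [la i] times [e i], which keep a fixed distance while [d i ^+ 2 <= B]. A
    finite cover by small balls therefore meets only finitely many such indices, and [h] picks one
    in each ball. *)
Lemma discrete_compact_resolvent (I : choiceType) (e : I -> H) (d : I -> R) :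
  onb e -> compact_resolvent (diagG e d) -> discrete d.
Proof.
move=> oe [T [[bT cT] _ TD]] B.
have [B0|B0] := ltP B 0.
  rewrite (_ : [set _ | _] = set0) //; apply/seteqP; split => // i /= h.
  by have := le_lt_trans h B0; rewrite ltNge sqr_ge0.
pose S := [set i | d i ^+ 2 <= B].
have [[i0 Si0]|] := pselect (exists i, S i); last first.
  move=> nS; rewrite (_ : [set _ | _] = set0) //; apply/seteqP; split => // i /= h.
  by case: nS; exists i.
pose la i : R := (1 + d i ^+ 2)^-1.
have p i : 0 < 1 + d i ^+ 2 by rewrite ltr_wpDr ?sqr_ge0.
have TTe i : T (T (e i)) = (la i)%:C%C *: e i.
  rewrite (_ : _ *: _ = T (T ((1 + d i ^+ 2)%:C%C *: ((la i)%:C%C *: e i)))).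
    by rewrite scalerA -rmorphM divff ?gt_eqF // scale1r.
  apply/TD; rewrite (Delta_diagG oe).
  rewrite scalerA mulrC -scalerA; have [_ _ lN] := subsp_diagG e (fun i => 1 + d i ^+ 2).
  have := lN (la i)%:C%C _ _ (diagG_e oe (fun i => 1 + d i ^+ 2) i) (_ : diagG e _ (0, 0)).
  rewrite /= !addr0; apply => k /=.
  by rewrite !dot0l mulr0.
have /bounded_opP[lT [M TM]] := bT.
pose k : R := (1 + B)^-1; have k0 : 0 < k by rewrite invr_gt0 ltr_wpDr.
have kla i : S i -> k <= la i by move=> Si; rewrite lef_pV2 ?posrE ?p ?ltr_wpDr ?lerD2l.
(* Two indices in one ball would give |T (T e_i - T e_j)|^2 < (|M| + 1) (2 r)^2, which is at most
   k^2, against the separation. *)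
pose r : R := k / (2 * (`|M| + 1)).
have M1 : 0 < `|M| + 1 by rewrite ltr_wpDl.
have r0 : 0 < r by rewrite divr_gt0 // mulr_gt0.
have rC0 : 0 < r%:C%C by rewrite ltcR.
rewrite compact_cover in cT.
set K := closure _ in cT.
have [|y Ky|D' _ KD'] := cT H K (fun y => ball y r%:C%C).
- by move=> y _; exact: ball_open.
- by exists y => //; exact: ballxx.
have Te i : K (T (e i)).
  by apply: subset_closure; exists (e i) => //=; rewrite norm_le1 /nrm2 oe.1 eqxx.
pose h y := xget i0 [set i | S i /\ ball y r%:C%C (T (e i))].
have fin : finite_set (h @` [set` D']) by apply: finite_image; exact: finite_fset.
apply: (sub_finite_set _ fin) => i Si; have [y D'y yi] := KD' _ (Te i).
exists y => //; have [Sj yj] : S (h y) /\ ball y r%:C%C (T (e (h y))).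
  exact: (@xgetI _ i0 [set i | S i /\ ball y r%:C%C (T (e i))] i (conj Si yi)).
move: (h y) Sj yj => j Sj yj; apply/eqP; apply: contraT => ij.
have d1 : nrm2 (T (e i) - T (e j)) < (2 * r) ^+ 2.
  rewrite -ltcR -normr_nrm2 rmorphXn ltr_sqr ?nnegrE ?normr_ge0 //; last first.
    by rewrite ler0c mulr_ge0 // ltW.
  move: yi yj; rewrite -ball_normE /= => yi yj.
  rewrite -[T (e i)](subrK y) -addrA (le_lt_trans (ler_normD _ _)) //.
  by rewrite mulr_natl mulr2n rmorphD ltrD // distrC.
have d2 : nrm2 ((la i)%:C%C *: e i - (la j)%:C%C *: e j) <= M * nrm2 (T (e i) - T (e j)).
  rewrite (_ : _ - _ = T (T (e i) - T (e j))); first exact: TM.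
  by rewrite (linB lT) !TTe.
have d3 : k ^+ 2 <= nrm2 ((la i)%:C%C *: e i - (la j)%:C%C *: e j).
  have oij : dot (e i) (e j) = 0 by rewrite oe.1 eq_sym (negPf ij).
  have n1 l : nrm2 (e l) = 1 by rewrite /nrm2 oe.1 eqxx.
  rewrite nrm2B !nrm2Z !sqn_real dotZl dotZr oij !mulr0 subr0 !n1 !mulr1.
  have := kla i Si; have := kla j Sj; nra.
have d4 : nrm2 (T (e i) - T (e j)) >= 0 by exact: nrm2_ge0.
have d5 : M * nrm2 (T (e i) - T (e j)) < (`|M| + 1) * (2 * r) ^+ 2.
  have MM : M <= `|M| + 1 by have := ler_norm M; lra.
  apply: (@le_lt_trans _ _ ((`|M| + 1) * nrm2 (T (e i) - T (e j)))).
    by rewrite ler_wpM2r.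
  by rewrite ltr_pM2l.
have d6 : (`|M| + 1) * (2 * r) ^+ 2 <= k ^+ 2.
  have -> : (`|M| + 1) * (2 * r) ^+ 2 = k ^+ 2 / (`|M| + 1).
    by rewrite /r; move: (`|M| + 1) {M1}(gt_eqF M1) => m m0; field; rewrite m0.
  by rewrite ler_pdivrMr // ler_peMr ?sqr_ge0 // lerDr.
by move: (le_lt_trans (le_trans d3 d2) (lt_le_trans d5 d6)); rewrite ltxx.
Qed.

Lemma spectral_theorem (D : graph H) : self_adjoint D -> compact_resolvent D ->
  exists (I : choiceType) (e : I -> H) (d : I -> R),
    [/\ onb e, D = diagG e d & discrete d].
Proof.
move=> sD cD.
have [S [SE So Smax]] := @max_orthonormal R H
  [set x | nrm2 x = 1 /\ exists t : R, D (x, t%:C%C *: x)] (fun x h => h.1).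
have oS : onb (fun x : S => val x).
  split => // x xo; apply/eqP; apply: contrapT => /negP x0.
  have [|y Sy|v v0 [vS [t vt]]] := eigenvector_in sD cD (S := S) _ x0.
  - by move=> y /SE[].
  - exact: xo (SigSub (mem_set Sy)).
  have nv : 0 < nrm2 v by rewrite lt_def nrm2_eq0 v0 nrm2_ge0.
  apply: (Smax ((Num.sqrt (nrm2 v))^-1%:C%C *: v)).
    split.
      by rewrite nrm2Z sqn_real exprVn sqr_sqrtr ?nrm2_ge0 // mulVf // gt_eqF.
    by exists t; rewrite scalerA mulrC -scalerA; exact: sa_scale.
  by move=> y; rewrite dotZl vS ?mulr0 //; exact: set_valP.
have ex (x : S) : exists t : R, D (val x, t%:C%C *: val x).
  by have [_] := SE _ (set_valP x).
have [d dE] := choice ex.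
have E := diagG_self_adjoint oS sD dE.
by exists S, (fun x : S => val x), d; split => //; apply: discrete_compact_resolvent oS _; rewrite -E.
Qed.

End SpectralTheorem.

(** * Sobolev spaces and iterated commutators with the Laplacian *)

Section Sobolev.
Context {R : realType} {H : hilbertType R} {I : choiceType}.
Local Notation C := (R[i]).
Variables (e : I -> H) (d : I -> R).
Hypothesis oe : onb e.
Local Notation D := (diagG e d).

Definition wt (i : I) : R := Num.sqrt (1 + d i ^+ 2).
Local Notation n := wt.

Let p1 i : 1 <= 1 + d i ^+ 2. Proof. by rewrite lerDl sqr_ge0. Qed.
Lemma wt_ge1 i : 1 <= n i. Proof. by rewrite -sqrtr1 ler_wsqrtr. Qed.
Let n0 i : 0 < n i. Proof. exact: lt_le_trans (wt_ge1 i). Qed.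
Let nN0 i : n i != 0. Proof. by rewrite gt_eqF. Qed.
Let n2 i : n i ^+ 2 = 1 + d i ^+ 2.
Proof. by rewrite sqr_sqrtr // (le_trans _ (p1 i)). Qed.

Lemma wt_abs i : `|n i - `|d i| | <= 1 /\ `| `|d i| - n i| <= 1.
Proof.
suff h : `|n i - `|d i| | <= 1 by split; [|rewrite distrC].
have := n2 i; have := wt_ge1 i; have := normr_ge0 (d i); rewrite -[d i ^+ 2]real_normK ?num_real //.
rewrite ler_norml; move: (n i) `|d i| => x y *; apply/andP; split; nra.
Qed.

Lemma sat_wt_abs X : sat (fun i => `|d i|) X <-> sat n X.
Proof.
by split; apply: (@sat_perturb _ _ _ _ _ 1) => i; have [] := wt_abs i.
Qed.

(** Powers of the weight [wt], the square root of the eigenvalues of Delta; with them the parameter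
    [s] is the Sobolev order itself. *)
Definition Np (s : R) : graph H := diagG e (fun i => n i `^ s).

Lemma Delta_powE s : Delta_pow D s = Np s.
Proof.
rewrite /Delta_pow (Delta_diagG oe) (fcalc_diagG oe) /Np; congr diagG.
apply/funext => i; rewrite /wt -powR12_sqrt ?(le_trans _ (p1 i)) // -powRrM.
by rewrite mulrC.
Qed.

Lemma DeltaE : Delta D = Np 2.
Proof.
rewrite (Delta_diagG oe) /Np; congr diagG; apply/funext => i.
by rewrite powR_mulrn ?(ltW (n0 i)) // n2.
Qed.

Definition W (x : H) : Prop := forall s, dom (Np s) x.
Definition Ns s x := app (Np s) x.

Lemma W_inftyE : W_infty D = W.
Proof.
by apply/seteqP; split=> x Wx s; have := Wx s; rewrite Delta_powE.
Qed.

Lemma ad_DeltaE P x : ad_Delta D P x = Ns 2 (P x) - P (Ns 2 x).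
Proof. by rewrite /ad_Delta DeltaE. Qed.

Lemma NsP x s i : W x -> dot (Ns s x) (e i) = (n i `^ s)%:C%C * dot x (e i).
Proof. by move=> Wx; exact: (dom_diagG oe (Wx s)). Qed.

Lemma Ns_app x y s : Np s (x, y) -> Ns s x = y.
Proof. exact: app_diagG. Qed.

Lemma NsD x s t i : W x -> dot (Ns (s + t) x) (e i) =
  (n i `^ t)%:C%C * dot (Ns s x) (e i).
Proof.
move=> Wx; rewrite !NsP // mulrA -rmorphM -powRD ?(negPf (nN0 i)) ?implybT //.
by rewrite addrC.
Qed.

Lemma W_Ns s x : W x -> W (Ns s x).
Proof. by move=> Wx t; exists (Ns (s + t) x) => i /=; exact: NsD. Qed.

Lemma W_lin a x y : W x -> W y -> W (a *: x + y).
Proof.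
move=> Wx Wy s; have [_ _ lN] := subsp_diagG e (fun i => n i `^ s).
exists (a *: Ns s x + Ns s y).
exact: (lN a (x, _) (y, _) (dom_diagG oe (Wx s)) (dom_diagG oe (Wy s))).
Qed.

Lemma Ns_lin s a x y : W x -> W y -> Ns s (a *: x + y) = a *: Ns s x + Ns s y.
Proof.
move=> Wx Wy; apply: (onb_eq oe) => i.
rewrite NsP; last exact: W_lin.
by rewrite !dotDl !dotZl !NsP //; ring.
Qed.

Lemma W_fin (s : seq I) (c : I -> C) : W (\sum_(i <- s) c i *: e i).
Proof. by move=> t; eexists; exact: diagG_fin. Qed.

Lemma W_e i : W (e i).
Proof. by move=> t; eexists; exact: diagG_e. Qed.

Lemma Ns_fin t (s : seq I) (c : I -> C) : Ns t (\sum_(i <- s) c i *: e i) =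
  \sum_(i <- s) (c i * (n i `^ t)%:C%C) *: e i.
Proof. by apply: Ns_app; exact: diagG_fin. Qed.

Lemma Ns_e t i : Ns t (e i) = (n i `^ t)%:C%C *: e i.
Proof. by apply: Ns_app; exact: diagG_e. Qed.

Lemma wt_powN s i : n i `^ (- s) * n i `^ s = 1.
Proof. by rewrite powRN mulVf // gt_eqF // powR_gt0. Qed.

Section OpToSat.
Variable T : H -> H.
Hypotheses (bT : bounded_op T).
Hypothesis OpT : forall k, Op D k%:R (iter k (ad_Delta D) T).

Let P k := iter k (ad_Delta D) T.

Let PW k x : W x -> W (P k x).
Proof. by have [h _ _] := OpT k; rewrite -W_inftyE; exact: h. Qed.

Let Plin k (a : C) x y : W x -> W y -> P k (a *: x + y) = a *: P k x + P k y.
Proof. by have [_ h _] := OpT k; rewrite -W_inftyE; exact: h. Qed.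

Let W0 : W 0.
Proof. by move: (W_fin [::] (fun=> 0)); rewrite big_nil. Qed.

Let P0 k : P k 0 = 0.
Proof.
have := Plin k 1 W0 W0; rewrite !scale1r addr0 => h.
by apply: (addrI (P k 0)); rewrite -h addr0.
Qed.

Let Psum k (s : seq I) (c : I -> C) :
  P k (\sum_(i <- s) c i *: e i) = \sum_(i <- s) c i *: P k (e i).
Proof.
elim: s => [|i s IH]; first by rewrite !big_nil P0.
by rewrite !big_cons Plin ?IH //; [exact: W_e|exact: W_fin].
Qed.

Let Pcoef k i j : dot (P k (e j)) (e i) = ((n i ^+ 2 - n j ^+ 2) ^+ k)%:C%C * mx e e T i j.
Proof.
elim: k => [|k IH]; first by rewrite expr0 mul1r.
rewrite /P iterS -/(P k) ad_DeltaE dotBl NsP; last exact/PW/W_e.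
have -> : P k (Ns 2 (e j)) = (n j `^ 2)%:C%C *: P k (e j).
  by rewrite Ns_e -[_ *: e j]addr0 Plin ?P0 ?addr0 //; exact: W_e.
rewrite dotZl IH !powR_mulrn ?(ltW (n0 _)) // (exprS _ k) !(rmorphM, rmorphB) /=; ring.
Qed.

(** The bound is used at the single Sobolev exponent s = -k/2. There s + k = -s, so the weight in
    the source norm cancels the factor [Ns s x], and what remains is exactly the symmetric
    weight. *)
Lemma Op_sat : sat n (mx e e T).
Proof.
pose b i := Num.sqrt (n i).
have b0 i : 0 < b i by rewrite sqrtr_gt0.
have nb i : n i = b i ^+ 2 by rewrite sqr_sqrtr // ltW.
apply/(sat_symm_ad wt_ge1 _ b0 nb) => k.
pose s : R := - (k%:R / 2).
have bk i : n i `^ s = (b i ^+ k)^-1.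
  rewrite /s powRN -(powR_mulrn k (ltW (b0 i))) /b -(powR12_sqrt (ltW (n0 i))) -powRrM.
  by rewrite mulrC.
have [_ _ /(_ s)[M PM]] := OpT k.
pose phi x := Ns s (P k (Ns s x)).
have hW x : W x -> W (Ns s x) by exact: W_Ns.
apply: (@mx_bounded_fin _ _ _ e oe _ phi ((complex.Re `|M|) ^+ 2)).
- exact: sqr_ge0.
- move=> t c ut i; rewrite /phi NsP; last exact/PW/hW/W_fin.
  rewrite Ns_fin Psum dot_suml mulr_sumr; apply: eq_bigr => j _.
  rewrite dotZl Pcoef /symm_ad /smul !bk expr_div_n exprMn invfM !rmorphM /=; ring.
move=> t c ut; set x := \sum_(_ <- _) _.
have Wx : W x by exact: W_fin.
rewrite -(nrm2_fin oe.1) // -/x.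
rewrite -ler_norm_nrm2; last by rewrite -ler0c RRe_real ?normr_ge0 // ger0_real.
have := PM (Ns s x); rewrite W_inftyE => /(_ (hW _ Wx)).
rewrite !Delta_powE -/(Ns s _) -/(Ns _ _) => h; have h0 := le_trans (normr_ge0 _) h.
rewrite RRe_real ?ger0_real // (le_trans h) //.
rewrite -[leLHS](ger0_norm h0) normrM normr_id (_ : Ns (s + k%:R) _ = x) //.
apply: (onb_eq oe) => i; rewrite NsP; last exact: hW.
rewrite NsP // mulrA -rmorphM (_ : s + k%:R = - s) ?wt_powN ?mul1r //.
by rewrite /s; field.
Qed.

End OpToSat.

Section SatToOp.
Variable T : H -> H.
Hypotheses (bT : bounded_op T) (sT : sat n (mx e e T)).

(** The matrix of ad_Delta^k(T) N^(-k). The weight is one-sided because the [k] orders are to be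
    absorbed by the argument. *)
Let A k : I -> I -> C :=
  smul (fun i j => ((n i ^+ 2 - n j ^+ 2) / n j) ^+ k) (mx e e T).

Let satA k : sat n (A k).
Proof.
apply: sat_pow sT => X nX.
rewrite (eq_smul (m' := fun i j => (n i - n j) * (n i / n j + 1))).
  rewrite -smulA; apply: sat_comm; apply: sat_smulD; last by rewrite smul1.
  exact: (sat_ratio wt_ge1).
by move=> i j; field.
Qed.

(** The matrix of N^s ad_Delta^k(T) N^(-k-s), whose boundedness is the Sobolev estimate at exponent
    [s]. *)
Let B k s : I -> I -> C := smul (fun i j => n i `^ s * n j `^ (- s)) (A k).

Let exQ (ks : nat * R) : exists Q : H -> H, bounded_op Q /\
  forall i j, mx e e Q j i = B ks.1 ks.2 j i.
Proof.
have /(op_of_mx oe oe)[Q bQ QE] := sat_bdd_powR ks.2 wt_ge1 (satA ks.1).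
by exists Q.
Qed.

Lemma dot_expand (Q : H -> H) y i : bounded_op Q ->
  \sum_(j <- s) dot y (e j) * mx e e Q i j @[s --> fins] --> (dot (Q y) (e i) : (C : numFieldType)).
Proof.
move=> bQ.
have cf : continuous (fun z => dot (Q z) (e i) : (C : numFieldType)).
  exact: (continuous_dotl (bounded_op_continuous bQ)).
have E s : dot (Q (\sum_(j <- s) dot y (e j) *: e j)) (e i) =
    \sum_(j <- s) dot y (e j) * mx e e Q i j.
  rewrite (lin_sum bQ.1) dot_suml; apply: eq_bigr => j _.
  by rewrite (linZ bQ.1) dotZl.
have := cvg_comp _ _ (@fourier _ _ _ e oe y) (cf y).
rewrite (_ : _ \o _ = fun s => \sum_(j <- s) dot y (e j) * mx e e Q i j) //.
by apply/funext => s; exact: E.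
Qed.

(** Unordered expansion of the three coordinates reduces the relation to one between terms, so
    unbounded weights never have to be interchanged with a sum. With [g2 = 0] it moves a power of
    the weight across an operator; with [g2 = -1] it performs one step of [ad_Delta]. *)
Lemma coord_eq (Q1 Q2 Q3 : H -> H) y1 y2 y3 (g1 g2 : C) i :
  bounded_op Q1 -> bounded_op Q2 -> bounded_op Q3 ->
  (forall j, g1 * (dot y1 (e j) * mx e e Q1 i j) + g2 * (dot y2 (e j) * mx e e Q2 i j) =
     dot y3 (e j) * mx e e Q3 i j) ->
  g1 * dot (Q1 y1) (e i) + g2 * dot (Q2 y2) (e i) = dot (Q3 y3) (e i).
Proof.
move=> b1 b2 b3 E.
have c3 := dot_expand (y := y3) (i := i) b3.
have c1 := dot_expand (y := y1) (i := i) b1.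
have c2 := dot_expand (y := y2) (i := i) b2.
have ES s : \sum_(j <- s) dot y3 (e j) * mx e e Q3 i j =
    g1 * (\sum_(j <- s) dot y1 (e j) * mx e e Q1 i j) +
    g2 * (\sum_(j <- s) dot y2 (e j) * mx e e Q2 i j).
  by rewrite !mulr_sumr -big_split; apply: eq_bigr => j _; rewrite /= E.
have k1 := @cvgM (C : numFieldType) _ fins _ (fun=> g1) _ g1 _ (cvg_cst (g1 : (C : numFieldType))) c1.
have k2 := @cvgM (C : numFieldType) _ fins _ (fun=> g2) _ g2 _ (cvg_cst (g2 : (C : numFieldType))) c2.
have FF : Filter (@fins I) by exact: _.
have := @cvgD _ (C : numFieldType) _ fins FF _ _ _ _ (k1 FF FF) (k2 FF FF).
move=> k3'; move: c3; have -> := funext ES => c3.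
exact: (cvg_unique (@norm_hausdorff _ (C : numFieldType)) k3' c3).
Qed.

(** On W the iterated commutator is Q N^k with Q bounded, and N^s Q N^k = Q' N^(s+k) with Q'
    bounded. The second identity gives the invariance of W as well as every Sobolev bound; the first
    is proved by induction on coordinates. *)
Lemma sat_Op k : Op D k%:R (iter k (ad_Delta D) T).
Proof.
have [Q QP] := choice exQ.
pose q k s := Q (k, s).
have bq k' s : bounded_op (q k' s) by exact: (QP (k', s)).1.
have qE k' s i j : mx e e (q k' s) j i = B k' s j i by exact: (QP (k', s)).2.
have npow k' i (s : R) : n i `^ (k'%:R + s) = n i ^+ k' * n i `^ s.
  by rewrite powRD ?(negPf (nN0 i)) ?implybT // powR_mulrn // ltW.
have NN i s : n i `^ s * n i `^ (- s) = 1 by rewrite mulrC wt_powN.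
have shift k' s x i : W x -> (n i `^ s)%:C%C * dot (q k' 0 (Ns k'%:R x)) (e i) =
    dot (q k' s (Ns (k'%:R + s) x)) (e i).
  move=> Wx; have := @coord_eq (q k' 0) (q k' 0) (q k' s) (Ns k'%:R x) (Ns k'%:R x)
    (Ns (k'%:R + s) x) (n i `^ s)%:C%C 0 i (bq _ _) (bq _ _) (bq _ _).
  rewrite mul0r addr0; apply => j; rewrite mul0r addr0 !qE !NsP // npow powR_mulrn ?(ltW (n0 _)) //.
  rewrite /B /smul oppr0 !powRr0 mulr1 mul1r.
  move: (NN j s); move: (n j `^ s) (n j `^ (- s)) (n i `^ s) (n j ^+ k') (dot x (e j)) (A k' i j).
  move=> u v w z x' y' uv.
  rewrite [RHS](_ : _ = (u * v)%:C%C * (z%:C%C * x' * (w%:C%C * y'))); last first.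
    by rewrite !rmorphM /=; ring.
  by rewrite uv mul1r; ring.
have main k' x : W x -> forall i, dot (iter k' (ad_Delta D) T x) (e i) =
    dot (q k' 0 (Ns k'%:R x)) (e i).
  elim: k' x => [|k' IH] x Wx i.
    rewrite /= ; congr dot.
    have -> : Ns 0%:R x = x.
      by apply: (onb_eq oe) => j; rewrite NsP // powRr0 mul1r.
    apply: (mx_inj oe oe) => // j l; rewrite qE /B /A /smul oppr0 !powRr0.
    by rewrite expr0 !mul1r.
  have WP y : W y -> W (iter k' (ad_Delta D) T y).
    move=> Wy s; exists (q k' s (Ns (k'%:R + s) y)) => l /=.
    by rewrite IH // shift.
  rewrite iterS ad_DeltaE dotBl NsP; last exact: WP.
  rewrite !IH //; last exact: W_Ns.
  have := @coord_eq (q k' 0) (q k' 0) (q k'.+1 0) (Ns k'%:R x) (Ns k'%:R (Ns 2 x))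
    (Ns k'.+1%:R x) (n i `^ 2)%:C%C (-1) i (bq _ _) (bq _ _) (bq _ _).
  rewrite mulN1r; apply => j; rewrite mulN1r !qE !NsP //; last exact: W_Ns.
  rewrite /B /A /smul oppr0 !powRr0 !mulr1 !mul1r !powR_mulrn ?(ltW (n0 _)) //.
  have zr : (n i ^+ 2 - n j ^+ 2) / n j * n j = n i ^+ 2 - n j ^+ 2 by field.
  rewrite (exprS (n j) k') (exprS (_ / _) k').
  move: zr; move: (n i ^+ 2) (n j ^+ 2) => a2 b2; move: (_ / n j) => r zr.
  move: (n j ^+ k') (r ^+ k') (dot x (e j)) (mx e e T i j) => u v x' y'.
  rewrite [RHS](_ : _ = (r * n j)%:C%C * (u%:C%C * x' * (v%:C%C * y'))); last first.
    by rewrite !rmorphM /=; ring.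
  by rewrite zr rmorphB /=; ring.
have WP y : W y -> W (iter k (ad_Delta D) T y).
  move=> Wy s; exists (q k s (Ns (k%:R + s) y)) => l /=.
  by rewrite main // shift.
split.
- by rewrite W_inftyE; exact: WP.
- move=> a x y; rewrite W_inftyE => Wx Wy; apply: (onb_eq oe) => i.
  rewrite main; last exact: W_lin.
  by rewrite Ns_lin // (bq k 0).1 !dotDl !dotZl -!main.
- move=> s; have [_ [M qM]] := bq k s; exists M => x; rewrite W_inftyE => Wx.
  rewrite !Delta_powE -/(Ns (s + k%:R) x) (_ : app _ _ = q k s (Ns (s + k%:R) x)) //.
  by apply: Ns_app => i /=; rewrite main // shift // [s + _]addrC.
Qed.

End SatToOp.
End Sobolev.

(** * Tensor products, direct sums and shifts *)

Section AppClspan.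
Context {R : realType}.
Local Notation C := (R[i]).

Lemma subsp_graph (H : hilbertType R) (T : H -> H) : bounded_op T ->
  subsp [set p : H * H | p.2 = T p.1].
Proof.
move=> bT; split.
- apply: closed_eqf; first exact: snd_continuous.
  exact: (comp_continuous (bounded_op_continuous bT) (@fst_continuous H H)).
- by rewrite /= (lin0 bT.1).
- by move=> a p q /= -> ->; rewrite bT.1.
Qed.

Lemma subsp_preim_graph (H : hilbertType R) (N : set (H * H)) (T : H -> H) :
  subsp N -> bounded_op T -> subsp [set x | N (x, T x)].
Proof.
move=> [cN N0 Nlin] bT; split.
- apply: (closed_preim (f := fun x => (x, T x)) _ cN) => x.
  by apply: cvg_pair; [exact: cvg_id|exact: bounded_op_continuous].
- by rewrite /= (lin0 bT.1).
- by move=> a x y /= Nx Ny; rewrite bT.1; exact: (Nlin a _ _ Nx Ny).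
Qed.

(** Evaluates the operators defined as [app (clspan S)]: once a bounded [T] agrees with the
    assignment, the closure is its graph. Totality of the first components is stated as an induction
    principle, the form in which tensor products provide it. *)
Lemma app_clspan (H : hilbertType R) (S : set (H * H)) (T : H -> H) : bounded_op T ->
  (forall p, S p -> p.2 = T p.1) ->
  (forall P : set H, subsp P -> (forall p, S p -> P p.1) -> forall x, P x) ->
  app (clspan S) = T.
Proof.
move=> bT ST Stot.
have h1 : clspan S `<=` [set p | p.2 = T p.1].
  by apply: clspan_sub => //; exact: subsp_graph.
have h2 : forall x, clspan S (x, T x).
  apply: (Stot [set x | clspan S (x, T x)]).
    by apply: subsp_preim_graph => //; exact: subsp_clspan.
  move=> [x y] Sxy; apply: subset_closure; apply: lin_span_sub => /=.
  by rewrite -(ST _ Sxy).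
apply/funext => x.
exact: (h1 (x, _) (@xgetI _ 0 [set y | clspan S (x, y)] (T x) (h2 x))).
Qed.

End AppClspan.

Lemma subsp_eq_ops (R : realType) (H K : hilbertType R) (S T : H -> K) :
  bounded_op S -> bounded_op T -> subsp [set x | S x = T x].
Proof.
move=> bS bT; split.
- by apply: closed_eqf; exact: bounded_op_continuous.
- by rewrite /= (lin0 bS.1) (lin0 bT.1).
- by move=> a x y /= Sx Sy; rewrite bS.1 bT.1 Sx Sy.
Qed.

Section Tensor.
Context {R : realType} {H K : hilbertType R} (T : hilbert_tensor H K).
Local Notation C := (R[i]).

Lemma nrm2_tens x y : nrm2 (tens T x y) = nrm2 x * nrm2 y.
Proof. by rewrite /nrm2 dot_tens !dotxx ReM_real. Qed.

Lemma bounded_tens_l y : bounded_op (fun x => tens T x y).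
Proof.
apply/bounded_opP; split; first exact: tens_linear_l.
by exists (nrm2 y) => x; rewrite nrm2_tens mulrC.
Qed.

Lemma bounded_tens_r x : bounded_op (tens T x).
Proof.
apply/bounded_opP; split; first exact: tens_linear_r.
by exists (nrm2 x) => y; rewrite nrm2_tens.
Qed.

Lemma tens_ind (P : set T) : subsp P -> (forall x y, P (tens T x y)) -> forall z, P z.
Proof.
move=> sP Pt; apply: (total_ind (tens_total (h := T))) => //.
by move=> _ [x [y ->]].
Qed.

Lemma subsp_preim (E F : hilbertType R) (S : E -> F) (P : set F) : bounded_op S ->
  subsp P -> subsp [set x | P (S x)].
Proof.
move=> bS [cP P0 Plin]; split.
- exact: (closed_preim (bounded_op_continuous bS) cP).
- by rewrite /= (lin0 bS.1).
- by move=> a x y /= Px Py; rewrite bS.1; exact: Plin.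
Qed.

Lemma tens_ind_onb (I J : eqType) (e : I -> H) (f : J -> K) (P : set T) :
  onb e -> onb f -> subsp P -> (forall i j, P (tens T (e i) (f j))) -> forall z, P z.
Proof.
move=> oe of_ sP Pt; apply: tens_ind => // x y.
apply: (onb_ind oe (subsp_preim (bounded_tens_l y) sP)) => i.
by apply: (onb_ind of_ (subsp_preim (bounded_tens_r (e i)) sP)) => j; exact: Pt.
Qed.

Lemma tens_onb (I J : eqType) (e : I -> H) (f : J -> K) : onb e -> onb f ->
  onb (fun x : I * J => tens T (e x.1) (f x.2)).
Proof.
move=> oe of_; split=> [[i j] [i' j']|x xo].
  by rewrite dot_tens oe.1 of_.1 xpair_eqE -natrM mulnb.
suff : forall y, dot y x = 0.
  by move=> /(_ x)/eqP; rewrite dotxx => /eqP/complexI/eqP; rewrite nrm2_eq0 => /eqP.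
apply: (tens_ind_onb oe of_) => [|i j].
  split; [exact: (closed_eq0 (V := (C : numFieldType)) (@dotl_continuous _ T x))|exact: dot0l|].
  by move=> a y z /= yx zx; rewrite dotDl dotZl yx zx mulr0 addr0.
by rewrite /= dotC (xo (i, j)) rmorph0.
Qed.

End Tensor.

(** The operator is built from the tensor product of the matrices in arbitrary orthonormal bases;
    the formula on simple tensors then follows by continuity in each variable. *)
Lemma ex_tens_op (R : realType) (H K H' K' : hilbertType R)
    (T : hilbert_tensor H K) (T' : hilbert_tensor H' K') (P : H -> H') (Q : K -> K') :
  bounded_op P -> bounded_op Q ->
  exists2 S : T -> T', bounded_op S & forall x y, S (tens T x y) = tens T' (P x) (Q y).
Proof.
move=> bP bQ.
have [I [E oE]] := @exists_onb R H; have [J [F oF]] := @exists_onb R K.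
have [I' [E' oE']] := @exists_onb R H'; have [J' [F' oF']] := @exists_onb R K'.
have := bdd_tens (bdd_mx oE oE' bP) (bdd_mx oF oF' bQ).
move=> /(op_of_mx (tens_onb T oE oF) (tens_onb T' oE' oF'))[S bS SE].
have SEF i j : S (tens T (E i) (F j)) = tens T' (P (E i)) (Q (F j)).
  apply: (onb_eq (tens_onb T' oE' oF')) => -[i' j'].
  by have := SE (i, j) (i', j'); rewrite /mx /= => ->; rewrite dot_tens.
exists S => // x y.
have h j z : S (tens T z (F j)) = tens T' (P z) (Q (F j)).
  apply: (onb_ind oE (subsp_eq_ops
    (bounded_op_comp bS (bounded_tens_l T (F j)))
    (bounded_op_comp (bounded_tens_l T' (Q (F j))) bP))) => i; exact: SEF.
apply: (onb_ind oF (subsp_eq_ops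
    (bounded_op_comp bS (bounded_tens_r T x))
    (bounded_op_comp (bounded_tens_r T' (P x)) bQ))) => j; exact: h.
Qed.

Lemma delta_onb (R : realType) (G : eqType) (l2 : ell2 (R := R) G) : onb (delta l2).
Proof. by apply: dense_onb; [exact: dot_delta|exact: delta_total]. Qed.

Lemma ex_shift (R : realType) (G : groupType) (l2 : ell2 (R := R) G) (h : G) :
  exists2 S : l2 -> l2, bounded_op S & forall x, S (delta l2 x) = delta l2 (h * x)%g.
Proof.
(* [bdd_perm] assigns to a row its column, so translation by [h] is encoded by [h^-1]. *)
have inj : injective (fun x => h^-1 * x)%g by exact: mulgI.
have [S bS SE] := op_of_mx (delta_onb l2) (delta_onb l2) (bdd_perm (R := R) inj).
exists S => // x; apply: (onb_eq (delta_onb l2)) => y.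
have := SE x y; rewrite /mx => ->; rewrite dot_delta; congr (nat_of_bool _)%:R.
by apply/eqP/eqP => [->|<-]; rewrite ?mulVKg ?mulKg.
Qed.

Lemma ex_dsum_op (R : realType) (H : hilbertType R) (G : eqType) (l2 : ell2 (R := R) G)
    (T : hilbert_tensor H l2) (u : G -> H -> H) B : 0 <= B ->
  (forall g, linear (u g)) -> (forall g x, nrm2 (u g x) <= B * nrm2 x) ->
  exists2 S : T -> T, bounded_op S &
    forall x g, S (tens T x (delta l2 g)) = tens T (u g x) (delta l2 g).
Proof.
move=> B0 lu uB; have [I [E oE]] := @exists_onb R H; have od := delta_onb l2.
have B1 : 0 <= 1 + B by rewrite addr_ge0.
have := bdd_dsum (fun g => bddM_mx oE oE (lu g) (uB g) B0) B1.
move=> /(op_of_mx (tens_onb T oE od) (tens_onb T oE od))[S bS SE].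
have bu g : bounded_op (u g) by apply/bounded_opP; split => //; exists B.
exists S => // x g.
apply: (onb_ind oE (subsp_eq_ops
    (bounded_op_comp bS (bounded_tens_l T (delta l2 g)))
    (bounded_op_comp (bounded_tens_l T (delta l2 g)) (bu g)))) => i /=.
apply: (onb_eq (tens_onb T oE od)) => -[i' g'].
have := SE (i, g) (i', g'); rewrite /mx /= => ->; rewrite dot_tens dot_delta eq_sym.
by case: eqP => [->|_]; rewrite ?mulr1 ?mulr0.
Qed.

Section DirectSum.
Context {R : realType} {K : hilbertType R} (S : hilbert_sum K K).
Local Notation C := (R[i]).

Definition injb (b : bool) : K -> S := if b then inj1 S else inj2 S.

Lemma injb_linear b : linear (injb b).
Proof. by case: b; [exact: inj1_linear|exact: inj2_linear]. Qed.

Lemma dot_injb b c x y : dot (injb b x) (injb c y) = if b == c then dot x y else 0.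
Proof.
case: b c => [] []; rewrite /injb /= ?dot_inj1 ?dot_inj2 ?dot_inj12 //.
by rewrite dotC dot_inj12 rmorph0.
Qed.

Lemma injb_bounded b : bounded_op (injb b).
Proof.
apply/bounded_opP; split; first exact: injb_linear.
by exists 1 => x; rewrite /nrm2 dot_injb eqxx mul1r.
Qed.

Lemma ex_proj : exists p : bool -> S -> K, [/\ forall b, bounded_op (p b),
   forall z, z = injb true (p true z) + injb false (p false z) &
   forall b c x, p b (injb c x) = if b == c then x else 0].
Proof.
have ex z : exists xy : K * K, z = injb true xy.1 + injb false xy.2.
  by have [x [y E]] := sum_total z; exists (x, y).
have [q qE] := choice ex; pose p (b : bool) z := if b then (q z).1 else (q z).2.
have pE z : z = injb true (p true z) + injb false (p false z) by exact: qE.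
have inj0 b : injb b 0 = 0 by rewrite (lin0 (injb_linear b)).
have dotp b z y : dot (p b z) y = dot z (injb b y).
  by rewrite {2}(pE z) dotDl !dot_injb; case: b => /=; rewrite ?addr0 ?add0r.
have p_eq b z x : (forall y, dot z (injb b y) = dot x y) -> p b z = x.
  move=> h; apply/eqP; rewrite -subr_eq0 -nrm2_eq0; apply/eqP.
  by rewrite /nrm2 dotBl dotp h subrr.
exists p; split => // [b|b c x].
  apply/bounded_opP; split=> [a x y|].
    by apply: p_eq => z; rewrite !dotDl !dotZl !dotp.
  exists 1 => z; rewrite mul1r.
  have E : nrm2 z = nrm2 (p true z) + nrm2 (p false z).
    have o x y : dot (injb true x) (injb false y) = 0 by exact: dot_inj12.
    rewrite {1}(pE z) nrm2D o mulr0 addr0.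
    by rewrite /nrm2 !dot_injb !eqxx.
  by rewrite E; case: b; rewrite ?lerDl ?lerDr nrm2_ge0.
apply: p_eq => y; rewrite dot_injb eq_sym; case: eqP => // _.
by rewrite dot0l.
Qed.

Lemma sum_ind (P : set S) : subsp P -> (forall b x, P (injb b x)) -> forall z, P z.
Proof.
move=> [_ P0 Plin] Pi z; have [x [y ->]] := sum_total z.
by rewrite -[inj1 S x]scale1r; apply: Plin; [exact: (Pi true)|exact: (Pi false)].
Qed.

Lemma injb_onb (I : eqType) (e : I -> K) : onb e ->
  onb (fun x : I * bool => injb x.2 (e x.1)).
Proof.
move=> oe; split=> [[i b] [j c]|x xo].
  by rewrite dot_injb xpair_eqE /= andbC; case: (b == c); rewrite ?oe.1.
have [y [z xE]] := sum_total x; rewrite xE -/(injb true y) -/(injb false z).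
have -> : y = 0.
  apply: oe.2 => i; have := xo (i, true); rewrite xE dotDl.
  by rewrite -/(injb true y) -/(injb false z) !dot_injb /= addr0.
have -> : z = 0.
  apply: oe.2 => i; have := xo (i, false); rewrite xE dotDl.
  by rewrite -/(injb true y) -/(injb false z) !dot_injb /= add0r.
by rewrite !(lin0 (injb_linear _)) addr0.
Qed.

End DirectSum.

(** * The equivariant Dirac operator *)

Section Dirac.
Context {R : realType} {H L : hilbertType R} {K : hilbert_tensor H L}.
Context (HH : hilbert_sum K K) {I J : choiceType}.
Local Notation C := (R[i]).
Variables (e : I -> H) (f : J -> L) (d : I -> R) (m : J -> R).
Hypotheses (oe : onb e) (of_ : onb f).

(** The generators of [D_tilde] with an arbitrary graph [M] instead of [Mell], so that [M] can be
    replaced by its diagonal form. *)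
Definition dirac_gens (D : graph H) (M : graph L) : set (HH * HH) :=
  [set p | exists xi xi' eta eta', [/\ D (xi, xi'), M (eta, eta') &
    p = (inj1 HH (tens K xi eta),
         inj2 HH (tens K xi' eta + 'i%C *: tens K xi eta')) \/
    p = (inj2 HH (tens K xi eta),
         inj1 HH (tens K xi' eta - 'i%C *: tens K xi eta'))]].

Local Notation E := (fun x : I * J => tens K (e x.1) (f x.2)).
Let oE : onb E. Proof. exact: tens_onb. Qed.

(** On the plane spanned by the two copies of a tensor basis vector the Dirac operator has zero
    diagonal, [c] in the lower left and its conjugate in the upper right corner. Its eigenvalues are
    plus and minus |c|, with unit eigenvectors (1, u) / sqrt 2 and (1, -u) / sqrt 2, [u] the phase
    of [c]. *)
Definition dirac_coef (x : I * J) : C := (d x.1)%:C%C + 'i%C * (m x.2)%:C%C.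
Definition dirac_abs (x : I * J) : R := Num.sqrt (d x.1 ^+ 2 + m x.2 ^+ 2).
(** The value 1 where [c] vanishes keeps [u] unimodular, so that the vectors [dirac_vec] still form
    a basis. *)
Definition dirac_phase (x : I * J) : C :=
  if dirac_abs x == 0 then 1 else dirac_coef x / (dirac_abs x)%:C%C.
Local Notation c := dirac_coef.
Local Notation r := dirac_abs.
Local Notation u := dirac_phase.

Let r2 x : r x ^+ 2 = d x.1 ^+ 2 + m x.2 ^+ 2.
Proof. by rewrite sqr_sqrtr // addr_ge0 ?sqr_ge0. Qed.

Let sqn_c x : sqn (c x) = r x ^+ 2.
Proof. by rewrite r2 /sqn /c /=; ring. Qed.

Let c_ru x : c x = (r x)%:C%C * u x.
Proof.
rewrite /u; case: eqP => [r0|/eqP r0].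
  have : sqn (c x) == 0 by rewrite sqn_c r0 expr0n.
  by rewrite sqn_eq0 => /eqP ->; rewrite r0 mul0r.
by rewrite mulrC divfK // (inj_eq (@complexI R) _ 0).
Qed.

Let uu x : u x * (u x)^* = 1.
Proof.
rewrite mulcJ /u; case: eqP => [r0|/eqP r0].
  by rewrite /sqn /= expr1n expr0n addr0.
rewrite sqnM sqn_c (_ : sqn (_^-1) = (r x ^+ 2)^-1) ?divff ?expf_neq0 //.
by rewrite -(fmorphV (real_complex R)) sqn_real exprVn.
Qed.

Let cu x : c x * (u x)^* = (r x)%:C%C.
Proof. by rewrite c_ru -mulrA uu mulr1. Qed.

Let cJ x : (c x)^* = (r x)%:C%C * (u x)^*.
Proof. by rewrite c_ru rmorphM /= conjC_real. Qed.

Let sg (s : bool) : R := if s then 1 else -1.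
Let isq : R := (Num.sqrt 2)^-1.
Let isq2 : isq%:C%C * isq%:C%C = 2^-1 :> C.
Proof.
rewrite -rmorphM -expr2 exprVn sqr_sqrtr // fmorphV.
by congr (_^-1); rewrite rmorph_nat.
Qed.
Let isq0 : isq%:C%C != 0 :> C.
Proof.
by rewrite (inj_eq (@complexI R) _ 0) invr_eq0 sqrtr_eq0 -ltNge.
Qed.

Definition dirac_vec (y : (I * J) * bool) : HH :=
  isq%:C%C *: (injb HH true (E y.1) + ((sg y.2)%:C%C * u y.1) *: injb HH false (E y.1)).
Local Notation w := dirac_vec.

Let dot_w z1 z2 y : dot (injb HH true z1 + injb HH false z2) (w y) =
  isq%:C%C * (dot z1 (E y.1) + (sg y.2)%:C%C * (u y.1)^* * dot z2 (E y.1)).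
Proof.
rewrite dotZr conjC_real; congr (_ * _).
rewrite dotDl !dotDr !dotZr !dot_injb /= mulr0 addr0 add0r.
by rewrite rmorphM /= conjC_real.
Qed.

Lemma dirac_onb : onb w.
Proof.
split=> [[x s] [y t]|z zo].
  rewrite {1}/w scalerDr scalerA -!(linZ (injb_linear HH _)) dot_w /= !dotZl.
  rewrite oE.1 xpair_eqE; case: eqP => [->|_] /=; last by rewrite !mulr0 addr0 mulr0.
  rewrite !mulr1 mulrDr [X in _ + X](_ : _ = isq%:C%C * isq%:C%C *
    ((sg s)%:C%C * (sg t)%:C%C) * (u y * (u y)^*)); last by ring.
  rewrite uu isq2 mulr1 -rmorphM -{1}[2^-1]mulr1 -mulrDr.
  case: s t => [] []; rewrite /sg /= ?mulr1 ?mul1r ?mulrNN ?mul1r ?rmorphN /= ?rmorph1 ?subrr ?mulr0 //;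
    by rewrite mulVf // pnatr_eq0.
have [z1 [z2 zE]] := sum_total z; rewrite -/(injb HH true z1) -/(injb HH false z2) in zE.
have h x s : dot z1 (E x) + (sg s)%:C%C * (u x)^* * dot z2 (E x) = 0.
  have := zo (x, s); rewrite zE dot_w => /eqP.
  by rewrite mulf_eq0 (negPf isq0) /= => /eqP.
have h1 x : dot z1 (E x) = 0 /\ (u x)^* * dot z2 (E x) = 0.
  have := h x true; have := h x false; rewrite /sg rmorphN rmorph1 mul1r mulN1r mulNr.
  move=> /eqP; rewrite subr_eq0 => /eqP -> /eqP; rewrite -mulr2n -mulr_natl mulf_eq0 pnatr_eq0 /=.
  by move=> /eqP.
have -> : z = injb HH true 0 + injb HH false 0.
  rewrite zE; congr (injb HH _ _ + injb HH _ _); apply: oE.2 => x; first exact: (h1 x).1.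
  have := (h1 x).2 => /(congr1 (fun v => u x * v)); rewrite mulrA uu mul1r mulr0.
  by [].
by rewrite !(lin0 (injb_linear _ _)) addr0.
Qed.

Definition dirac_eig (y : (I * J) * bool) : R := sg y.2 * r y.1.

Lemma dirac_diag : clspan (dirac_gens (diagG e d) (diagG f m)) = diagG w dirac_eig.
Proof.
apply/seteqP; split.
  apply: clspan_sub; first exact: subsp_diagG.
  move=> p [xi [xi' [eta [eta' [Dxi Meta]]]]] [] -> [x s] /=.
    have -> : inj2 HH (tens K xi' eta + 'i%C *: tens K xi eta') =
      injb HH true 0 + injb HH false (tens K xi' eta + 'i%C *: tens K xi eta').
      by rewrite (lin0 (injb_linear _ _)) add0r.
    have -> : inj1 HH (tens K xi eta) = injb HH true (tens K xi eta) + injb HH false 0.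
      by rewrite (lin0 (injb_linear _ _)) addr0.
    rewrite !dot_w /= !dot0l mulr0 addr0 add0r dotDl dotZl !dot_tens (Dxi x.1) (Meta x.2) /=.
    rewrite /dirac_eig /= rmorphM /= -(cu x) /c; ring.
  have -> : inj1 HH (tens K xi' eta - 'i%C *: tens K xi eta') =
    injb HH true (tens K xi' eta - 'i%C *: tens K xi eta') + injb HH false 0.
    by rewrite (lin0 (injb_linear _ _)) addr0.
  have -> : inj2 HH (tens K xi eta) = injb HH true 0 + injb HH false (tens K xi eta).
    by rewrite (lin0 (injb_linear _ _)) add0r.
  rewrite !dot_w /= !dot0l mulr0 addr0 add0r dotBl dotZl !dot_tens (Dxi x.1) (Meta x.2) /=.
  rewrite /dirac_eig /= rmorphM /=.
  have ss : (sg s)%:C%C * (sg s)%:C%C = 1 :> C.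
    by rewrite -rmorphM; case: s; rewrite /sg ?mulrNN mulr1.
  rewrite [RHS](_ : _ = isq%:C%C * ((sg s)%:C%C * (sg s)%:C%C) * ((r x)%:C%C * (u x)^*) *
    (dot xi (e x.1) * dot eta (f x.2))); last by ring.
  rewrite ss -cJ /c rmorphD rmorphM /= !conjC_real (_ : ('i%C)^* = - 'i%C :> C); first by ring.
  by apply/eqP; rewrite eq_complex /= oppr0 !eqxx.
apply: (diagG_ind dirac_onb); first exact: subsp_clspan.
move=> [x s].
have [_ c0 lin] := subsp_clspan (dirac_gens (diagG e d) (diagG f m)).
have g1 : clspan (dirac_gens (diagG e d) (diagG f m)) (injb HH true (E x), c x *: injb HH false (E x)).
  apply: subset_closure; apply: lin_span_sub.
  exists (e x.1), ((d x.1)%:C%C *: e x.1), (f x.2), ((m x.2)%:C%C *: f x.2).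
  split; [exact: diagG_e|exact: diagG_e|left; congr (_, _)].
  rewrite (linZ (bounded_tens_l K _).1) (linZ (bounded_tens_r K _).1) scalerA -scalerDl.
  by rewrite -(linZ (injb_linear HH false)).
have g2 : clspan (dirac_gens (diagG e d) (diagG f m)) (injb HH false (E x), (c x)^* *: injb HH true (E x)).
  apply: subset_closure; apply: lin_span_sub.
  exists (e x.1), ((d x.1)%:C%C *: e x.1), (f x.2), ((m x.2)%:C%C *: f x.2).
  split; [exact: diagG_e|exact: diagG_e|right; congr (_, _)].
  rewrite (linZ (bounded_tens_l K _).1) (linZ (bounded_tens_r K _).1) scalerA -scalerBl.
  rewrite -(linZ (injb_linear HH true)) /c rmorphD rmorphM /= !conjC_real.
  rewrite (_ : ('i%C)^* = - 'i%C :> C) ?mulNr //.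
  by apply/eqP; rewrite eq_complex /= oppr0 !eqxx.
have := lin isq%:C%C _ _ (lin ((sg s)%:C%C * u x) _ _ g2 g1) c0.
congr (clspan _ (_, _)); first by rewrite /= addr0 /w addrC.
rewrite /= addr0 /w [RHS]scalerA [X in _ = X *: _]mulrC -[RHS]scalerA; congr (_ *: _).
rewrite scalerDr !scalerA /dirac_eig rmorphM /=.
have ss : (sg s)%:C%C * (sg s)%:C%C = 1 :> C.
  by rewrite -rmorphM; case: s; rewrite /sg ?mulrNN mulr1.
congr (_ *: _ + _ *: _).
  rewrite cJ -mulrA; congr (_ * _); rewrite mulrCA uu mulr1 //.
rewrite [RHS](_ : _ = ((sg s)%:C%C * (sg s)%:C%C) * ((r x)%:C%C * u x)); last by ring.
by rewrite ss mul1r -c_ru.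
Qed.

Lemma dirac_eig_sqr y : dirac_eig y ^+ 2 = d y.1.1 ^+ 2 + m y.1.2 ^+ 2.
Proof.
rewrite /dirac_eig exprMn r2 /sg.
by case: y.2; rewrite ?sqrrN expr1n mul1r.
Qed.

Lemma dirac_discrete : discrete d -> discrete m -> discrete dirac_eig.
Proof.
move=> dd dm B.
have fin : finite_set ([set i | d i ^+ 2 <= B] `*` [set j | m j ^+ 2 <= B] `*` [set: bool]).
  by apply: finite_setX; [apply: finite_setX; [exact: dd|exact: dm]|exact: finite_finset].
apply: (sub_finite_set _ fin) => -[[i j] s] /=; rewrite dirac_eig_sqr /= => h.
split=> //; split; rewrite /=; apply: le_trans h.
  by rewrite lerDl sqr_ge0.
by rewrite lerDr sqr_ge0.
Qed.

Local Notation E2 := (fun y : (I * J) * bool => injb HH y.2 (E y.1)).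

(** The two eigenvectors over the same [x] have opposite eigenvalues, so the absolute value is the
    scalar [r x] on their plane and is diagonal in the tensor basis as well. The phases thereby
    disappear from the regularity condition. *)
Lemma dirac_absop : absop (diagG w dirac_eig) = diagG E2 (fun y => r y.1).
Proof.
rewrite (absop_diagG dirac_onb).
have -> : (fun y => `|dirac_eig y|) = fun y => r y.1.
  apply/funext => y; rewrite /dirac_eig normrM (ger0_norm (sqrtr_ge0 _)) /sg.
  by case: y.2; rewrite ?normrN normr1 mul1r.
have wE x s (z : HH) : dot z (w (x, s)) = isq%:C%C * (dot z (injb HH true (E x)) +
    (sg s)%:C%C * (u x)^* * dot z (injb HH false (E x))).
  by rewrite dotZr conjC_real dotDr dotZr rmorphM /= conjC_real.
apply/seteqP; split=> -[z z'] /= h.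
  have hx x s : dot z' (injb HH true (E x)) + (sg s)%:C%C * (u x)^* * dot z' (injb HH false (E x))
    = (r x)%:C%C * (dot z (injb HH true (E x)) + (sg s)%:C%C * (u x)^* * dot z (injb HH false (E x))).
    have := h (x, s); rewrite /= !wE mulrCA; exact: mulfI.
  have h1 x := hx x true; have h2 x := hx x false.
  have two (a b : C) : a + a = b + b -> a = b.
    by rewrite -!mulr2n; apply: pmulrnI.
  move=> [x []] /=.
    have := h1 x; have := h2 x; rewrite /sg rmorphN rmorph1 => e2 e1; apply: two.
    have := f_equal2 +%R e1 e2.
    rewrite [LHS](_ : _ = dot z' (injb HH true (E x)) + dot z' (injb HH true (E x))); last by ring.
    by move=> ->; ring.
  have := h1 x; have := h2 x; rewrite /sg rmorphN rmorph1 => e2 e1; apply: two.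
  have := f_equal2 (fun a b => u x * (a - b)) e1 e2.
  rewrite [LHS](_ : _ = (u x * (u x)^*) * (dot z' (injb HH false (E x)) + dot z' (injb HH false (E x)))); last by ring.
  rewrite [RHS](_ : _ = (u x * (u x)^*) * ((r x)%:C%C * dot z (injb HH false (E x)) + (r x)%:C%C * dot z (injb HH false (E x)))); last by ring.
  by rewrite uu !mul1r.
move=> [x s] /=; rewrite !wE /=; have /= -> := h (x, true); have /= -> := h (x, false).
ring.
Qed.

End Dirac.

Section DiracRegular.
Context {R : realType} {H L : hilbertType R} {K : hilbert_tensor H L}.
Context (HH : hilbert_sum K K) {I J : choiceType}.
Local Notation C := (R[i]).
Variables (e : I -> H) (f : J -> L) (d : I -> R) (m : J -> R).
Hypotheses (oe : onb e) (of_ : onb f).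
Local Notation E := (fun x : I * J => tens K (e x.1) (f x.2)).
Local Notation E2 := (fun y : (I * J) * bool => injb HH y.2 (E y.1)).
Local Notation w := (dirac_vec HH e f d m).
Local Notation Dt := (diagG w (dirac_eig d m)).
Let oE : onb E. Proof. exact: tens_onb. Qed.
Let oE2 : onb E2. Proof. exact: injb_onb. Qed.

Lemma sat_dirac_abs (X : I -> I -> C) (Y : J -> J -> C) :
  sat (fun i => `|d i|) X -> sat (fun j => `|m j|) Y ->
  sat (dirac_abs d m) (fun x y => X x.1 y.1 * Y x.2 y.2).
Proof.
move=> /sat_wt_abs sX /sat_wt_abs sY.
(* The two functions are sqrt(y^2 + 2) and y, which differ by at most sqrt 2. *)
apply: (sat_perturb (f := nm (wt d) (wt m)) (B := 2)); last first.
  by apply: sat_tens => // ?; exact: wt_ge1.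
move=> [i j]; rewrite /dirac_abs /nm /= /wt !sqr_sqrtr ?addr_ge0 ?sqr_ge0 //.
have a0 : 0 <= d i ^+ 2 + m j ^+ 2 by rewrite addr_ge0 ?sqr_ge0.
have b0 : 0 <= 1 + d i ^+ 2 + (1 + m j ^+ 2) by rewrite !addr_ge0 ?sqr_ge0.
have := sqr_sqrtr a0; have := sqr_sqrtr b0.
have := sqrtr_ge0 (d i ^+ 2 + m j ^+ 2); have := sqrtr_ge0 (1 + d i ^+ 2 + (1 + m j ^+ 2)).
move: (Num.sqrt _) (Num.sqrt (d i ^+ 2 + _)) => x y x0 y0 xx yy.
have xy : x ^+ 2 = y ^+ 2 + 2 by rewrite xx yy; ring.
rewrite ler_norml; apply/andP; split; nra.
Qed.

Local Arguments injb : simpl never.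

Variable p : bool -> HH -> K.
Hypotheses (bp : forall b, bounded_op (p b))
  (pE : forall z, z = injb HH true (p true z) + injb HH false (p false z))
  (p_inj : forall b c x, p b (injb HH c x) = if b == c then x else 0).

(** The 2 by 2 block operator whose only nonzero block is [X], from summand [b] to summand [a]. *)
Definition corner (a b : bool) (X : K -> K) : HH -> HH := fun z => injb HH a (X (p b z)).

Lemma corner_bounded a b X : bounded_op X -> bounded_op (corner a b X).
Proof.
move=> bX; apply: (bounded_op_comp (injb_bounded HH a)).
exact: (bounded_op_comp bX (bp b)).
Qed.

(** The eigenvalues of the absolute value do not depend on the summand, so the matrix unit commutes
    with it and off-diagonal corners behave like diagonal ones. *)
Lemma corner_regular a b (P : H -> H) (Q : L -> L) (X : K -> K) : bounded_op X ->
  (forall x y, X (tens K x y) = tens K (P x) (Q y)) ->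
  dom_delta_infty (absop (diagG e d)) P -> dom_delta_infty (absop (diagG f m)) Q ->
  dom_delta_infty (absop Dt) (corner a b X).
Proof.
move=> bX XE; rewrite (absop_diagG oe) (absop_diagG of_).
move=> /(dom_delta_inftyP oe)[bP sP] /(dom_delta_inftyP of_)[bQ sQ].
rewrite (dirac_absop HH d m oe of_); apply/(dom_delta_inftyP oE2); split.
  exact: corner_bounded.
have sPQ := sat_dirac_abs sP sQ => k.
apply: bdd_ext (bdd_tens (sPQ k) (bdd_unit (R := R) a b)) => -[[i j] a'] [[i' j'] b'] /=.
rewrite /smul /mx /= /corner p_inj -mulrA; congr (_ * _).
have [_|_] := eqVneq b b'; last first.
  by rewrite andbF mulr0 (lin0 bX.1) (lin0 (injb_linear HH a)) dot0l.
rewrite XE dot_injb andbT (eq_sym a').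
by case: (a == a'); rewrite ?dot_tens ?mulr1 ?mulr0.
Qed.

Lemma dom_delta_infty_lin (S T : HH -> HH) (a : C) :
  dom_delta_infty (absop Dt) S -> dom_delta_infty (absop Dt) T ->
  dom_delta_infty (absop Dt) (fun x => a *: S x + T x).
Proof.
rewrite (absop_diagG (dirac_onb HH d m oe of_)) => dS dT k.
by apply: dom_delta_lin => //; exact: dirac_onb.
Qed.

Lemma dirac_regular (P : H -> H) (Q : L -> L) (X : K -> K) :
  regular_op e d P -> regular_op f m Q -> bounded_op X ->
  (forall x y, X (tens K x y) = tens K (P x) (Q y)) ->
  regular_op w (dirac_eig d m) (fun z => corner true true X z + corner false false X z).
Proof.
move=> rP rQ bX XE.
have ow := dirac_onb HH d m oe of_.
have [PP' bP'] := regular_op_is_comm oe rP; have [QQ' bQ'] := regular_op_is_comm of_ rQ.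
have bP := regular_op_bounded rP; have bQ := regular_op_bounded rQ.
set P' := comm_closure _ P in PP' bP'; set Q' := comm_closure _ Q in QQ' bQ'.
have [X1 bX1 X1E] := ex_tens_op K K bP' bQ; have [X2 bX2 X2E] := ex_tens_op K K bP bQ'.
have [_ dP dP'] := rP; have [_ dQ dQ'] := rQ.
pose T z := 1 *: corner true true X z + corner false false X z.
(* The commutator of [D_tilde] with X on both summands, X = P (x) Q: the blocks are [D, P] (x) Q
   plus or minus i P (x) [M, Q], off the diagonal. *)
pose B z := 1 *: corner false true X1 z + ('i%C *: corner false true X2 z +
  (1 *: corner true false X1 z + (- 'i%C *: corner true false X2 z + 0))).
have -> : (fun z => corner true true X z + corner false false X z) = T.
  by apply/funext => z; rewrite /T scale1r.
have cd := dom_delta_infty_lin.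
have d0 : dom_delta_infty (absop Dt) (fun=> 0) by have [_ ? _] := regular_op0 ow (dirac_eig d m).
have dB : dom_delta_infty (absop Dt) B.
  apply: (cd _ _ _ (corner_regular _ _ bX1 X1E dP' dQ)).
  apply: (cd _ _ _ (corner_regular _ _ bX2 X2E dP dQ')).
  apply: (cd _ _ _ (corner_regular _ _ bX1 X1E dP' dQ)).
  exact: (cd _ _ _ (corner_regular _ _ bX2 X2E dP dQ') d0).
have dT : dom_delta_infty (absop Dt) T.
  by apply: cd; exact: (corner_regular _ _ bX XE).
apply: (regular_op_intro ow _ dT dB).
have bT := (dT 0%N).1; have bB := (dB 0%N).1.
(* It suffices to look at generators of the graph: by [PP'] and [QQ'] the pair built from a
   generator is again a generator. *)
have TB : Dt `<=` [set q | Dt (T q.1, T q.2 + B q.1)].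
  rewrite -(dirac_diag HH d m oe of_); apply: clspan_sub.
    by apply: subsp_comm => //; exact: subsp_clspan.
  move=> _ [xi [xi' [eta [eta' [Dxi Meta]]]]] [] ->.
    apply: subset_closure; apply: lin_span_sub.
    exists (P xi), (P xi' + P' xi), (Q eta), (Q eta' + Q' eta); split.
    - exact: PP'.
    - exact: QQ'.
    left; rewrite /T /B /corner /=.
    rewrite -/(injb HH true (tens K xi eta)) -/(injb HH false (tens K xi' eta + _)) !p_inj /=.
    rewrite !(lin0 bX.1) !(lin0 bX1.1) !(lin0 bX2.1) !(lin0 (injb_linear HH _)) !(scaler0, addr0, add0r, scale1r).
    rewrite XE; congr (_, _).
    rewrite -(linZ (injb_linear HH false)) -!(linD (injb_linear HH false)); congr (injb HH false _).
    rewrite (linD bX.1) (linZ bX.1) !XE X1E X2E.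
    rewrite (linD (bounded_tens_l K _).1) (linD (bounded_tens_r K _).1) scalerDr.
    by rewrite addrACA.
  apply: subset_closure; apply: lin_span_sub.
  exists (P xi), (P xi' + P' xi), (Q eta), (Q eta' + Q' eta); split.
  - exact: PP'.
  - exact: QQ'.
  right; rewrite /T /B /corner /=.
  rewrite -/(injb HH false (tens K xi eta)) -/(injb HH true (tens K xi' eta - _)) !p_inj /=.
  rewrite !(lin0 bX.1) !(lin0 bX1.1) !(lin0 bX2.1) !(lin0 (injb_linear HH _)) !(scaler0, addr0, add0r, scale1r).
  rewrite XE; congr (_, _).
  rewrite -(linZ (injb_linear HH true)) -!(linD (injb_linear HH true)); congr (injb HH true _).
  rewrite (linB bX.1) (linZ bX.1) !XE X1E X2E.
  rewrite (linD (bounded_tens_l K _).1) (linD (bounded_tens_r K _).1) scalerDr opprD scaleNr.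
  by rewrite addrACA.
by move=> x y xy; exact: (TB (x, y) xy).
Qed.

End DiracRegular.

(** * Crossed products *)

Section FiniteSupport.

Lemma fsum_seq (G : choiceType) (V : nmodType) (F : G -> V) (r : seq G) : uniq r ->
  (forall g, g \notin r -> F g = 0) -> \sum_(g \in [set: G]) F g = \sum_(g <- r) F g.
Proof.
move=> ur F0; rewrite (fsbigE r) //; last by move=> g _; exact: F0.
by apply: eq_bigl => g; rewrite in_setT.
Qed.

Lemma Cc_support (G : choiceType) (E : zmodType) (S : set E) (f : G -> E) : Cc S f ->
  exists2 r : seq G, uniq r & forall g, g \notin r -> f g = 0.
Proof.
move=> [/finite_seqP[r rE] _]; exists (undup r); rewrite ?undup_uniq // => g.
rewrite mem_undup => gr; apply/eqP; apply: contraT => f0.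
by case/negP: gr; have : [set` r] g by rewrite -rE.
Qed.

Lemma Cc_single (G : choiceType) (E : zmodType) (S : set E) (a : E) (g : G) : S 0 -> S a ->
  Cc S (fun h => if h == g then a else 0).
Proof.
move=> S0 Sa; split; last by move=> h; case: ifP.
apply: (sub_finite_set (B := [set g])); last exact: finite_set1.
by move=> h /=; case: (h =P g) => // _; rewrite eqxx.
Qed.

End FiniteSupport.

Section CstarFacts.
Context {R : realType} {A : cstarType R}.
Local Notation C := (R[i]).

Lemma star_algebra_zero (calA : set A) : dense_star_subalgebra calA -> calA 0.
Proof.
move=> [_ A1 Alin _ _]; have := Alin (-1) aone aone A1 A1.
by rewrite scaleN1r addNr.
Qed.

End CstarFacts.

Section MonomialAlgebra.
Context {R : realType} {A : cstarType R} {G : groupType} {X : hilbertType R}.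
Local Notation C := (R[i]).
Variables (rho : G -> A -> A) (sigma : G -> G -> A) (calA : set A).
Variable m : A -> G -> X -> X.

(** Treats two algebras at once: [m] is [mono] for [calB] and [hat_monomial] for [hat_rep]. The
    hypotheses below are the relations of the twisted convolution algebra. *)
Definition msum (f : G -> A) : X -> X := fun z => \sum_(g \in [set: G]) m (f g) g z.

Hypothesis m_lin : forall (c : C) a b g z, m (c *: a + b) g z = c *: m a g z + m b g z.

Let m0 g z : m 0 g z = 0.
Proof.
have := m_lin 1 0 0 g z; rewrite scaler0 addr0 scale1r => h.
by apply: (addrI (m 0 g z)); rewrite -h addr0.
Qed.

Lemma msum_seq f (r : seq G) : uniq r -> (forall g, g \notin r -> f g = 0) ->
  msum f = fun z => \sum_(g <- r) m (f g) g z.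
Proof.
move=> ur f0; apply/funext => z; apply: fsum_seq => // g gr.
by rewrite f0 // m0.
Qed.

Lemma msum_single a g : msum (fun h => if h == g then a else 0) = m a g.
Proof.
rewrite (msum_seq (r := [:: g])) //; last by move=> h; rewrite inE => /negPf ->.
by apply/funext => z; rewrite big_seq1 eqxx.
Qed.

Lemma msum_ind (P : set (X -> X)) f : Cc calA f -> P (fun=> 0) ->
  (forall S T, P S -> P T -> P (fun x => 1 *: S x + T x)) ->
  (forall a g, calA a -> P (m a g)) -> P (msum f).
Proof.
move=> Cf P0 Padd Pm; have [r ur f0] := Cc_support Cf.
rewrite (msum_seq ur f0); elim: {ur f0} r => [|g r IH].
  by under eq_fun do rewrite big_nil.
under eq_fun do rewrite big_cons -[m _ _ _]scale1r.
by apply: Padd => //; apply: Pm; exact: Cf.2.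
Qed.

Hypothesis calA_alg : dense_star_subalgebra calA.

Lemma monomial_in a g : calA a -> (msum @` Cc calA) (m a g).
Proof.
move=> Aa; exists (fun h => if h == g then a else 0); last exact: msum_single.
by apply: Cc_single => //; exact: star_algebra_zero.
Qed.

Hypothesis hsmooth : smooth calA rho sigma.
Hypothesis m_bounded : forall a g, bounded_op (m a g).
Hypothesis m_mul : forall a g b h z,
  m a g (m b h z) = m (a ** rho g b ** sigma g h) (g * h)%g z.
Hypothesis m_one : forall z, m aone 1%g z = z.
Hypothesis m_adj : forall a g x y, dot (m a g x) y =
  dot x (m (star (sigma g^-1%g g) ** rho g^-1%g (star a)) g^-1%g y).

Let rhoA g a : calA a -> calA (rho g a).
Proof. by move=> Aa; rewrite -(hsmooth.1 g); exists a. Qed.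

Lemma msum_lin_in (c : C) S T : (msum @` Cc calA) S -> (msum @` Cc calA) T ->
  (msum @` Cc calA) (fun x => c *: S x + T x).
Proof.
move=> [f Cf <-] [f' Cf' <-]; have [r ur f0] := Cc_support Cf.
have [r' ur' f0'] := Cc_support Cf'; have [_ _ Alin _ _] := calA_alg.
exists (fun g => c *: f g + f' g).
  split; last by move=> g; apply: Alin; [exact: Cf.2|exact: Cf'.2].
  have fin : finite_set ([set g | f g != 0] `|` [set g | f' g != 0]).
    by rewrite finite_setU; split; [exact: Cf.1|exact: Cf'.1].
  apply: (sub_finite_set _ fin) => g /= h.
  have [fg|fg] := eqVneq (f g) 0; [right|by left].
  by move: h; rewrite fg scaler0 add0r.
pose s := undup (r ++ r').
have us : uniq s by exact: undup_uniq.
have sr g : g \notin s -> f g = 0 /\ f' g = 0.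
  by rewrite mem_undup mem_cat negb_or => /andP[/f0 -> /f0' ->].
rewrite (msum_seq us (f := f)); last by move=> g /sr[].
rewrite (msum_seq us (f := f')); last by move=> g /sr[].
rewrite (msum_seq us); last by move=> g /sr[-> ->]; rewrite scaler0 addr0.
apply/funext => z; rewrite scaler_sumr -big_split; apply: eq_bigr => g _.
exact: m_lin.
Qed.

Lemma msum_zero_in : (msum @` Cc calA) (fun=> 0).
Proof.
exists (fun=> 0).
  split; last by move=> g; exact: star_algebra_zero.
  by rewrite (_ : [set _ | _] = set0) //; apply/seteqP; split => g //=; rewrite eqxx.
by rewrite (msum_seq (r := [::])) //; apply/funext => z; rewrite big_nil.
Qed.

Lemma msum_star_algebra : star_algebra (msum @` Cc calA).
Proof.
have [_ A1 Alin Amul Astar] := calA_alg.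
split.
- move=> _ [f Cf <-]; apply: (msum_ind Cf) => //.
    by exact: bounded_op0.
  by move=> S T; exact: bounded_op_lin.
- rewrite (_ : id = m aone 1%g); last by apply/funext => z; rewrite m_one.
  exact: monomial_in.
- by move=> c S T; exact: msum_lin_in.
- move=> _ _ [f Cf <-] [f' Cf' <-].
  apply: (@msum_ind (fun S => (msum @` Cc calA) (S \o msum f')) f Cf) => [|S T SB TB|a g Aa].
  + exact: msum_zero_in.
  + exact: (msum_lin_in 1 SB TB).
  have bm := m_bounded a g.
  apply: (@msum_ind (fun T => (msum @` Cc calA) (m a g \o T)) f' Cf') => [|S T SB TB|b h Ab].
  + rewrite (_ : _ \o _ = fun=> 0); first exact: msum_zero_in.
    by apply/funext => z; rewrite /= (lin0 bm.1).
  + rewrite (_ : _ \o _ = fun x => 1 *: (m a g \o S) x + (m a g \o T) x).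
      exact: msum_lin_in.
    by apply/funext => z; rewrite /= bm.1.
  rewrite (_ : _ \o _ = m (a ** rho g b ** sigma g h) (g * h)%g).
    by apply: monomial_in; apply: (Amul); [apply: (Amul) => //; exact: rhoA|exact: hsmooth.2].
  by apply/funext => z; exact: m_mul.
- move=> _ [f Cf <-].
  apply: (@msum_ind (fun S => exists2 T, (msum @` Cc calA) T &
    forall x y, dot (S x) y = dot x (T y)) f Cf).
  + by exists (fun=> 0) => [|x y]; [exact: msum_zero_in|rewrite dot0l dot0r].
  + move=> S T [S' S'B SS'] [T' T'B TT'].
    exists (fun x => 1 *: S' x + T' x); first exact: msum_lin_in.
    by move=> x y; rewrite !scale1r dotDl dotDr SS' TT'.
  + move=> a g Aa; eexists; last by move=> x y; exact: m_adj.
    apply: monomial_in; apply: (Amul); first by apply: (Astar); exact: hsmooth.2.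
    by apply: rhoA; exact: Astar.
Qed.

End MonomialAlgebra.

Section Covariant.
Context {R : realType} {A : cstarType R} {G : groupType}.
Local Notation C := (R[i]).
Variables (rho : G -> A -> A) (sigma : G -> G -> A).
Variables (H : hilbertType R) (pi : A -> H -> H) (U : G -> H -> H).
Hypothesis hsys : twisted_dynamical_system rho sigma.
Hypothesis cov : covariant_representation rho sigma pi U.

Let pi_rep : representation pi. Proof. by have [] := cov. Qed.
Lemma pi_bounded a : bounded_op (pi a). Proof. by have [+ _ _ _ _] := pi_rep; apply. Qed.
Lemma pi_lin (c : C) a b x : pi (c *: a + b) x = c *: pi a x + pi b x.
Proof. by have [_ + _ _ _] := pi_rep; apply. Qed.
Lemma pi_mul a b x : pi (a ** b) x = pi a (pi b x).
Proof. by have [_ _ + _ _] := pi_rep; apply. Qed.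
Lemma pi_star a x y : dot (pi (star a) x) y = dot x (pi a y).
Proof. by have [_ _ _ + _] := pi_rep; apply. Qed.
Lemma pi_adj a x y : dot (pi a x) y = dot x (pi (star a) y).
Proof. by rewrite -pi_star starK. Qed.

Lemma pi_one x : pi aone x = x.
Proof.
have [_ _ _ _ dpi] := pi_rep.
apply: (total_ind dpi (subsp_eq_ops (pi_bounded aone) (bounded_op_id H))).
by move=> _ [a [y ->]] /=; rewrite -pi_mul amul1l.
Qed.

Lemma U_unitary g : unitary_op (U g). Proof. by have [_ + _ _] := cov; apply. Qed.
Lemma U_mul x y v : U x (U y v) = pi (sigma x y) (U (x * y)%g v).
Proof. by have [_ _ + _] := cov; apply. Qed.
Lemma U_pi x a v : U x (pi a v) = pi (rho x a) (U x v).
Proof. by have [_ _ _ h] := cov; rewrite h. Qed.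

Lemma U_linear g : linear (U g). Proof. by have [] := U_unitary g. Qed.
Lemma U_dot g x y : dot (U g x) (U g y) = dot x y. Proof. by have [_ + _] := U_unitary g; apply. Qed.
Lemma U_nrm2 g x : nrm2 (U g x) = nrm2 x. Proof. by rewrite /nrm2 U_dot. Qed.

Lemma U_bounded g : bounded_op (U g).
Proof.
apply/bounded_opP; split; first exact: U_linear.
by exists 1 => x; rewrite U_nrm2 mul1r.
Qed.

Lemma U_one v : U 1%g v = v.
Proof.
have [_ _ _ sig1 _] := hsys.
(* [U 1] is idempotent and isometric, hence the identity. *)
have h := U_mul 1%g 1%g v; rewrite mulg1 (sig1 1%g).1 pi_one in h.
apply/eqP; rewrite -subr_eq0 -nrm2_eq0 -(U_nrm2 1%g).
by rewrite (linB (U_linear _)) h subrr nrm20.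
Qed.

(** Twisting separates the inverse of [U g] from [U g^-1]: the product of [U g^-1] and [U g] is
    [pi (sigma g^-1 g)]. *)
Lemma U_adj g x y : dot (U g x) y =
  dot x (pi (star (sigma g^-1%g g)) (U g^-1%g y)).
Proof.
rewrite -pi_adj (_ : pi _ x = U g^-1%g (U g x)) ?U_dot //.
by rewrite U_mul mulVg U_one.
Qed.

Definition mono (a : A) (g : G) : H -> H := fun xi => pi a (U g xi).

Lemma mono_bounded a g : bounded_op (mono a g).
Proof. exact: (bounded_op_comp (pi_bounded a) (U_bounded g)). Qed.

Lemma mono_mul a g b h z :
  mono a g (mono b h z) = mono (a ** rho g b ** sigma g h) (g * h)%g z.
Proof. by rewrite /mono U_pi U_mul !pi_mul. Qed.

Lemma mono_one z : mono aone 1%g z = z.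
Proof. by rewrite /mono pi_one U_one. Qed.

Lemma mono_adj a g x y : dot (mono a g x) y =
  dot x (mono (star (sigma g^-1%g g) ** rho g^-1%g (star a)) g^-1%g y).
Proof. by rewrite /mono pi_adj U_adj U_pi pi_mul. Qed.

Lemma mono_lin (c : C) a b g z : mono (c *: a + b) g z = c *: mono a g z + mono b g z.
Proof. exact: pi_lin. Qed.

Lemma calBE calA : calB pi U calA = msum mono @` Cc calA.
Proof. by []. Qed.

Section Regular.
Local Arguments injb : simpl never.
Variables (V : hilbertType R) (l2 : ell2 (R := R) G) (L : hilbert_tensor l2 V).

Lemma lambda_ind (P : set L) : subsp P -> (forall x v, P (tens L (delta l2 x) v)) ->
  forall z, P z.
Proof.
move=> sP Pt; have [I [e oe]] := @exists_onb R V.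
by apply: (tens_ind_onb (delta_onb l2) oe).
Qed.

Lemma lambdaP g : bounded_op (lambda (L := L) g) /\
  forall x v, lambda (L := L) g (tens L (delta l2 x) v) = tens L (delta l2 (g * x)%g) v.
Proof.
have [S bS SE] := ex_shift l2 g.
have [T bT TE] := ex_tens_op L L bS (bounded_op_id V).
have TEx x v : T (tens L (delta l2 x) v) = tens L (delta l2 (g * x)%g) v.
  by rewrite TE SE.
suff -> : lambda (L := L) g = T by [].
apply: app_clspan => // [_ [x [v ->]] //=|P sP Pp].
apply: lambda_ind => // x v.
by apply: (Pp (tens L (delta l2 x) v, tens L (delta l2 (g * x)%g) v)); exists x, v.
Qed.

Variables (K : hilbert_tensor H L) (HH : hilbert_sum K K).

Definition gvec b xi x v : HH := injb HH b (tens K xi (tens L (delta l2 x) v)).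

Lemma gvec_ind (P : set HH) : subsp P -> (forall b xi x v, P (gvec b xi x v)) ->
  forall z, P z.
Proof.
move=> sP Pg; apply: sum_ind => // b z.
apply: (tens_ind (subsp_preim (injb_bounded HH b) sP)) => xi eta.
have bb := bounded_op_comp (injb_bounded HH b) (bounded_tens_r K xi).
by apply: (lambda_ind (subsp_preim bb sP)) => x v; exact: Pg.
Qed.

(** The shape required by [dirac_regular]: two copies of P (x) Q with P a monomial of the type
    generating [calB] and Q a translation, so that the two regularity hypotheses of (1) apply to P
    and Q separately. *)
Lemma hat_monomial_corner a h (p : bool -> HH -> K) :
  (forall b, bounded_op (p b)) ->
  (forall b c x, p b (injb HH c x) = if b == c then x else 0) ->
  exists X : K -> K, [/\ bounded_op X,
    forall x y, X (tens K x y) = tens K (mono a h x) (lambda (L := L) h y) &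
    hat_monomial pi U (HH := HH) a h = fun z => corner p true true X z + corner p false false X z].
Proof.
move=> bp pE.
have [X bX XE] := ex_tens_op K K (mono_bounded a h) (lambdaP h).1.
exists X; split => //.
pose T z := 1 *: corner p true true X z + corner p false false X z.
have bT : bounded_op T by apply: bounded_op_lin; exact: corner_bounded.
have -> : (fun z => corner p true true X z + corner p false false X z) = T.
  by apply/funext => z; rewrite /T scale1r.
have TE b xi x v : T (gvec b xi x v) = gvec b (mono a h xi) (h * x)%g v.
  rewrite /T /corner /gvec !pE scale1r.
  case: b => /=; rewrite ?(lin0 bX.1) ?(lin0 (injb_linear HH true)) ?(lin0 (injb_linear HH false));
    by rewrite ?addr0 ?add0r XE (lambdaP h).2.
apply: app_clspan => // [_ [xi [x [v [->|->]]]]|P sP Pp] /=.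
- exact: esym (TE true xi x v).
- exact: esym (TE false xi x v).
apply: gvec_ind => // b xi x v; case: b.
  by apply: (Pp (gvec true xi x v, gvec true (mono a h xi) (h * x)%g v)); exists xi, x, v; left.
by apply: (Pp (gvec false xi x v, gvec false (mono a h xi) (h * x)%g v)); exists xi, x, v; right.
Qed.

Local Notation hat := (hat_monomial pi U (HH := HH)).

Lemma hatP a h : bounded_op (hat a h) /\
  forall b xi x v, hat a h (gvec b xi x v) = gvec b (mono a h xi) (h * x)%g v.
Proof.
have [p [bp _ pE]] := ex_proj HH.
have [X [bX XE ->]] := hat_monomial_corner a h bp pE; split.
  under eq_fun do rewrite -[corner p true true X _]scale1r.
  by apply: bounded_op_lin; exact: corner_bounded.
move=> b xi x v; rewrite /corner /gvec !pE.
case: b => /=; rewrite ?(lin0 bX.1) ?(lin0 (injb_linear HH true)) ?(lin0 (injb_linear HH false));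
  by rewrite ?addr0 ?add0r XE (lambdaP h).2.
Qed.

Lemma hat_ext (S T : HH -> HH) : bounded_op S -> bounded_op T ->
  (forall b xi x v, S (gvec b xi x v) = T (gvec b xi x v)) -> forall z, S z = T z.
Proof. by move=> bS bT ST; apply: (gvec_ind (subsp_eq_ops bS bT)). Qed.

Lemma gvec_lin b (c : C) xi xi' x v :
  gvec b (c *: xi + xi') x v = c *: gvec b xi x v + gvec b xi' x v.
Proof. by rewrite /gvec tens_linear_l (injb_linear HH). Qed.

Lemma hat_lin (c : C) a b g z : hat (c *: a + b) g z = c *: hat a g z + hat b g z.
Proof.
apply: (hat_ext (hatP _ g).1 (bounded_op_lin c (hatP a g).1 (hatP b g).1)).
by move=> s xi x v; rewrite !(hatP _ g).2 -gvec_lin mono_lin.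
Qed.

Lemma hat_mul a g b h z :
  hat a g (hat b h z) = hat (a ** rho g b ** sigma g h) (g * h)%g z.
Proof.
apply: (hat_ext (bounded_op_comp (hatP a g).1 (hatP b h).1) (hatP _ (g * h)%g).1).
by move=> s xi x v; rewrite /= (hatP b h).2 (hatP a g).2 (hatP _ (g * h)%g).2 mono_mul mulgA.
Qed.

Lemma hat_one z : hat aone 1%g z = z.
Proof.
apply: (hat_ext (hatP _ 1%g).1 (bounded_op_id HH)).
by move=> s xi x v; rewrite (hatP _ 1%g).2 mono_one mul1g.
Qed.

Lemma subsp_dot_eq (X : hilbertType R) (S T : X -> X) y : bounded_op S -> 
  subsp [set x | dot (S x) y = dot x (T y)].
Proof.
move=> bS; split.
- apply: (closed_eqf (V := (C : numFieldType)) (f := fun x => dot (S x) y) (g := fun x => dot x (T y))).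
    exact: (continuous_dotl (bounded_op_continuous bS)).
  exact: dotl_continuous.
- by rewrite /= (lin0 bS.1) !dot0l.
- by move=> c x x' /= h h'; rewrite bS.1 !dotDl !dotZl h h'.
Qed.

Lemma subsp_dot_eq2 (X : hilbertType R) (S T : X -> X) x : bounded_op T -> 
  subsp [set y | dot (S x) y = dot x (T y)].
Proof.
move=> bT; split.
- apply: (closed_eqf (V := (C : numFieldType)) (f := fun y => dot (S x) y) (g := fun y => dot x (T y))).
    exact: dotr_continuous.
  exact: (continuous_dotr (bounded_op_continuous bT)).
- by rewrite /= (lin0 bT.1) !dot0r.
- by move=> c y y' /= h h'; rewrite bT.1 !dotDr !dotZr h h'.
Qed.

Lemma hat_adj a g x y : dot (hat a g x) y =
  dot x (hat (star (sigma g^-1%g g) ** rho g^-1%g (star a)) g^-1%g y).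
Proof.
set b := _ ** _; have [bS SE] := hatP a g; have [bT TE] := hatP b g^-1%g.
apply: (gvec_ind (subsp_dot_eq (hat b g^-1%g) y bS)) => s xi k v.
apply: (gvec_ind (subsp_dot_eq2 (hat a g) (gvec s xi k v) bT)) => s' xi' k' v' /=.
rewrite SE TE /gvec !dot_injb; case: eqP => // _.
rewrite !dot_tens !dot_delta mono_adj; congr (_ * ((nat_of_bool _)%:R * _)).
by apply/eqP/eqP => [<-|->]; rewrite ?mulKg ?mulVKg.
Qed.

Lemma hat_star_algebra calA : dense_star_subalgebra calA -> smooth calA rho sigma ->
  star_algebra (hat_rep pi U HH @` Cc calA).
Proof.
move=> cA sm; apply: (@msum_star_algebra _ _ _ _ rho sigma calA hat) => //.
- exact: hat_lin.
- by move=> a g; exact: (hatP a g).1.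
- exact: hat_mul.
- exact: hat_one.
- exact: hat_adj.
Qed.

End Regular.

Lemma calB_star_algebra calA : dense_star_subalgebra calA -> smooth calA rho sigma ->
  star_algebra (calB pi U calA).
Proof.
move=> cA sm; apply: (@msum_star_algebra _ _ _ _ rho sigma calA mono) => //.
- exact: mono_lin.
- exact: mono_bounded.
- exact: mono_mul.
- exact: mono_one.
- exact: mono_adj.
Qed.

End Covariant.

(** * Fell absorption *)

Lemma norm_eq_nrm2 (R : realType) (H K : hilbertType R) (x : H) (y : K) :
  nrm2 x = nrm2 y -> `|x| = `|y|.
Proof.
move=> xy; apply/eqP; rewrite -(eqrXn2 (n := 2)) //.
by rewrite !normr_nrm2 xy.
Qed.

Section Fell.
Context {R : realType} {A : cstarType R} {G : groupType}.
Local Notation C := (R[i]).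
Variables (rho : G -> A -> A) (sigma : G -> G -> A).
Variables (H : hilbertType R) (pi : A -> H -> H) (U : G -> H -> H).
Hypothesis hsys : twisted_dynamical_system rho sigma.
Hypothesis cov : covariant_representation rho sigma pi U.
Variables (V : hilbertType R) (l2 : ell2 (R := R) G) (L : hilbert_tensor l2 V).
Variables (K : hilbert_tensor H L) (HH : hilbert_sum K K) (HG : hilbert_tensor H l2).

Local Notation mono := (mono pi U).

Let Uinv g v := pi (star (sigma g^-1%g g)) (U g^-1%g v).

Let UinvK g v : Uinv g (U g v) = v.
Proof.
have [[_ us] _ _ _ _] := hsys.
by rewrite /Uinv (U_mul cov) mulVg (U_one hsys cov) -(pi_mul cov) (us _ _).1 (pi_one cov).
Qed.

Let UK g v : U g (Uinv g v) = v.
Proof.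
have [_ _ surj] := U_unitary cov g; have [w <-] := surj v.
by rewrite UinvK.
Qed.

Let Uinv_nrm2 g v : nrm2 (Uinv g v) = nrm2 v.
Proof. by rewrite -(U_nrm2 cov g) UK. Qed.

Let Uinv_linear g : linear (Uinv g).
Proof. by move=> c x y; rewrite /Uinv (U_linear cov) (pi_bounded cov _).1. Qed.

Lemma HG_ind (P : set HG) : subsp P -> (forall xi x, P (tens HG xi (delta l2 x))) ->
  forall z, P z.
Proof.
move=> sP Pt; have [I [e oe]] := @exists_onb R H.
by apply: (tens_ind_onb oe (delta_onb l2)).
Qed.

(* W (xi (x) delta_y) = U_(y^-1) xi (x) delta_y intertwines the left regular
   representation with a delta_x |-> pi(a) U_x (x) (translation by x). *)
Lemma fell_unitary : exists W W' : HG -> HG, [/\ bounded_op W, bounded_op W',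
  forall z, W' (W z) = z, forall z, nrm2 (W z) = nrm2 z &
  forall xi y, W (tens HG xi (delta l2 y)) = tens HG (U y^-1%g xi) (delta l2 y) /\
     W' (tens HG xi (delta l2 y)) = tens HG (Uinv y^-1%g xi) (delta l2 y)].
Proof.
have uB g x : nrm2 (U g^-1%g x) <= 1 * nrm2 x by rewrite (U_nrm2 cov) mul1r.
have uB' g x : nrm2 (Uinv g^-1%g x) <= 1 * nrm2 x by rewrite Uinv_nrm2 mul1r.
have [W bW WE] := ex_dsum_op HG ler01 (fun g => U_linear cov g^-1%g) uB.
have [W' bW' WE'] := ex_dsum_op HG ler01 (fun g => Uinv_linear g^-1%g) uB'.
have WW z : W' (W z) = z.
  apply: (HG_ind (subsp_eq_ops (bounded_op_comp bW' bW) (bounded_op_id HG))) => xi x.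
  by rewrite /= WE WE' UinvK.
have adj x y : dot (W x) y = dot x (W' y).
  apply: (HG_ind (subsp_dot_eq W' y bW)) => xi k.
  apply: (HG_ind (subsp_dot_eq2 W (tens HG xi (delta l2 k)) bW')) => xi' k' /=.
  rewrite WE WE' !dot_tens !dot_delta (U_adj hsys cov).
  by case: eqP => [->|_] //; rewrite !mulr0.
exists W, W'; split=> // z.
by rewrite /nrm2 adj WW.
Qed.

Lemma ex_translate a g : exists2 Lm : HG -> HG, bounded_op Lm &
  forall xi y, Lm (tens HG xi (delta l2 y)) = tens HG (mono a g xi) (delta l2 (g * y)%g).
Proof.
have [S bS SE] := ex_shift l2 g.
have [T bT TE] := ex_tens_op HG HG (mono_bounded cov a g) bS.
by exists T => // xi y; rewrite TE SE.
Qed.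

Lemma regular_monomialE (W W' Lm : HG -> HG) a g : bounded_op W -> bounded_op W' ->
  (forall xi y, W (tens HG xi (delta l2 y)) = tens HG (U y^-1%g xi) (delta l2 y) /\
     W' (tens HG xi (delta l2 y)) = tens HG (Uinv y^-1%g xi) (delta l2 y)) ->
  bounded_op Lm ->
  (forall xi y, Lm (tens HG xi (delta l2 y)) = tens HG (mono a g xi) (delta l2 (g * y)%g)) ->
  regular_monomial rho sigma pi (HG := HG) a g = fun z => W (Lm (W' z)).
Proof.
move=> bW bW' WE bLm LmE.
have bT := bounded_op_comp bW (bounded_op_comp bLm bW').
apply: app_clspan => // [_ [xi [y ->]]|P sP Pp] /=.
  (* With k = y^-1 g^-1, covariance gives U_k pi(a) U_g = pi(rho_k(a) sigma_(k,g)) U_(y^-1), and W'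
     cancels the last factor. *)
  rewrite (WE _ _).2 LmE (WE _ _).1; congr (tens HG _ _).
  rewrite /mono (U_pi cov) (U_mul cov) invgM mulgVK UK.
  by rewrite (pi_mul cov).
apply: HG_ind => // xi y.
apply: (Pp (tens HG xi (delta l2 y), tens HG
       (pi (rho (y^-1 * g^-1)%g a ** sigma (y^-1 * g^-1)%g g) xi)
       (delta l2 (g * y)%g))).
by exists xi, y.
Qed.

Let mono0 g xi : mono 0 g xi = 0.
Proof.
have := mono_lin cov 1 0 0 g xi; rewrite scaler0 addr0 scale1r => h.
by apply: (addrI (mono 0 g xi)); rewrite -h addr0.
Qed.

(** Copies of H (x) l^2(G) inside H (x) l^2(G) (x) V, one for each [v]; those of an orthonormal
    basis of V are mutually orthogonal and together total. *)
Lemma ex_amplify (v : V) : exists J : HG -> K, bounded_op J /\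
  forall xi y, J (tens HG xi (delta l2 y)) = tens K xi (tens L (delta l2 y) v).
Proof.
have [J bJ JE] := ex_tens_op HG K (bounded_op_id H) (bounded_tens_l L v).
by exists J; split => // xi y; rewrite JE.
Qed.

(** The left regular representation is unitarily conjugate to [Lam], and [hat_rep] is an orthogonal
    sum of copies of [Lam], indexed by the two summands and a basis of V. Hence any bound for the
    former holds for the latter. *)
Lemma fell_bound f M : Cc setT f -> bounded_by (left_regular rho sigma pi HG f) M ->
  bounded_by (hat_rep pi U HH f) M.
Proof.
move=> Cf fM; have [r ur f0] := Cc_support Cf.
have [W [W' [bW bW' WW Wn WE]]] := fell_unitary.
have exLm (g : G) : exists Lm : HG -> HG, bounded_op Lm /\
    forall xi y, Lm (tens HG xi (delta l2 y)) = tens HG (mono (f g) g xi) (delta l2 (g * y)%g).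
  by have [T bT TE] := ex_translate (f g) g; exists T.
have [Lm LmP] := choice exLm.
pose Lam z := \sum_(g <- r) Lm g z.
have bLm g : bounded_op (Lm g) by exact: (LmP g).1.
have bLam : bounded_op Lam by exact: bounded_op_sum.
have lregE z : left_regular rho sigma pi HG f (W z) = W (Lam z).
  have rE g : regular_monomial rho sigma pi (HG := HG) (f g) g = fun z => W (Lm g (W' z)).
    exact: (regular_monomialE bW bW' WE (bLm g) (LmP g).2).
  rewrite /left_regular (fsum_seq ur) => [|g gr].
    by rewrite /Lam (lin_sum bW.1); apply: eq_bigr => g _; rewrite rE WW.
  have Lm0 : Lm g z = 0.
    apply: (HG_ind (subsp_eq_ops (bLm g) bounded_op0)) => xi y.
    by rewrite /= (LmP g).2 f0 // mono0 (lin0 (bounded_tens_l HG _).1).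
  by rewrite rE WW Lm0 (lin0 bW.1).
have LamM z : `|Lam z| <= M * `|z|.
  by have := fM (W z); rewrite lregE (norm_eq_nrm2 (Wn _)) (norm_eq_nrm2 (Wn z)).
have hat0 : hat_rep pi U HH f 0 = 0.
  have h g : hat_monomial pi U (HH := HH) (f g) g 0 = 0.
    by rewrite (lin0 (hatP cov HH (f g) g).1.1).
  by rewrite /hat_rep fsbig1.
(* [M] is a priori any complex number; a nonzero vector of H forces it to be real and nonnegative.
   If there is none, all the spaces are zero. *)
have [[xi0 xi0N]|noxi] := pselect (exists xi : H, xi != 0); last first.
  have z0 (z : HH) : z = 0.
    apply: (gvec_ind (subsp_eq_ops (bounded_op_id HH) bounded_op0)) => b xi x v.
    have -> : xi = 0 by apply/eqP; apply: contrapT => /negP h; apply: noxi; exists xi.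
    by rewrite /gvec (lin0 (bounded_tens_l K _).1) (lin0 (injb_linear HH b)).
  by move=> z; rewrite (z0 z) hat0 normr0 mulr0.
have [B B0 MB] : exists2 B : R, 0 <= B & M = B%:C%C.
  have n0 : 0 < `|tens HG xi0 (delta l2 1%g)|.
    rewrite normr_gt0 -nrm2_eq0 nrm2_tens mulf_neq0 ?nrm2_eq0 //.
    by rewrite -nrm2_eq0 /nrm2 dot_delta eqxx oner_eq0.
  have M0 : 0 <= M by rewrite -(pmulr_lge0 _ n0); exact: le_trans (LamM _).
  exists (complex.Re M); last by rewrite RRe_real // ger0_real.
  by rewrite -ler0c RRe_real // ger0_real.
have LamB z : nrm2 (Lam z) <= B ^+ 2 * nrm2 z by rewrite -ler_norm_nrm2 // -MB.
have [p [bp pz pE]] := ex_proj HH.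
have exX (g : G) : exists X : K -> K, [/\ bounded_op X,
    forall x y, X (tens K x y) = tens K (mono (f g) g x) (lambda (L := L) g y) &
    hat_monomial pi U (HH := HH) (f g) g = fun z => corner p true true X z + corner p false false X z].
  exact: (hat_monomial_corner cov (f g) g bp pE).
have [X XP] := choice exX.
pose XS k := \sum_(g <- r) X g k.
have bX g : bounded_op (X g) by have [] := XP g.
have bXS : bounded_op XS by exact: bounded_op_sum.
have X0 g : g \notin r -> forall k, X g k = 0.
  move=> gr; apply: (tens_ind (subsp_eq_ops (bX g) bounded_op0)) => xi eta /=.
  have [_ -> _] := XP g.
  by rewrite f0 // mono0 (lin0 (bounded_tens_l K _).1).
have hatE z : hat_rep pi U HH f z = injb HH true (XS (p true z)) + injb HH false (XS (p false z)).
  rewrite /hat_rep (fsum_seq ur) => [|g gr].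
    rewrite /XS !(lin_sum (injb_linear HH _)) -big_split; apply: eq_bigr => g _.
    by have [_ _ ->] := XP g.
  have [_ _ ->] := XP g.
  by rewrite /corner !X0 // !(lin0 (injb_linear HH _)) addr0.
suff XSB k : nrm2 (XS k) <= B ^+ 2 * nrm2 k.
  move=> z; rewrite MB ler_norm_nrm2 // hatE.
  have o x y : dot (injb HH true x) (injb HH false y) = 0 by exact: dot_inj12.
  have n b x : nrm2 (injb HH b x) = nrm2 x by rewrite /nrm2 dot_injb eqxx.
  rewrite {3}(pz z) !nrm2D !o !mulr0 !addr0 !n mulrDr.
  by rewrite lerD.
have [I [e oe]] := @exists_onb R H; have [I' [v ov]] := @exists_onb R V.
have [J JP] := choice ex_amplify.
have bJ w : bounded_op (J w) by exact: (JP w).1.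
have JX w z : XS (J w z) = J w (Lam z).
  rewrite /XS /Lam (lin_sum (bJ w).1); apply: eq_bigr => g _.
  apply: (HG_ind (subsp_eq_ops (bounded_op_comp (bX g) (bJ w))
    (bounded_op_comp (bJ w) (bLm g)))) => xi y /=.
  have [_ XE _] := XP g.
  by rewrite (JP w).2 XE (LmP g).2 (JP w).2 (lambdaP L g).2.
have Jdot w w' z z' : dot (J w z) (J w' z') = dot z z' * dot w w'.
  have s1 y : subsp [set z | dot (J w z) (J w' y) = dot z y * dot w w'].
    split.
    - apply: (closed_eqf (V := (C : numFieldType)) (f := fun z => dot (J w z) (J w' y))
        (g := fun z => dot z y * dot w w')).
        exact: (continuous_dotl (bounded_op_continuous (bJ w))).
      by move=> x; apply: (@cvgM (C : numFieldType)); [exact: dotl_continuous|exact: cvg_cst].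
    - by rewrite /= (lin0 (bJ w).1) !dot0l mul0r.
    - by move=> c x x' /= h h'; rewrite (bJ w).1 !dotDl !dotZl h h'; ring.
  have s2 y : subsp [set z' | dot (J w y) (J w' z') = dot y z' * dot w w'].
    split.
    - apply: (closed_eqf (V := (C : numFieldType)) (f := fun z' => dot (J w y) (J w' z'))
        (g := fun z' => dot y z' * dot w w')).
        exact: (continuous_dotr (bounded_op_continuous (bJ w'))).
      by move=> x; apply: (@cvgM (C : numFieldType)); [exact: dotr_continuous|exact: cvg_cst].
    - by rewrite /= (lin0 (bJ w').1) !dot0r mul0r.
    - by move=> c x x' /= h h'; rewrite (bJ w').1 !dotDr !dotZr h h'; ring.
  apply: (HG_ind (s1 z')) => xi x; apply: (HG_ind (s2 (tens HG xi (delta l2 x)))) => xi' x' /=.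
  by rewrite !(JP _).2 !dot_tens mulrA.
have Jn s (y : I' -> HG) : uniq s ->
    nrm2 (\sum_(k <- s) J (v k) (y k)) = \sum_(k <- s) nrm2 (y k).
  move=> us; rewrite /nrm2 dot_suml Re_sum big_seq [RHS]big_seq; apply: eq_bigr => k' ks.
  rewrite dot_sumr (bigD1_seq k') //= Jdot ov.1 eqxx mulr1 big1 ?addr0 // => l lk.
  by rewrite Jdot ov.1 eq_sym (negPf lk) mulr0.
have oL : onb (fun x : G * I' => tens L (delta l2 x.1) (v x.2)).
  exact: tens_onb (delta_onb l2) ov.
have oK := tens_onb K oe oL.
have clP : closed [set k | nrm2 (XS k) - B ^+ 2 * nrm2 k <= 0].
  apply: (closed_preim (f := fun k => nrm2 (XS k) - B ^+ 2 * nrm2 k) (A := [set y | y <= 0])); last exact: closed_le.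
  move=> z; apply: cvgB.
    exact: (comp_continuous (@continuous_nrm2 R K) (bounded_op_continuous bXS)).
  by apply: cvgM; [exact: cvg_cst|exact: continuous_nrm2].
rewrite -subr_le0; apply: (closed_cvg _ clP _ _ (@fourier _ _ _ _ oK k)); near=> s.
set z := \sum_(_ <- s) _.
(* Collect the terms of the finite sum by their basis index in V. The groups [J (v k') (y k')] are
   orthogonal, and [XS] acts in each of them as [Lam]. *)
pose ks := undup [seq t.2.2 | t <- s].
pose y k' := \sum_(t <- s | t.2.2 == k') dot k (tens K (e t.1) (tens L (delta l2 t.2.1) (v t.2.2))) *:
   tens HG (e t.1) (delta l2 t.2.1).
have zE : z = \sum_(k' <- ks) J (v k') (y k').
  transitivity (\sum_(k' <- ks) \sum_(t <- s | t.2.2 == k')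
    dot k (tens K (e t.1) (tens L (delta l2 t.2.1) (v t.2.2))) *:
    tens K (e t.1) (tens L (delta l2 t.2.1) (v t.2.2))).
    under [RHS]eq_bigr do rewrite big_mkcond.
    rewrite exchange_big /=; apply: eq_big_seq => t ts.
    rewrite (bigD1_seq t.2.2) ?undup_uniq //=; last first.
      by rewrite mem_undup; apply/mapP; exists t.
    by rewrite eqxx big1 ?addr0 // => k'; rewrite eq_sym => /negPf ->.
  apply: eq_bigr => k' _; rewrite big_mkcond /y [in RHS]big_mkcond (lin_sum (bJ (v k')).1); apply: eq_bigr => t _.
  case: eqP => [<-|_]; last by rewrite (lin0 (bJ _).1).
  by rewrite (linZ (bJ _).1) (JP _).2.
have uks : uniq ks by exact: undup_uniq.
rewrite /= zE (lin_sum bXS.1) (eq_bigr (fun k' => J (v k') (Lam (y k')))); last by move=> k' _; rewrite JX.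
rewrite (Jn ks (fun k' => Lam (y k'))) // Jn // subr_le0 mulr_sumr.
by apply: ler_sum => k' _; exact: LamB.
Unshelve. all: by end_near.
Qed.

End Fell.

(** * Regularity of triples, generators and Sobolev orders *)

Section RegularTriples.
Context {R : realType} {H : hilbertType R} {I : choiceType}.
Local Notation C := (R[i]).
Variables (e : I -> H) (d : I -> R).
Hypothesis oe : onb e.
Local Notation D := (diagG e d).

Lemma regular_triple_op (B : set (H -> H)) T :
  regular_spectral_triple B D -> B T -> regular_op e d T.
Proof.
move=> [[_ _ _ Bbc] Breg] BT; have [dT dcT] := Breg _ BT.
by split => //; exact: Bbc.
Qed.

Lemma regular_triple_intro (B : set (H -> H)) : discrete d -> star_algebra B ->
  (forall T, B T -> regular_op e d T) -> regular_spectral_triple B D.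
Proof.
move=> dd sB Breg; split; last by move=> T /Breg[].
split=> //; [exact: self_adjoint_diagG|exact: compact_resolvent_diagG|].
by move=> T /Breg[].
Qed.

Lemma msum_regular (A : cstarType R) (G : groupType) (calA : set A) (m : A -> G -> H -> H) f :
  (forall (c : C) a b g z, m (c *: a + b) g z = c *: m a g z + m b g z) ->
  Cc calA f -> (forall a g, calA a -> regular_op e d (m a g)) ->
  regular_op e d (msum m f).
Proof.
move=> m_lin Cf mreg; apply: (msum_ind m_lin Cf) => //; first exact: regular_op0.
by move=> S T; exact: regular_op_lin.
Qed.

Lemma dom_delta_Op T : bounded_op T -> dom_delta_infty (absop D) T <->
  forall k, Op D k%:R (iter k (ad_Delta D) T).
Proof.
rewrite (absop_diagG oe) => bT; split => [dT k|OT].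
  have [_ sT] := (dom_delta_inftyP oe _ _).1 dT.
  exact: (sat_Op oe bT ((sat_wt_abs _ _).1 sT) k).
apply: (dom_delta_inftyP oe _ _).2; split => //.
exact: ((sat_wt_abs _ _).2 (Op_sat oe OT)).
Qed.

End RegularTriples.

Lemma lambda_in (R : realType) (G : groupType) (V : hilbertType R) (l2 : ell2 (R := R) G)
  (L : hilbert_tensor l2 V) (g : G) : lambda_Cc L (lambda (L := L) g).
Proof.
exists (fun h => if h == g then 1 else 0); first exact: Cc_single.
apply/funext => z; rewrite (fsum_seq (r := [:: g])) //.
  by rewrite big_seq1 eqxx scale1r.
by move=> h; rewrite inE => /negPf ->; rewrite scale0r.
Qed.
Theorem theorem4p5 (R : realType) (A : cstarType R) (G : groupType)
    (rho : G -> A -> A) (sigma : G -> G -> A)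
    (calA : set A) (H : hilbertType R) (D : graph H)
    (pi : A -> H -> H) (U : G -> H -> H)
    (V : hilbertType R) (ell : G -> V -> V)
    (sepA : separable_space A) (sepH : separable_space H)
    (hsys : twisted_dynamical_system rho sigma)
    (htriple : equivariant_spectral_triple rho sigma calA D pi U)
    (hfaithful : injective pi)
    (hsmooth : smooth calA rho sigma)
    (finV : finite_dimensional V)
    (hell : forall x, hermitian_op (ell x))
    (hproper : proper_length ell) (hbounded : translation_bounded ell) :
  [/\ (forall (l2 : ell2 (R := R) G) (L : hilbert_tensor l2 V)
          (K : hilbert_tensor H L) (HH : hilbert_sum K K)
          (HG : hilbert_tensor H l2),
        regular_spectral_triple (calB pi U calA) D ->
        regular_spectral_triple (lambda_Cc L) (Mell ell L) ->
        (* hat_rep is defined on the reduced twisted crossed product *)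
        (forall f M, Cc setT f ->
           bounded_by (left_regular rho sigma pi HG f) M ->
           bounded_by (hat_rep pi U HH f) M) /\
        regular_spectral_triple (hat_rep pi U HH @` Cc calA)
          (D_tilde ell D HH)),
      (regular_spectral_triple (pi @` calA) D ->
       (forall g, Op D 0 (U g)) ->
       (forall g, Op D 0 (comm_closure D (U g))) ->
       (forall k g, (0 < k)%N ->
          Op D k%:R (iter k (ad_Delta D) (U g)) /\
          Op D k%:R (iter k (ad_Delta D) (comm_closure D (U g)))) ->
       regular_spectral_triple (calB pi U calA) D)
    & (regular_spectral_triple (calB pi U calA) D ->
       [/\ regular_spectral_triple (pi @` calA) D,
           forall g, Op D 0 (U g),
           forall g, Op D 0 (comm_closure D (U g))
         & forall k g, (0 < k)%N ->
             Op D k%:R (iter k (ad_Delta D) (U g)) /\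
             Op D k%:R (iter k (ad_Delta D) (comm_closure D (U g)))])].
Proof.
have [cA [sA sD cD pibc] cov Ubc] := htriple.
have [I [e [d [oe DE dd]]]] := spectral_theorem sD cD; subst D.
have monoB a g : calA a -> calB pi U calA (mono pi U a g).
  by move=> Aa; rewrite calBE; exact: (monomial_in (mono_lin cov) cA g Aa).
have [_ A1 _ _ _] := cA.
split.
- move=> l2 L K HH HG rB rL; split; first by move=> f M; exact: fell_bound.
  (* Self-adjointness and compact resolvent of [Mell] are contained in the hypothesis on the second
     triple and give it an eigenbasis. *)
  have [[_ sM cM _] _] := rL.
  have [J [f [m [of_ ME dm]]]] := spectral_theorem sM cM.
  have -> : D_tilde ell (diagG e d) HH =
      diagG (dirac_vec HH e f d m) (dirac_eig d m).
    by rewrite -(dirac_diag HH d m oe of_) -ME.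
  rewrite ME in rL.
  have oD := dirac_onb HH d m oe of_.
  apply: (regular_triple_intro oD (dirac_discrete dd dm)).
    exact: (hat_star_algebra hsys cov HH cA hsmooth).
  move=> _ [c Cc <-]; apply: (msum_regular oD (hat_lin cov (HH := HH)) Cc) => a h Aa.
  have [p [bp _ pE]] := ex_proj HH.
  have [X [bX XE ->]] := hat_monomial_corner cov a h bp pE.
  apply: (dirac_regular oe of_ bp pE _ _ bX XE).
    exact: (regular_triple_op rB (monoB a h Aa)).
  exact: (regular_triple_op rL (lambda_in L h)).
- move=> rA OU ODU Oad.
  apply: (regular_triple_intro oe dd (calB_star_algebra hsys cov cA hsmooth)).
  rewrite calBE => _ [c Cc <-].
  apply: (msum_regular oe (mono_lin cov) Cc) => a g Aa.
  apply: (@regular_op_comp _ _ _ _ oe _ (pi a) (U g)).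
    by apply: regular_triple_op rA _; exists a.
  have bU := U_bounded cov g.
  have [_ bcU _ _] := bounded_comm_mx oe bU (bounded_comm_bdd oe bU (Ubc g)).
  (* The zeroth iterate is the operator itself, covered by the two order-zero assumptions; positive
     orders come from the commutator conditions. *)
  split=> //; apply/(dom_delta_Op d oe) => // -[|k]; [exact: OU| |exact: ODU|].
    by have [] := Oad k.+1 g isT.
  by have [] := Oad k.+1 g isT.
- move=> rB.
  (* [U g] and [pi a] are themselves elements of [calB], as the monomials with coefficient 1 and
     with group element e. *)
  have rU g : regular_op e d (U g).
    rewrite (_ : U g = mono pi U aone g); first exact: (regular_triple_op rB (monoB _ _ A1)).
    by apply/funext => x; rewrite /mono (pi_one cov).
  have rpi a : calA a -> regular_op e d (pi a).
    move=> Aa; rewrite (_ : pi a = mono pi U a 1%g).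
      exact: (regular_triple_op rB (monoB _ _ Aa)).
    by apply/funext => x; rewrite /mono (U_one hsys cov).
  have OU g k : Op (diagG e d) k%:R (iter k (ad_Delta (diagG e d)) (U g)).
    by have [_ dU _] := rU g; move: k; apply/(dom_delta_Op d oe) => //; exact: U_bounded cov g.
  have ODU g k : Op (diagG e d) k%:R
      (iter k (ad_Delta (diagG e d)) (comm_closure (diagG e d) (U g))).
    have [_ _ dU] := rU g; move: k; apply/(dom_delta_Op d oe) => //.
    exact: (dU 0%N).1.
  split.
  + by apply: (regular_triple_intro oe dd sA) => _ [a Aa <-]; exact: rpi.
  + by move=> g; exact: (OU g 0%N).
  + by move=> g; exact: (ODU g 0%N).
  + by move=> k g _; split; [exact: OU|exact: ODU].
Qed.
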